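(* Let $\nu = \exp(-W)\, dx$ be a log-concave probability measure on $\mathbb{R}^d$ with barycenter at the origin, having smooth positive density on its convex support $\Omega \subset \{x \in \mathbb{R}^d : |x| \le R\}$. Then for any $h \in C^1(\Omega)$, $$\mathrm{Var}_{\nu}(h) \le 2 \int_\Omega \Big\langle \Big( \frac{1}{2 R^2} \, \mathrm{Id}+ D^2 W \Big)^{-1} \nabla h, \nabla h \Big \rangle \, d \nu .$$
   Context: Derivatives, norms and scalar products are Euclidean. $\mathrm{Var}_\nu(h) = \int h^2 d\nu - (\int h\, d\nu)^2$. A measure $\nu$ supported on $\Omega\subset\mathbb{R}^d$ is log-concave if $\Omega$ is convex and on $\Omega$ one has $\nu=\exp(-W)dx$ with $W:\Omega\to\mathbb{R}$ convex. The barycenter of $\nu$ is $\int x\,d\nu(x)$. *)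

(* Defs.v *)
From HB Require Import structures.
From mathcomp Require Import all_boot all_order all_algebra.
From mathcomp Require Import all_classical all_reals all_analysis.

Set Implicit Arguments.
Unset Strict Implicit.
Unset Printing Implicit Defensive.

Import Order.TTheory GRing.Theory Num.Theory.
Import numFieldNormedType.Exports.

Local Open Scope classical_set_scope.
Local Open Scope ring_scope.

Definition rV_display : measure_display. Proof. exact. Qed.

Section rV_measurable.
Context (R : realType) (n : nat).

Let coor (i : 'I_n) (x : 'rV[R]_n) : measurableTypeR R := x ord0 i.

Let rV0 : g_sigma_preimage coor set0.
Proof. exact: sigma_algebra0. Qed.

Let rVC A : g_sigma_preimage coor A -> g_sigma_preimage coor (~` A).
Proof. exact: sigma_algebraC. Qed.

Let rVU (F : _^nat) : (forall i, g_sigma_preimage coor (F i)) ->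
  g_sigma_preimage coor (\bigcup_i (F i)).
Proof. exact: sigma_algebra_bigcup. Qed.

(* The product sigma-algebra on R^n; it is Borel's by [rV_borelE] below. *)
HB.instance Definition _ := @isMeasurable.Build rV_display 'rV[R]_n
  (g_sigma_preimage coor) rV0 rVC rVU.

Lemma measurable_coor (i : 'I_n) :
  measurable_fun [set: 'rV[R]_n]
    ((fun x => x ord0 i) : 'rV[R]_n -> measurableTypeR R).
Proof.
move=> _ Y mY; rewrite setTI; apply: sub_sigma_algebra => /=.
rewrite -bigcup_seq/=; exists i => /=; first by rewrite mem_index_enum.
by exists Y => //; rewrite setTI.
Qed.

Lemma measurable_fun_rV d (T : measurableType d) (f : T -> 'rV[R]_n) :
  (forall i, measurable_fun [set: T]
     ((fun t => f t ord0 i) : T -> measurableTypeR R)) ->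
  measurable_fun [set: T] f.
Proof.
move=> mf _ A mA; rewrite setTI; move: A mA.
suff : g_sigma_preimage (fun i => coor i \o f) `<=` measurable.
  by move=> + A mA; rewrite g_sigma_preimage_comp; apply; exists A; rewrite ?setTI.
apply: smallest_sub; first exact: sigma_algebra_measurable.
move: mf; rewrite /coor; clear; case: n f => [|m] f mf; first by rewrite big_ord0.
rewrite -bigcup_mkord_ord; apply: bigcup_sub => i Ii.
by move=> A [B mB <-]; exact: mf.
Qed.

End rV_measurable.

Lemma rV_borelE (R : realType) n :
  (@measurable _ 'rV[R]_n) = <<s @open 'rV[R]_n >>.
Proof.
apply/seteqP; split.
  apply: smallest_sub; first exact: smallest_sigma_algebra.
  apply: (@big_ind _ (fun G => G `<=` <<s @open 'rV[R]_n >>)) => //.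
    by move=> G H GS HS A [/GS|/HS].
  move=> i _ A [B mB <-]; rewrite setTI.
  have mcoor : measurable_fun setT ((fun x : g_sigma_algebraType (@open 'rV[R]_n) =>
      x ord0 i) : _ -> measurableTypeR R).
    have mG : @measurable _ (measurableTypeR R) = <<s @measurable_realfun.RGenOpens.G R >>.
      exact: measurable_realfun.RGenOpens.measurableE.
    apply: (@measurability _ _ (g_sigma_algebraType (@open 'rV[R]_n))
      (measurableTypeR R) setT _ _ mG) => _ [V [a [b ->]] <-]; rewrite setTI; apply: sub_sigma_algebra.
    by apply: open_comp => // x _; exact: coord_continuous.
  by rewrite -[_ @^-1` _]setTI; exact: mcoor.
apply: smallest_sub; first exact: sigma_algebra_measurable.
move=> U oU.
pose B (q : 'rV[rat]_n) (m : nat) : set 'rV[R]_n :=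
  [set x | forall i, ball (ratr (q ord0 i) : R) m.+1%:R^-1 (x ord0 i)].
have mB q m : measurable (B q m).
  rewrite (_ : B q m = \bigcap_(i in [set: 'I_n])
      ((fun x : 'rV[R]_n => x ord0 i : measurableTypeR R) @^-1`
         ball (ratr (q ord0 i) : R) m.+1%:R^-1)).
    apply: fin_bigcap_measurable => // i _.
    rewrite -[X in measurable X]setTI; apply: measurable_coor => //.
    by rewrite ball_itv; exact: measurable_itv.
  by apply/seteqP; split => x Bx i; [move=> _|]; apply: Bx.
pose F k := if unpickle k is Some (q, m) then
  (if `[< B q m `<=` U >] then B q m else set0) else set0.
rewrite (_ : U = \bigcup_k F k); last first.
  apply/seteqP; split => [x Ux|x [k _]]; last first.
    rewrite /F; case: unpickle => [[q m]|//].
    by case: asboolP => // BU /BU.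
  have /nbhs_ballP[e /= e0 eU] : nbhs x U by exact: open_nbhs_nbhs.
  have [m me] : exists m, m.+1%:R^-1 < e / 2.
    have e20 : 0 < e / 2 by rewrite divr_gt0.
    by have [m _ /(_ _ (leqnn m))] := near_infty_natSinv_lt (PosNum e20); exists m.
  have Q i : exists q : rat, ball (ratr q : R) m.+1%:R^-1 (x ord0 i).
    have m0 : 0 < m.+1%:R^-1 :> R by rewrite invr_gt0.
    have [|q] := @rat_in_itvoo R (x ord0 i - m.+1%:R^-1) (x ord0 i + m.+1%:R^-1).
      by rewrite ltrBlDr -addrA ltrDl addr_gt0.
    rewrite in_itv/= => /andP[q1 q2]; exists q.
    by rewrite /ball/= distrC ltr_distlC; apply/andP.
  have /choice[q qP] := Q.
  exists (pickle (\row_i q i, m)) => //; rewrite /F pickleK asboolT.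
    by move=> i; rewrite mxE.
  move=> y By; apply: eU; split => // i j; rewrite (ord1 i).
  have := By j; rewrite mxE => yj.
  exact: ball_splitr (le_ball (ltW me) (qP j)) (le_ball (ltW me) yj).
apply: bigcupT_measurable => k; rewrite /F; case: unpickle => [[q m]|//].
by case: asboolP.
Qed.

Section rV_cons.
Context (R : realType) (n : nat).

Definition rV_cons (p : measurableTypeR R * 'rV[R]_n) : 'rV[R]_n.+1 :=
  \row_i (if unlift ord0 i is Some j then p.2 ord0 j else p.1).

Definition rV_uncons (x : 'rV[R]_n.+1) : measurableTypeR R * 'rV[R]_n :=
  (x ord0 ord0, \row_j x ord0 (lift ord0 j)).

Lemma rV_consK : cancel rV_cons rV_uncons.
Proof.
move=> [a v]; rewrite /rV_uncons !mxE unlift_none; congr pair.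
by apply/rowP => j; rewrite !mxE liftK.
Qed.

Lemma measurable_rV_cons :
  measurable_fun [set: measurableTypeR R * 'rV[R]_n] rV_cons.
Proof.
apply: measurable_fun_rV => i.
rewrite (_ : (fun _ => _) = fun p : measurableTypeR R * 'rV[R]_n =>
   if unlift ord0 i is Some j then p.2 ord0 j : measurableTypeR R else p.1).
  case: unliftP => [j _|_]; last exact: measurable_fst.
  exact: (measurableT_comp (measurable_coor j)).
by apply/funext => p; rewrite mxE.
Qed.

Lemma measurable_rV_uncons : measurable_fun [set: 'rV[R]_n.+1] rV_uncons.
Proof.
apply: measurable_fun_pair; first exact: measurable_coor.
apply: measurable_fun_rV => i.
rewrite (_ : (fun _ => _) =
  fun x : 'rV[R]_n.+1 => x ord0 (lift ord0 i) : measurableTypeR R).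
  exact: measurable_coor.
by apply/funext => p; rewrite mxE.
Qed.

End rV_cons.

Section lebesgue_rV_succ.
Context (R : realType) (n : nat).
Variable mu : {sigma_finite_measure set 'rV[R]_n -> \bar R}.

Definition lebesgue_rV_succ : set 'rV[R]_n.+1 -> \bar R :=
  pushforward (@lebesgue_measure R \x mu)%E (@rV_cons R n).

Let succ0 : lebesgue_rV_succ set0 = 0%E.
Proof. by rewrite /lebesgue_rV_succ /pushforward preimage_set0 measure0. Qed.

Let succ_ge0 A : (0 <= lebesgue_rV_succ A)%E.
Proof. by apply: measure_ge0; exact: measurable_rV_cons. Qed.

Let succ_sigma_additive : semi_sigma_additive lebesgue_rV_succ.
Proof.
by apply: measure_semi_sigma_additive; exact: measurable_rV_cons.
Qed.

HB.instance Definition _ := isMeasure.Build _ _ _ lebesgue_rV_succ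
  succ0 succ_ge0 succ_sigma_additive.

Let sigma_finite_succ : sigma_finite setT lebesgue_rV_succ.
Proof.
have /sigma_finiteP[F [TF ndF Foo]] := sigma_finiteT (@lebesgue_measure R).
have /sigma_finiteP[G [TG ndG Goo]] := sigma_finiteT mu.
exists (fun k => @rV_uncons R n @^-1` (F k `*` G k)).
  rewrite -preimage_bigcup (_ : \bigcup_k _ = setT) ?preimage_setT//.
  apply/seteqP; split => // -[x y] _.
  have [k _ Fkx] : (\bigcup_i F i) x by rewrite -TF.
  have [l _ Gly] : (\bigcup_i G i) y by rewrite -TG.
  exists (maxn k l) => //; split.
  - by move: x Fkx; exact/subsetPset/ndF/leq_maxl.
  - by move: y Gly; exact/subsetPset/ndG/leq_maxr.
move=> k; have [mF Fk] := Foo k; have [mG Gk] := Goo k; split.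
  by rewrite -[X in measurable X]setTI; apply: measurable_rV_uncons => //;
    exact: measurableX.
rewrite /lebesgue_rV_succ /pushforward -comp_preimage.
rewrite (_ : _ \o _ = id) ?preimage_id; last first.
  by apply/funext => p /=; rewrite rV_consK.
by rewrite product_measure1E// lte_mul_pinfty// ge0_fin_numE.
Qed.

HB.instance Definition _ :=
  Measure_isSigmaFinite.Build _ _ _ lebesgue_rV_succ sigma_finite_succ.

End lebesgue_rV_succ.

Fixpoint lebesgue_rV (R : realType) (n : nat) :
    {sigma_finite_measure set 'rV[R]_n -> \bar R} :=
  if n is m.+1 then lebesgue_rV_succ (lebesgue_rV R m) else \d_ (0 : 'rV[R]_0).

Lemma lebesgue_rV_box (R : realType) n (A : 'I_n -> set (measurableTypeR R)) :
  (forall i, measurable (A i)) ->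
  lebesgue_rV R n [set x | forall i, A i (x ord0 i)] =
  (\prod_(i < n) lebesgue_measure (A i))%E.
Proof.
elim: n A => [|n IH] A mA.
  rewrite big_ord0 (_ : [set _ | _] = setT); first by rewrite /= diracT.
  by apply/seteqP; split => // x _ [].
rewrite big_ord_recl -IH// /= /lebesgue_rV_succ /pushforward.
have mB : measurable [set x : 'rV[R]_n | forall i, A (lift ord0 i) (x ord0 i)].
  rewrite (_ : [set _ | _] = \bigcap_(i in [set: 'I_n])
      ((fun x : 'rV[R]_n => x ord0 i : measurableTypeR R) @^-1` A (lift ord0 i))).
    apply: fin_bigcap_measurable => // i _.
    by rewrite -[X in measurable X]setTI; apply: measurable_coor.
  by apply/seteqP; split => x Ax i; [move=> _|]; apply: Ax.
rewrite -product_measure1E//.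
congr (_ _); apply/seteqP; split => [[a v] H|[a v] [Ha Hv] i] /=.
  split; first by have := H ord0; rewrite mxE unlift_none.
  by move=> i; have := H (lift ord0 i); rewrite mxE liftK.
by rewrite mxE; case: unliftP => [j ->|->].
Qed.

Section calculus.
Context (R : realType) (d : nat).
Implicit Types (f g : 'rV[R]_d -> R) (D : set 'rV[R]_d) (x y : 'rV[R]_d).

(* The norm [`| x |] that MathComp-Analysis puts on ['rV[R]_d] is the sup norm;
   it induces the same topology, but is not the Euclidean norm [enorm]. *)
Definition dotp x y : R := \sum_i x ord0 i * y ord0 i.
Definition enorm x : R := Num.sqrt (dotp x x).

Definition partial (i : 'I_d) f : 'rV[R]_d -> R := 'D_(delta_mx ord0 i) f.

(* [ipartial [:: i; j] f] is the second derivative d_i (d_j f). *)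
Definition ipartial (s : seq 'I_d) f : 'rV[R]_d -> R := foldr partial f s.

(* C^k(D) for a convex set D with nonempty interior, open or not: the partial
   derivatives of order at most k exist in the interior of D and have
   continuous extensions to D. The values of f outside D play no role. *)
Definition Ck_on (k : nat) D f :=
  {within D, continuous f} /\
  forall (s : seq 'I_d) (i : 'I_d), (size s < k)%N ->
    (forall x, D° x -> derivable (ipartial s f) x (delta_mx ord0 i)) /\
    exists2 g : 'rV[R]_d -> R, {within D, continuous g} &
      forall x, D° x -> g x = ipartial (i :: s) f x.

Definition smooth_on D f := forall k, Ck_on k D f.

(* The continuous extension of an iterated partial derivative to the points of
   D that lie on its boundary; see [ipartial_onE] for the interior. *)
Definition ipartial_on D (s : seq 'I_d) f x : R :=
  lim (ipartial s f y @[y --> within D° (nbhs x)]).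

Definition grad_on D f x : 'rV[R]_d := \row_i ipartial_on D [:: i] f x.

Definition hess_on D f x : 'M[R]_d := \matrix_(i, j) ipartial_on D [:: i; j] f x.

Lemma ipartial_onE k D f (s : seq 'I_d) x : Ck_on k D f -> (size s <= k)%N ->
  D° x -> ipartial_on D s f x = ipartial s f x.
Proof.
move=> [fc fk] sk Dx.
have Dnx : nbhs x D°.
  by apply: open_nbhs_nbhs; split => //; exact: open_interior.
have [g gc gE] : exists2 g : 'rV[R]_d -> R, {within D, continuous g} &
    forall y, D° y -> g y = ipartial s f y.
  case: s sk => [|i s] sk; first by exists f.
  by have [] := fk s i sk.
have gx : g y @[y --> x] --> g x.
  by move: (gc x); rewrite /continuous_at -(nbhs_subspace_interior Dx).
rewrite /ipartial_on within_interior//; apply: cvg_lim => //.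
rewrite -(gE _ Dx); apply: cvg_trans gx; apply: near_eq_cvg.
by near=> y; apply: gE; near: y.
Unshelve. all: by end_near. Qed.

End calculus.

Section log_concave.
Context (R : realType) (d : nat).
Implicit Types (nu : probability 'rV[R]_d R) (D : set 'rV[R]_d).

Definition density_on nu D (rho : 'rV[R]_d -> R) :=
  forall A, measurable A ->
    nu A = (\int[lebesgue_rV R d]_(x in A `&` D) (rho x)%:E)%E.

(* Only the values of W on D matter. The density is positive on D, and zero
   outside, because W is real-valued. *)
Definition log_concave nu D (W : 'rV[R]_d -> R) :=
  [/\ convex_set D, convex_function D W & density_on nu D (fun x => expR (- W x))].

Definition barycenter nu : 'rV[R]_d := \row_i (\int[nu]_x (x ord0 i))%R.

(* The variance of a function on D, for nu concentrated on D. It is +oo when h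
   is not square integrable, since the real-valued integral is then a real
   number in any case. *)
Definition variance_on nu D (h : 'rV[R]_d -> R) : \bar R :=
  (\int[nu]_(x in D) (h x ^+ 2)%:E - ((\int[nu]_(x in D) h x)%R ^+ 2)%:E)%E.

End log_concave.

(* Main.v *)
(* The Brascamp-Lieb inequality
     Var(h) <= int <(D^2 V)^-1 grad h, grad h>
   for a density exp(-V) with D^2 V positive definite is the second-order
   expansion, as e -> 0, of the Prekopa-Leindler inequality applied to
   exp(e h - V), exp(-e h - V) and their midpoint supremum, which is
   exp(e^2 <(D^2 V)^-1 grad h, grad h> / 2 + o(e^2) - V) (Bobkov-Ledoux).
   It is applied to V = W + |x|^2 / (4 r^2), for which D^2 V = Id / (2 r^2) + D^2 W.
   On the ball |x| <= r the densities exp(-V) and exp(-W) differ by a factor at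
   most exp(1/4) <= 2, and a variance is an infimum over constants, so exchanging
   them costs the factor 2 (Holley-Stroock); the barycenter plays no role.
   The expansion is uniform on a compact convex K inside the interior of Omega;
   the convex cores {x | ball x (1/n) in Omega} exhaust Omega up to its
   boundary, which is Lebesgue-null, again by Prekopa-Leindler. *)
Require Import Defs.
From mathcomp Require Import all_boot all_order all_algebra.
From mathcomp Require Import all_classical all_reals all_analysis.
From mathcomp Require Import measurable_realfun.
From mathcomp Require Import ring lra.
Import Order.TTheory GRing.Theory Num.Theory.
Import numFieldNormedType.Exports.
Local Open Scope classical_set_scope.
Local Open Scope ring_scope.

(** Prekopa-Leindler asks for no boundary condition and, beyond measurability, for no regularity of
    the integrands, so it can be used on a compact piece of [Omega] with the functions set to zero
    outside. The midpoint supremum is never formed, which spares its measurability: an explicit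
    function bounds the exponent for all [x] and [y] at once. With [z] the midpoint and [v] half the
    difference, Taylor's formula serves when [v] is small; otherwise the term [c * dotp v v] of the
    potential exceeds [e] times the oscillation of [h]. The remainder o(e^2) is traded for a
    parameter [de]: a share [de] of the quadratic form absorbs the Taylor errors. Then [e] tends to
    zero first, and [de] afterwards. At the boundary the obstacle is that [Omega] need not be
    closed: [h] may be unbounded and is not known to be square integrable, and the constant
    subtracted from [h] changes with the core. The passage to the limit has to show that these
    constants stay bounded and that [h] is square integrable. *)

(** * Brunn-Minkowski inequality for midpoints on the line *)

Section brunn_minkowski_1d.
Context (R : realType).
Local Notation mR := (measurableTypeR R).
Local Notation lam := (@lebesgue_measure R).
Implicit Types (A B C : set mR).

Lemma measurable_midpoint (a : R) :
  measurable_fun [set: mR] ((fun x : mR => (x + a) / 2) : mR -> mR).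
Proof.
apply: (@continuous_measurable_fun R) => x.
by apply: cvgMl; apply: cvgD => //; exact: cvg_cst.
Qed.

(** Half the image of Lebesgue measure under the midpoint map gives every half-open interval its
    length, so it is Lebesgue measure by uniqueness. *)
Lemma lebesgue_measure_midpoint (a : R) C : measurable C ->
  lam ((fun x : mR => (x + a) / 2 : mR) @^-1` C) = (2%:E * lam C)%E.
Proof.
move=> mC; have half0 : (0 <= 2^-1 :> R)%R by [].
pose phi : mR -> mR := fun x => (x + a) / 2.
have H (m : {measure set mR -> \bar R}) : m = pushforward lam phi :> (set _ -> _) ->
      lam C = (2^-1%:E * m C)%E.
  move=> mE; apply: (@lebesgue_measure_unique R (mscale (NngNum half0) m)) => //.
  move=> _ [[x y] _ <-]; rewrite -[RHS]/(2^-1%:E * m `]x, y]%classic)%E mE /pushforward.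
  rewrite (_ : _ @^-1` _ = `](2 * x - a), (2 * y - a)]%classic); last first.
    apply/seteqP; split => z /=; rewrite !in_itv/= => /andP[]; rewrite /phi => ? ?;
      by apply/andP; split; rewrite ?/phi; lra.
  rewrite !lebesgue_measure_itv/= !lte_fin.
  have -> : (2 * x - a < 2 * y - a) = (x < y) by apply/idP/idP; lra.
  case: ifP => _; last by rewrite mule0.
  by rewrite -!EFinD -EFinM; congr EFin; lra.
rewrite (H (pushforward lam phi) erefl); first exact: measurable_midpoint.
by move=> mphi; rewrite muleA -EFinM divff// mul1e.
Qed.

(** For [a] in [A] near its supremum and [b] in [B] near its infimum, [(A + b) / 2] and
    [(a + B) / 2] both lie in [C] and have half the measure of [A] and [B]. The second lies above
    [p], the first below [(s + b) / 2], so they overlap at most in the interval [I], of length at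
    most [e / 2]. *)
Lemma brunn_minkowski_1d_bounded A B C : measurable A -> measurable B ->
  measurable C -> A !=set0 -> B !=set0 -> has_ubound A -> has_lbound B ->
  (forall a b, A a -> B b -> C ((a + b) / 2)) ->
  (lam A + lam B <= 2%:E * lam C)%E.
Proof.
move=> mA mB mC A0 B0 ubA lbB ABC; apply/lee_addgt0Pr => e e0.
have e20 : 0 < e / 2 by rewrite divr_gt0.
have [a Aa ae] := sup_adherent e20 (conj A0 ubA).
have [b Bb be] := inf_adherent e20 (conj B0 lbB).
set s := sup A in ae; set t := inf B in be; pose p := (t + a) / 2.
pose C1 : set mR := C `&` `]-oo, p[; pose C2 : set mR := C `&` `[p, +oo[.
pose I : set mR := `[p, (s + b) / 2]%classic.
have mC1 : measurable C1 by apply: measurableI.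
have mC2 : measurable C2 by apply: measurableI.
have mI : measurable I by exact: measurable_itv.
have mphi c D : measurable D -> measurable ((fun x : mR => (x + c) / 2 : mR) @^-1` D).
  by move=> mD; rewrite -[X in measurable X]setTI; exact: measurable_midpoint.
have lA : (lam A <= 2%:E * (lam C1 + lam I))%E.
  apply: (@le_trans _ _ (2%:E * lam (C1 `|` I))%E); last first.
    by rewrite lee_pmul2l//; apply: (@measureU2 _ _ _ lam).
  rewrite -(lebesgue_measure_midpoint b); last exact: measurableU.
  apply: le_measure; rewrite ?inE//; first by apply: mphi; exact: measurableU.
  move=> x Ax /=; have [xp|px] := ltP ((x + b) / 2) p.
    by left; split; [exact: ABC|rewrite /= in_itv].
  right; rewrite /I /= in_itv/= px/= ler_pM2r// lerD2r.
  exact: ub_le_sup.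
have lB : (lam B <= 2%:E * lam C2)%E.
  rewrite -(lebesgue_measure_midpoint a)//.
  apply: le_measure; rewrite ?inE//; first exact: mphi.
  move=> x Bx /=; split; first by rewrite addrC; exact: ABC.
  by rewrite /= in_itv/= andbT ler_pM2r// lerD2r; exact: ge_inf.
have lC : lam C = (lam C1 + lam C2)%E.
  rewrite -measureU//.
    congr (lam _); rewrite -setIUr; apply/esym/setIidPl => x _ /=.
    by rewrite !in_itv/= andbT; case: ltP => _; [left|right].
  apply/seteqP; split => // x [[_ /=]]; rewrite !in_itv/= => xp [_ /=].
  by rewrite in_itv/= andbT leNgt xp.
have lI : (lam I <= (e / 2)%:E)%E.
  rewrite lebesgue_measure_itv/=; case: ifP => [_|_]; last first.
    by rewrite lee_fin; lra.
  by rewrite -EFinB lee_fin /p; lra.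
apply: (le_trans (leeD lA lB)); rewrite lC !ge0_muleDr// addeAC leeD2l//.
rewrite (_ : e%:E = 2%:E * (e / 2)%:E)%E ?lee_pmul2l// -EFinM.
by congr EFin; lra.
Qed.

(** Continuity of the measure along one-sided truncations: only the upper end of [A] and the lower
    end of [B] have to be finite. *)
Lemma brunn_minkowski_1d A B C : measurable A -> measurable B ->
  measurable C -> A !=set0 -> B !=set0 ->
  (forall a b, A a -> B b -> C ((a + b) / 2)) ->
  (lam A + lam B <= 2%:E * lam C)%E.
Proof.
move=> mA mB mC [a Aa] [b Bb] ABC.
pose A_ n : set mR := A `&` `]-oo, n%:R]; pose B_ n : set mR := B `&` `[- n%:R, +oo[.
have mA_ n : measurable (A_ n) by apply: measurableI.
have mB_ n : measurable (B_ n) by apply: measurableI.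
have cA : lam (A_ n) @[n --> \oo] --> lam A.
  rewrite (_ : A = \bigcup_n A_ n).
    apply: nondecreasing_cvg_mu => //; first exact: bigcup_measurable.
    move=> m n mn; apply/subsetPset => x [Ax]/=; rewrite in_itv/= => xm.
    by split => //=; rewrite in_itv/= (le_trans xm)// ler_nat.
  apply/seteqP; split => [x Ax|x [n _ []]//].
  exists (Num.truncn `|x|).+1 => //; split => //=; rewrite in_itv/=.
  by rewrite (le_trans (ler_norm _))// ltW// truncnS_gt.
have cB : lam (B_ n) @[n --> \oo] --> lam B.
  rewrite (_ : B = \bigcup_n B_ n).
    apply: nondecreasing_cvg_mu => //; first exact: bigcup_measurable.
    move=> m n mn; apply/subsetPset => x [Bx]/=; rewrite !in_itv/= !andbT => xm.
    by split => //=; rewrite in_itv/= andbT (le_trans _ xm)// lerN2 ler_nat.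
  apply/seteqP; split => [x Bx|x [n _ []]//].
  exists (Num.truncn `|x|).+1 => //; split => //=; rewrite in_itv/= andbT.
  by rewrite lerNl (le_trans (ler_norm _))// normrN ltW// truncnS_gt.
have cAB : (lam (A_ n) + lam (B_ n))%E @[n --> \oo] --> (lam A + lam B)%E.
  by apply: cvgeD => //; apply: ge0_adde_def; rewrite inE.
rewrite -(cvg_lim _ cAB)//; apply: lime_le; first by apply/cvg_ex; eexists; exact: cAB.
near=> n; apply: brunn_minkowski_1d_bounded => //.
- exists a; split => //=; rewrite in_itv/= (le_trans (ler_norm _))// ltW//.
  by near: n; exact: nbhs_infty_gtr.
- exists b; split => //=; rewrite in_itv/= andbT lerNl (le_trans (ler_norm _))// normrN ltW//.
  by near: n; exact: nbhs_infty_gtr.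
- by exists n%:R => x [_] /=; rewrite in_itv.
- by exists (- n%:R) => x [_] /=; rewrite in_itv/= andbT.
- by move=> x y [Ax _] [By _]; exact: ABC.
Unshelve. all: by end_near. Qed.

End brunn_minkowski_1d.

(** * Layer-cake formula *)

Section layer_cake.
Context d (T : measurableType d) (R : realType).
Variable mu : {sigma_finite_measure set T -> \bar R}.

(** Both sides are the measure of the region [E] under the graph of [f], computed by Tonelli in the
    two orders. *)
Lemma layer_cake (f : T -> measurableTypeR R) : measurable_fun setT f ->
  (forall x, 0 <= f x) ->
  (\int[mu]_x (f x)%:E =
   \int[@lebesgue_measure R]_(t in `[0%R, +oo[) mu [set x | (t < f x)%R])%E.
Proof.
move=> mf f0.
pose E : set (T * measurableTypeR R) := [set z | 0 <= z.2 < f z.1].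
have mE : measurable E.
  rewrite (_ : E = (snd @^-1` `[0%R, +oo[%classic) `&`
     ((fun z : T * measurableTypeR R => f z.1 - z.2) @^-1` `]0%R, +oo[%classic)); last first.
    apply/seteqP; split => z; rewrite /E /= !in_itv/= !andbT subr_gt0.
      by move/andP.
    by case=> -> ->.
  apply: measurableI; rewrite -[X in measurable X]setTI.
    exact: (@measurable_snd _ _ T (measurableTypeR R)).
  apply: (measurable_funB (measurableT_comp mf measurable_fst) measurable_snd) => //.
have := @indic_fubini_tonelli _ _ _ _ _ mu (@lebesgue_measure R) E mE.
rewrite indic_fubini_tonelli_FE// indic_fubini_tonelli_GE//= => EE.
transitivity (\int[mu]_x @lebesgue_measure R (xsection E x))%E.
  apply: eq_integral => x _ /=; rewrite (_ : xsection E x = `[0, f x[%classic).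
    rewrite lebesgue_measure_itv/= lte_fin oppr0 adde0; case: ltP => // f_le0.
    by congr EFin; apply/eqP; rewrite eq_le f_le0 f0.
  by apply/seteqP; split => t; rewrite /xsection/= inE /E/= in_itv.
rewrite EE [RHS]integral_mkcond; apply: eq_integral => t _; rewrite patchE.
case: ifPn; rewrite ?inE ?notin_setE/= in_itv/= andbT => t0.
  by congr (mu _); apply/seteqP; split => x; rewrite /ysection/= inE /E/= t0.
rewrite (_ : ysection _ _ = set0) ?measure0//; apply/seteqP; split => // x.
by rewrite /ysection/= inE /E/= => /andP[/t0].
Qed.

End layer_cake.

(** * Prekopa-Leindler inequality on the line *)

Section prekopa_leindler_1d.
Context (R : realType).
Local Notation mR := (measurableTypeR R).
Local Notation lam := (@lebesgue_measure R).

(** If [f x] and [g y] exceed [t], so does [m] at the midpoint; hence Brunn-Minkowski applies to the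
    superlevel sets, and the layer-cake formula integrates it over [t]. Brunn-Minkowski needs
    nonempty sets, which is why both suprema are normalized to 1: below height 1 neither set is
    empty, from 1 on both are. *)
Lemma prekopa_leindler_1d_normalized (f g m : mR -> mR) :
  measurable_fun setT f -> measurable_fun setT g -> measurable_fun setT m ->
  (forall x, 0 <= f x <= 1) -> (forall x, 0 <= g x <= 1) ->
  (forall x, 0 <= m x) ->
  (forall t, t < 1 -> exists x, t < f x) ->
  (forall t, t < 1 -> exists x, t < g x) ->
  (forall x y, f x * g y <= m ((x + y) / 2) ^+ 2) ->
  (\int[lam]_x (f x)%:E + \int[lam]_x (g x)%:E <= 2%:E * \int[lam]_x (m x)%:E)%E.
Proof.
move=> mf mg mm f01 g01 m0 f1 g1 fgm.
have f0 x : 0 <= f x by have /andP[] := f01 x.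
have g0 x : 0 <= g x by have /andP[] := g01 x.
have ms (h : mR -> mR) t : measurable_fun setT h -> measurable [set x | t < h x].
  move=> mh; rewrite -[X in measurable X]setTI.
  rewrite (_ : [set x | t < h x] = h @^-1` `]t, +oo[%classic); first exact: mh.
  by apply/seteqP; split => x; rewrite /= in_itv/= andbT.
have mcdf (h : mR -> mR) (D : set mR) : measurable_fun setT h ->
    measurable_fun D ((fun t => lam [set x | t < h x]) : mR -> \bar R).
  move=> mh; pose E : set (mR * mR) := [set z | z.2 < h z.1].
  have mE : measurable E.
    rewrite (_ : E = (fun z : mR * mR => h z.1 - z.2) @^-1` `]0%R, +oo[%classic); last first.
      by apply/seteqP; split => z; rewrite /E /= !in_itv/= !andbT subr_gt0.
    rewrite -[X in measurable X]setTI.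
    exact: (measurable_funB (measurableT_comp mh measurable_fst) measurable_snd).
  have := @measurable_funTS _ _ _ _ D _ (measurable_fun_ysection lam mE).
  apply: eq_measurable_fun => t _ /=; congr (lam _).
  by apply/seteqP; split => x; rewrite /ysection/= inE.
rewrite !layer_cake// -ge0_integralD//; last 2 first.
  by exact: mcdf.
  by exact: mcdf.
rewrite -ge0_integralZl//; last by exact: mcdf.
apply: ge0_le_integral => //.
- by move=> t _; rewrite adde_ge0.
- by apply: emeasurable_funD; exact: mcdf.
- by apply: measurable_funeM; exact: mcdf.
- move=> t; rewrite /= in_itv/= andbT => t0; have [t1|t1] := ltP t 1.
    apply: brunn_minkowski_1d; try exact: ms.
    + by have [x] := f1 t t1; exists x.
    + by have [x] := g1 t t1; exists x.
    + move=> x y /= fx gy; rewrite -(@ltr_pXn2r _ 2) ?nnegrE//.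
      by apply: lt_le_trans (fgm x y); rewrite expr2 ltr_pM.
  rewrite (_ : [set x | t < f x] = set0); last first.
    by apply/seteqP; split => // x /=; have := f01 x; lra.
  rewrite (_ : [set x | t < g x] = set0) ?measure0 ?adde0 ?mule_ge0//.
  by apply/seteqP; split => // x /=; have := g01 x; lra.
Qed.

Let normalized_fun (f : mR -> mR) : (forall x, 0 <= f x) -> has_ubound (range f) ->
  0 < sup (range f) ->
  let s := sup (range f) in
  (forall x, 0 <= f x / s <= 1) /\ (forall t, t < 1 -> exists x, t < f x / s).
Proof.
move=> f0 ubf s0 s; split => [x|t t1].
  rewrite divr_ge0 ?(ltW s0)//= ler_pdivrMr// mul1r.
  by apply: ub_le_sup => //; exists x.
have : 0 < s * (1 - t) by rewrite mulr_gt0// subr_gt0.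
move=> /(@sup_adherent _ (range f)) [|_ [x _ <-] fx].
  by split => //; exists (f point), point.
exists x; rewrite ltr_pdivlMr//; rewrite -/s in fx; lra.
Qed.

(** Dividing [f] and [g] by their suprema [a] and [b], and [m] by [s = sqrt (a * b)], leads to the
    normalized case. If a supremum vanishes, so does the left-hand side. *)
Lemma prekopa_leindler_1d_bounded (f g : mR -> mR) (m : mR -> \bar R) (k : R) :
  measurable_fun setT f -> measurable_fun setT g -> measurable_fun setT m ->
  (forall x, 0 <= f x <= k) -> (forall x, 0 <= g x <= k) ->
  (forall x, 0 <= m x)%E ->
  (forall x y, (f x * g y)%:E <= m ((x + y) / 2)%R * m ((x + y) / 2)%R)%E ->
  (\int[lam]_x (f x)%:E * \int[lam]_x (g x)%:E <=
   \int[lam]_x m x * \int[lam]_x m x)%E.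
Proof.
move=> mf mg mm f0k g0k m0 fgm.
have f0 x : 0 <= f x by have /andP[] := f0k x.
have g0 x : 0 <= g x by have /andP[] := g0k x.
have ubf : has_ubound (range f) by exists k => _ [x _ <-]; have /andP[] := f0k x.
have ubg : has_ubound (range g) by exists k => _ [x _ <-]; have /andP[] := g0k x.
have M0 : (0 <= \int[lam]_x m x)%E by exact: integral_ge0.
set a := sup (range f); set b := sup (range g).
have fa x : f x <= a by apply: ub_le_sup => //; exists x.
have gb x : g x <= b by apply: ub_le_sup => //; exists x.
have a0 : 0 <= a by apply: le_trans (fa point).
have b0 : 0 <= b by apply: le_trans (gb point).
have [a_eq0|a_neq0] := eqVneq a 0.
  rewrite [X in (X * _)%E]integral0_eq ?mul0e ?mule_ge0// => x _.
  by congr EFin; apply/eqP; rewrite eq_le f0 -a_eq0 fa.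
have [b_eq0|b_neq0] := eqVneq b 0.
  rewrite [X in (_ * X)%E]integral0_eq ?mule0 ?mule_ge0// => x _.
  by congr EFin; apply/eqP; rewrite eq_le g0 -b_eq0 gb.
have {a0 a_neq0}a0 : 0 < a by rewrite lt_neqAle eq_sym a_neq0.
have {b0 b_neq0}b0 : 0 < b by rewrite lt_neqAle eq_sym b_neq0.
have [f01 f1] := normalized_fun f f0 ubf a0.
have [g01 g1] := normalized_fun g g0 ubg b0.
have [My|Mfin] := eqVneq (\int[lam]_x m x)%E +oo%E.
  by rewrite My mulyy leey.
pose s := Num.sqrt (a * b).
have s0 : 0 < s by rewrite sqrtr_gt0 mulr_gt0.
have s2 : s * s = a * b by rewrite -expr2 sqr_sqrtr// ltW// mulr_gt0.
have sV : (0 <= s^-1%:E)%E by rewrite lee_fin invr_ge0 ltW.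
(* The cap at 1 makes the function real-valued and keeps the midpoint inequality, because the
   product of the normalized functions is at most 1. *)
pose m' (x : mR) : mR := fine (mine (m x * s^-1%:E) 1)%E.
have m'E x : (m' x)%:E = (mine (m x * s^-1%:E) 1)%E.
  rewrite fineK// ge0_fin_numE; first by rewrite gt_min ltry orbT.
  by rewrite le_min mule_ge0//= lee_fin.
have m'0 x : 0 <= m' x.
  by rewrite -lee_fin m'E le_min mule_ge0//= lee_fin.
have mm' : measurable_fun setT m'.
  apply/measurable_EFinP; apply: (eq_measurable_fun (fun x => mine (m x * s^-1%:E) 1)%E).
    by move=> x _ /=; rewrite m'E.
  by apply: measurable_mine => //; apply: emeasurable_funM.
have main : (\int[lam]_x (f x / a)%:E + \int[lam]_x (g x / b)%:E <=
     2%:E * \int[lam]_x (m' x)%:E)%E.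
  apply: prekopa_leindler_1d_normalized => //.
  - by apply: measurable_funM.
  - by apply: measurable_funM.
  move=> x y; set z := (x + y) / 2.
  rewrite -lee_fin expr2 [X in (_ <= X)%E]EFinM m'E; have := fgm x y; rewrite -/z.
  have [mz1|mz1] := leP (m z * s^-1%:E)%E 1%E; last first.
    by move=> _; rewrite mule1 lee_fin mulr_ile1//; [have := f01 x|have := g01 y|
      have := f01 x|have := g01 y]; rewrite -/a -/b => /andP[].
  move=> h; rewrite muleACA -EFinM -invfM s2 mulrACA -invfM EFinM.
  by rewrite lee_pmul2r// lte_fin invr_gt0 mulr_gt0.
have m'm : (\int[lam]_x (m' x)%:E <= s^-1%:E * \int[lam]_x m x)%E.
  rewrite -ge0_integralZl//.
  apply: ge0_le_integral => //.
  - by move=> x _; rewrite lee_fin.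
  - exact/measurable_EFinP.
  - exact: measurable_funeM.
  - by move=> x _; rewrite m'E muleC ge_min lexx.
move: main; under eq_integral do rewrite mulrC EFinM.
rewrite ge0_integralZl//; [|exact/measurable_EFinP|by move=> *; rewrite lee_fin|
  by rewrite lee_fin invr_ge0 ltW].
under [X in (_ + X)%E]eq_integral do rewrite mulrC EFinM.
rewrite ge0_integralZl//; [|exact/measurable_EFinP|by move=> *; rewrite lee_fin|
  by rewrite lee_fin invr_ge0 ltW].
have F0 : (0 <= \int[lam]_x (f x)%:E)%E by apply: integral_ge0 => *; rewrite lee_fin.
have G0 : (0 <= \int[lam]_x (g x)%:E)%E by apply: integral_ge0 => *; rewrite lee_fin.
move: F0 G0 M0 Mfin m'm.
move: (\int[lam]_x m x)%E => M; move: (\int[lam]_x (m' x)%:E)%E => M'.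
move: (\int[lam]_x (f x)%:E)%E => F; move: (\int[lam]_x (g x)%:E)%E => G.
move=> F0 G0 M0 Mfin m'm h.
have {h m'm}h : (a^-1%:E * F + b^-1%:E * G <= 2%:E * (s^-1%:E * M))%E.
  by apply: (le_trans h); rewrite lee_pmul2l.
have {Mfin} : M \is a fin_num by rewrite ge0_fin_numE// lt_neqAle Mfin leey.
case: M M0 h => // M M0 h _.
have aV : 0 < a^-1 by rewrite invr_gt0.
have bV : 0 < b^-1 by rewrite invr_gt0.
case: F F0 h => [F|/=|//] F0 h; last first.
  move: h; rewrite gt0_muley ?lte_fin// addye ?leye_eq//.
  by case: G G0 => // G; rewrite gt0_muley ?lte_fin.
case: G G0 h => [G|/=|//] G0 h; last first.
  by move: h; rewrite gt0_muley ?lte_fin// addey ?leye_eq//.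
move: h; rewrite -!EFinM -EFinD !lee_fin; rewrite !lee_fin in M0 F0 G0.
move=> h.
have : (a^-1 * F + b^-1 * G) ^+ 2 <= (2 * (s^-1 * M)) ^+ 2.
  by rewrite ler_pXn2r// nnegrE ?addr_ge0 ?mulr_ge0 ?invr_ge0// ltW.
have -> : (2 * (s^-1 * M)) ^+ 2 = 4 * (a^-1 * b^-1 * M ^+ 2).
  by rewrite !exprMn exprVn (expr2 s) s2 invfM; ring.
(* The arithmetic-geometric mean inequality turns the additive bound into a multiplicative one; the
   normalizing constants cancel because [s * s = a * b]. *)
have : 4 * (a^-1 * F) * (b^-1 * G) <= (a^-1 * F + b^-1 * G) ^+ 2.
  by have := sqr_ge0 (a^-1 * F - b^-1 * G); lra.
move=> h1 h2; have := le_trans h1 h2.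
rewrite (_ : 4 * (a^-1 * F) * (b^-1 * G) = 4 * (a^-1 * b^-1) * (F * G)); last by ring.
rewrite (_ : 4 * (a^-1 * b^-1 * M ^+ 2) = 4 * (a^-1 * b^-1) * (M * M)); last by ring.
by rewrite ler_pM2l ?mulr_gt0.
Qed.

Let truncate (f : mR -> \bar R) (n : nat) (x : mR) : mR := fine (mine (f x) n%:R%:E).

Let truncateE f n x : (0 <= f x)%E -> (truncate f n x)%:E = mine (f x) n%:R%:E.
Proof.
move=> fx0; rewrite /truncate fineK// ge0_fin_numE.
  by rewrite gt_min ltry orbT.
by rewrite le_min fx0 lee_fin ler0n.
Qed.

Let truncate_bounded f n x : (0 <= f x)%E -> 0 <= truncate f n x <= n%:R.
Proof.
move=> fx0; rewrite -!lee_fin truncateE// le_min fx0 lee_fin ler0n/=.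
by rewrite ge_min lexx orbT.
Qed.

Let measurable_truncate f n : (forall x, 0 <= f x)%E -> measurable_fun setT f ->
  measurable_fun setT (truncate f n).
Proof.
move=> f0 mf; apply/measurable_EFinP.
apply: (eq_measurable_fun (fun x => mine (f x) n%:R%:E)).
  by move=> x _; rewrite /= truncateE.
exact: measurable_mine.
Qed.

Let cvg_integral_truncate f : (forall x, 0 <= f x)%E -> measurable_fun setT f ->
  (\int[lam]_x (truncate f n x)%:E)%E @[n --> \oo] --> (\int[lam]_x f x)%E.
Proof.
move=> f0 mf.
have -> : (\int[lam]_x f x)%E = (\int[lam]_x limn (fun n => (truncate f n x)%:E))%E.
  apply: eq_integral => x _; apply/esym/cvg_lim => //.
  under eq_fun do rewrite truncateE//.
  case: (f x) (f0 x) => [r r0| _|//].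
    apply: cvg_near_cst; near=> n; rewrite min_l// lee_fin ltW//.
    by near: n; exact: nbhs_infty_gtr.
  under eq_fun do rewrite min_r ?leey//.
  exact/cvgeryP/cvgr_idn.
apply: cvg_monotone_convergence => //.
- by move=> n; apply/measurable_EFinP; exact: measurable_truncate.
- by move=> n x _; rewrite lee_fin; have /andP[] := truncate_bounded f n x (f0 x).
- move=> x _ n p np; rewrite !truncateE// le_min ge_min lexx/=.
  by rewrite ge_min lee_fin ler_nat np orbT.
Unshelve. all: by end_near. Qed.

(** Extended values are allowed because the induction on the dimension applies this to slice
    integrals, which may be infinite. *)
Lemma prekopa_leindler_1d (f g m : mR -> \bar R) :
  measurable_fun setT f -> measurable_fun setT g -> measurable_fun setT m ->
  (forall x, 0 <= f x)%E -> (forall x, 0 <= g x)%E -> (forall x, 0 <= m x)%E ->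
  (forall x y, f x * g y <= m ((x + y) / 2)%R * m ((x + y) / 2)%R)%E ->
  (\int[lam]_x f x * \int[lam]_x g x <= \int[lam]_x m x * \int[lam]_x m x)%E.
Proof.
move=> mf mg mm f0 g0 m0 fgm.
have F0 : (0 <= \int[lam]_x f x)%E by exact: integral_ge0.
have G0 : (0 <= \int[lam]_x g x)%E by exact: integral_ge0.
have M0 : (0 <= \int[lam]_x m x)%E by exact: integral_ge0.
(* Zero integrals are set aside so that the product of the two limits is never 0 times infinity. *)
have [->|Fn0] := eqVneq (\int[lam]_x f x)%E 0%E; first by rewrite mul0e mule_ge0.
have [->|Gn0] := eqVneq (\int[lam]_x g x)%E 0%E; first by rewrite mule0 mule_ge0.
have cFG : (\int[lam]_x (truncate f n x)%:E * \int[lam]_x (truncate g n x)%:E)%E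
    @[n --> \oo] --> (\int[lam]_x f x * \int[lam]_x g x)%E.
  apply: cvgeM; [|exact: cvg_integral_truncate|exact: cvg_integral_truncate].
  by rewrite neq0_mule_def// mule_neq0.
rewrite -(cvg_lim _ cFG)//; apply: lime_le; first by apply/cvg_ex; eexists; exact: cFG.
near=> n; apply: (@prekopa_leindler_1d_bounded _ _ _ n%:R) => //.
- exact: measurable_truncate.
- exact: measurable_truncate.
- by move=> x; exact: truncate_bounded.
- by move=> x; exact: truncate_bounded.
- move=> x y; apply: le_trans (fgm x y); rewrite EFinM !truncateE//.
  by apply: lee_pmul; rewrite ?le_min ?f0 ?g0 ?lee_fin ?ler0n ?ge_min ?lexx.
Unshelve. all: by end_near. Qed.

End prekopa_leindler_1d.

(** * Prekopa-Leindler inequality in every dimension *)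

Section prekopa_leindler.
Context (R : realType).
Local Notation mR := (measurableTypeR R).
Local Notation lam := (@lebesgue_measure R).

Lemma integral_lebesgue_rV_succ n (f : 'rV[R]_n.+1 -> \bar R) :
  measurable_fun setT f -> (forall x, 0 <= f x)%E ->
  (\int[lebesgue_rV R n.+1]_x f x =
   \int[lam]_a \int[lebesgue_rV R n]_v f (@rV_cons R n (a, v)))%E.
Proof.
move=> mf f0.
rewrite [LHS](_ : _ = \int[pushforward (lam \x lebesgue_rV R n)%E (@rV_cons R n)]_x f x)%E//.
rewrite ge0_integral_pushforward//; last exact: measurable_rV_cons.
rewrite preimage_setT fubini_tonelli1//.
  exact: (measurableT_comp mf (@measurable_rV_cons R n)).
by move=> z; exact: f0.
Qed.

Lemma measurable_fun_rV_cons_integral n (f : 'rV[R]_n.+1 -> \bar R) :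
  measurable_fun setT f -> (forall x, 0 <= f x)%E ->
  measurable_fun setT ((fun a => \int[lebesgue_rV R n]_v f (@rV_cons R n (a, v)))%E : mR -> \bar R).
Proof.
move=> mf f0.
apply: (measurable_fun_fubini_tonelli_F (f \o @rV_cons R n)) => //.
  exact: (measurableT_comp mf (@measurable_rV_cons R n)).
by move=> z; exact: f0.
Qed.

Lemma measurable_fun_rV_cons_section n (f : 'rV[R]_n.+1 -> \bar R) (a : mR) :
  measurable_fun setT f ->
  measurable_fun setT (fun v => f (@rV_cons R n (a, v))).
Proof.
move=> mf.
apply: (measurableT_comp (measurableT_comp mf (@measurable_rV_cons R n))
  (@measurable_pair1 _ _ mR 'rV[R]_n a)).
Qed.

Lemma rV_cons_midpoint n (a b : mR) (v w : 'rV[R]_n) :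
  2^-1 *: (@rV_cons R n (a, v) + @rV_cons R n (b, w)) =
  @rV_cons R n ((a + b) / 2 : mR, 2^-1 *: (v + w)).
Proof.
apply/rowP => i; rewrite !mxE/= mulrC; case: unliftP => [j _|_] //.
by rewrite !mxE mulrC.
Qed.

(** For fixed first coordinates [a] and [b], the induction hypothesis on the slices is exactly the
    one-dimensional hypothesis for the slice integrals. Writing [m] twice avoids square roots of
    extended reals. *)
Theorem prekopa_leindler n (f g m : 'rV[R]_n -> \bar R) :
  measurable_fun setT f -> measurable_fun setT g -> measurable_fun setT m ->
  (forall x, 0 <= f x)%E -> (forall x, 0 <= g x)%E -> (forall x, 0 <= m x)%E ->
  (forall x y, f x * g y <= m (2^-1 *: (x + y))%R * m (2^-1 *: (x + y))%R)%E ->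
  (\int[lebesgue_rV R n]_x f x * \int[lebesgue_rV R n]_x g x <=
   \int[lebesgue_rV R n]_x m x * \int[lebesgue_rV R n]_x m x)%E.
Proof.
elim: n f g m => [|n IH] f g m mf mg mm f0 g0 m0 fgm.
  rewrite /= !integral_dirac// diracT !mul1e.
  by have := fgm 0 0; rewrite addr0 scaler0.
rewrite !integral_lebesgue_rV_succ//; apply: prekopa_leindler_1d.
- exact: measurable_fun_rV_cons_integral.
- exact: measurable_fun_rV_cons_integral.
- exact: measurable_fun_rV_cons_integral.
- by move=> a; apply: integral_ge0.
- by move=> a; apply: integral_ge0.
- by move=> a; apply: integral_ge0.
- move=> a b; apply: IH => //; try exact: measurable_fun_rV_cons_section.
  by move=> v w; rewrite -rV_cons_midpoint.
Qed.
End prekopa_leindler.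

(** * Taylor estimates from partial derivatives *)

Section one_dimensional.
Context (R : realType).

Lemma is_derive_line (V : normedModType R) (f : V -> R) (x v : V) (t : R) :
  derivable f (x + t *: v) v ->
  is_derive t 1 (fun s : R => f (x + s *: v)) ('D_v f (x + t *: v)).
Proof.
move=> df; pose g s := f (x + s *: v).
have gE : (fun h : R => h^-1 *: ((g \o shift t) (h *: 1) - g t)) =
    (fun h => h^-1 *: ((f \o shift (x + t *: v)) (h *: v) - f (x + t *: v))).
  by apply/funext => h /=; rewrite /g scalerDl addrCA [h%:A]mulr1.
by apply: DeriveDef; rewrite /derivable /derive -/g gE.
Qed.

(** The endpoints are not ordered, since coordinates of a displacement have either sign. *)
Lemma MVT_between (f f' : R -> R) (a b : R) :
  (forall s, Num.min a b <= s <= Num.max a b -> is_derive s 1 f (f' s)) ->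
  exists2 s, Num.min a b <= s <= Num.max a b & f b - f a = f' s * (b - a).
Proof.
wlog ab : a b / a <= b => [wlg df|].
  have /orP[ab|ba] := le_total a b; first exact: wlg.
  have [|s sab fE] := wlg b a ba; first by move=> s; rewrite minC maxC; exact: df.
  by exists s; [rewrite minC maxC|rewrite -opprB fE -opprB mulrN opprK].
rewrite (min_l ab) (max_r ab) => df.
have [|//|s] := @MVT_segment _ f f' a b ab.
- by move=> s; rewrite in_itv/= => /andP[/ltW ? /ltW ?]; apply: df; apply/andP.
- apply: continuous_in_subspaceT => s; rewrite inE/= in_itv/= => sab.
  by apply: differentiable_continuous; apply/derivable1_diffP; have [] := df s sab.
- by rewrite in_itv/=; exists s.
Qed.

End one_dimensional.

Section multivariate.
Context (R : realType) (d : nat).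
Implicit Types (f : 'rV[R]_d -> R) (x y z v : 'rV[R]_d).

Local Notation e_ i := (delta_mx ord0 i : 'rV[R]_d).

Lemma ball_rVP x (r : R) y : 0 < r ->
  ball x r y <-> forall i, `|x ord0 i - y ord0 i| < r.
Proof.
move=> r0; split => [[_ xy] i|xy]; first exact: xy.
by split => // i j; rewrite (ord1 i); exact: xy.
Qed.

(** The coordinates are changed one at a time, with the mean value theorem for each; [w k] is the
    displacement after [k] changes. The ball of the sup norm is a cube, so the whole path stays
    inside it. *)
Lemma partial_increment_le f z (r : R) (g : 'I_d -> R) (eta : R) x v : 0 < r ->
  (forall y i, ball z r y -> derivable f y (e_ i)) ->
  (forall y i, ball z r y -> `|partial i f y - g i| <= eta) ->
  ball z r x -> ball z r (x + v) ->
  `|f (x + v) - f x - \sum_i v ord0 i * g i| <= eta * \sum_i `|v ord0 i|.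
Proof.
move=> r0 df fg /(ball_rVP _ _ _ r0) zx /(ball_rVP _ _ _ r0) zxv.
pose w k : 'rV[R]_d := \row_(i < d) (if (i < k)%N then v ord0 i else 0).
suff H k : (k <= d)%N ->
    `|f (x + w k) - f x - \sum_(i < d | (i < k)%N) v ord0 i * g i| <=
    eta * \sum_(i < d | (i < k)%N) `|v ord0 i|.
  have := H d (leqnn _); rewrite (_ : w d = v); last first.
    by apply/rowP => i; rewrite mxE ltn_ord.
  by under eq_bigl do rewrite ltn_ord; under [X in _ * X]eq_bigl do rewrite ltn_ord.
elim: k => [_|k IH kd].
  rewrite !big_pred0//= subr0 mulr0 (_ : w 0%N = 0) ?addr0 ?subrr ?normr0//.
  by apply/rowP => i; rewrite !mxE.
pose j := Ordinal kd.
have split_sum (F : 'I_d -> R) : \sum_(i < d | (i < k.+1)%N) F i =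
    F j + \sum_(i < d | (i < k)%N) F i.
  rewrite (bigD1 j)//=; congr (_ + _); apply: eq_bigl => i.
  by rewrite ltnS (leq_eqVlt i) -val_eqE/=; case: ltngtP.
have wS : w k.+1 = w k + v ord0 j *: e_ j.
  apply/rowP => i; rewrite !mxE/= ltnS leq_eqVlt -val_eqE/=.
  have [ik|ik] := eqVneq (i : nat) k; last by rewrite mulr0 addr0.
  have -> : i = j by apply/val_inj.
  by rewrite ltnn mulr1 add0r.
have inb s : Num.min 0 (v ord0 j) <= s <= Num.max 0 (v ord0 j) ->
    ball z r (x + w k + s *: e_ j).
  move=> sv; apply/(ball_rVP _ _ _ r0) => i; rewrite !mxE/= -val_eqE/=.
  have [ik|ik] := eqVneq (i : nat) k.
    have -> : i = j by apply/val_inj.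
    rewrite ltnn mulr1 addr0; have := zx j; have := zxv j; rewrite mxE.
    move: sv; rewrite ge_min le_max !ltr_norml.
    by case/andP => /orP[?|?] /orP[?|?]; lra.
  rewrite mulr0 addr0; case: ifP => _.
    by have := zxv i; rewrite mxE.
  by rewrite addr0; exact: zx.
have [|s sv] := @MVT_between R (fun s => f (x + w k + s *: e_ j))
    (fun s => partial j f (x + w k + s *: e_ j)) 0 (v ord0 j).
  by move=> s sv; apply: is_derive_line; apply: df; exact: inb.
rewrite scale0r addr0 subr0 -addrA -wS => fE.
rewrite !split_sum mulrDr.
have := IH (ltnW kd); set S := \sum_(i < d | _) _ * _; set S' := \sum_(i < d | _) `|_|.
have -> : f (x + w k.+1) - f x - (v ord0 j * g j + S) =
    (partial j f (x + w k + s *: e_ j) - g j) * v ord0 j + (f (x + w k) - f x - S).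
  by rewrite mulrBl -fE; ring.
move=> le1; apply: (le_trans (ler_normD _ _)); apply: lerD => //.
by rewrite normrM ler_wpM2r//; apply: fg; exact: inb.
Qed.

Lemma derivable_C1 f z v :
  (\forall y \near z, forall i, derivable f y (e_ i)) ->
  (forall i, {for z, continuous (partial i f)}) ->
  is_derive z v f (\sum_i v ord0 i * partial i f z).
Proof.
move=> df cf.
suff H : (fun h : R => h^-1 *: ((f \o shift z) (h *: v) - f z)) @ 0^' -->
    (\sum_i v ord0 i * partial i f z).
  have Hc : derivable f z v by exact: (cvgP _ H).
  have <- : 'D_v f z = \sum_i v ord0 i * partial i f z by exact: (cvg_lim _ H).
  exact: derivableP.
apply/cvgrPdist_le => e e0.
pose S := \sum_i `|v ord0 i|.
have S0 : 0 <= S by apply: sumr_ge0.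
have S1 : 0 < S + 1 by rewrite ltr_wpDl.
pose eta := e / (S + 1); have eta0 : 0 < eta by rewrite divr_gt0.
have : \forall y \near z, (forall i, derivable f y (e_ i)) /\
    (forall i, `|partial i f y - partial i f z| <= eta).
  near=> y; split; first by near: y.
  near: y; apply: filter_forall => i.
  have /cvgrPdist_le /(_ _ eta0) := cf i.
  by apply: filterS => y; rewrite distrC.
move=> /nbhs_ballP[r /= r0 zr].
have : \forall h \near (0:R)^', ball z r (h *: v + z).
  have : h *: v + z @[h --> (0:R)^'] --> z.
    rewrite -[X in _ --> X]add0r -(scale0r v).
    by apply: cvgD; [apply: cvgZl; exact: cvg_within|exact: cvg_cst].
  by move=> /(_ (ball z r)); apply; exact: nbhsx_ballx.
move=> zh; near=> h.
have h0 : h != 0 by near: h; exact: nbhs_dnbhs_neq.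
have /= := @partial_increment_le f z r (fun i => partial i f z) eta z (h *: v) r0
   _ _ (ballxx _ r0).
rewrite [z + _]addrC; move=> /(_ _ _ _) H.
have {H} : `|f (h *: v + z) - f z - \sum_i (h *: v) ord0 i * partial i f z| <=
    eta * \sum_i `|(h *: v) ord0 i|.
  apply: H; [by move=> y i /zr[]|by move=> y i /zr[]|by near: h].
have -> : \sum_i (h *: v) ord0 i * partial i f z = h * \sum_i v ord0 i * partial i f z.
  by rewrite mulr_sumr; apply: eq_bigr => i _; rewrite mxE mulrA.
have -> : \sum_i `|(h *: v) ord0 i| = `|h| * S.
  by rewrite mulr_sumr; apply: eq_bigr => i _; rewrite mxE normrM.
move=> H; rewrite distrC.
have -> : h^-1 *: (f (h *: v + z) - f z) - \sum_i v ord0 i * partial i f z =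
    h^-1 * (f (h *: v + z) - f z - h * \sum_i v ord0 i * partial i f z).
  by rewrite [in RHS]mulrBr mulKf.
rewrite normrM normrV ?unitfE// ler_pdivrMl ?normr_gt0//.
apply: (le_trans H); rewrite mulrCA ler_wpM2l// /eta mulrAC ler_pdivrMr//.
by rewrite ler_wpM2l ?ltW// ltrDl.
Unshelve. all: by end_near. Qed.

End multivariate.

Section second_order.
Context (R : realType) (d : nat).
Implicit Types (f : 'rV[R]_d -> R) (x y z v : 'rV[R]_d).

Local Notation e_ i := (delta_mx ord0 i : 'rV[R]_d).

(** The mean value theorem is used once in direction [j] and once in direction [i]. The radius
    [3 * s] leaves room for [i = j], where the displacement can reach [2 * s]. *)
Lemma double_increment f z (s : R) i j : 0 < s ->
  (forall y, ball z (3 * s) y -> derivable f y (e_ j)) ->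
  (forall y, ball z (3 * s) y -> derivable (partial j f) y (e_ i)) ->
  exists2 y, ball z (3 * s) y &
    f (z + s *: e_ i + s *: e_ j) - f (z + s *: e_ i) - f (z + s *: e_ j) + f z =
    partial i (partial j f) y * s ^+ 2.
Proof.
move=> s0 df ddf; have s3 : 0 < 3 * s by rewrite mulr_gt0.
have inb a b : 0 <= a <= s -> 0 <= b <= s -> ball z (3 * s) (z + a *: e_ i + b *: e_ j).
  move=> a0s b0s; apply/(ball_rVP _ _ _ _ _ s3) => k.
  rewrite !mxE/= -addrA opprD addrA subrr add0r normrN.
  case: (k == i); case: (k == j); rewrite /= ?mulr0 ?mulr1 ?addr0 ?add0r ?normr0//.
  - by rewrite ger0_norm; lra.
  - by rewrite ger0_norm; lra.
  - by rewrite ger0_norm; lra.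
have s00 : (0 : R) <= 0 <= s by rewrite lexx ltW.
have sss : 0 <= s <= s by rewrite lexx ltW.
have mM : Num.min 0 s = 0 /\ Num.max 0 s = s by rewrite min_l ?max_r// ltW.
pose phi t := f (z + s *: e_ i + t *: e_ j) - f (z + t *: e_ j).
pose phi' t := partial j f (z + s *: e_ i + t *: e_ j) - partial j f (z + t *: e_ j).
have [|c] := @MVT_between R phi phi' 0 s.
  move=> t; rewrite mM.1 mM.2 => t0s; apply: is_deriveB.
    by apply: is_derive_line; apply: df; exact: inb.
  apply: is_derive_line; apply: df; have := inb 0 t s00 t0s.
  by rewrite scale0r addr0.
rewrite mM.1 mM.2 => c0s; rewrite /phi /phi' !scale0r !addr0 subr0 => phiE.
pose psi (t : R) := partial j f (z + c *: e_ j + t *: e_ i).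
have [|c'] := @MVT_between R psi (fun t => partial i (partial j f) (z + c *: e_ j + t *: e_ i)) 0 s.
  move=> t; rewrite mM.1 mM.2 => t0s; apply: is_derive_line; apply: ddf.
  by rewrite addrAC; exact: inb.
rewrite mM.1 mM.2 => c0s'; rewrite /psi !scale0r !addr0 subr0 => psiE.
exists (z + c *: e_ j + c' *: e_ i); first by rewrite addrAC; exact: inb.
rewrite expr2 mulrA -psiE (addrAC z (c *: _)) -phiE; ring.
Qed.

(** Schwarz's theorem: the double increment is symmetric in [i] and [j], so the two mixed
    derivatives agree at points arbitrarily close to [z], and continuity concludes. *)
Lemma partial_comm f z i j :
  (\forall y \near z, forall k, derivable f y (e_ k)) ->
  (\forall y \near z, forall k l, derivable (partial l f) y (e_ k)) ->
  (forall k l, {for z, continuous (partial k (partial l f))}) ->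
  partial i (partial j f) z = partial j (partial i f) z.
Proof.
move=> df ddf cf; apply/eqP; rewrite -subr_eq0 -normr_le0; apply/ler_addgt0Pr => e e0.
rewrite add0r.
have e20 : 0 < e / 2 by rewrite divr_gt0.
have close k l : exists2 r : R, 0 < r & forall y, ball z r y ->
    `|partial k (partial l f) z - partial k (partial l f) y| <= e / 2.
  by have /cvgrPdist_le /(_ _ e20) /nbhs_ballP[r r0 zr] := cf k l; exists r.
have [r1 r10 zr1] := close i j; have [r2 r20 zr2] := close j i.
have /nbhs_ballP[r3 /= r30 zr3] := df; have /nbhs_ballP[r4 /= r40 zr4] := ddf.
pose r := Num.min (Num.min r1 r2) (Num.min r3 r4).
have r0 : 0 < r by rewrite /r !lt_min r10 r20 r30 r40.
have zr y : ball z r y -> [/\ forall k, derivable f y (e_ k),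
    forall k l, derivable (partial l f) y (e_ k),
    `|partial i (partial j f) z - partial i (partial j f) y| <= e / 2 &
    `|partial j (partial i f) z - partial j (partial i f) y| <= e / 2].
  move=> zy; split; [apply: zr3|apply: zr4|apply: zr1|apply: zr2];
    by apply: le_ball zy; rewrite /r !ge_min lexx ?orbT.
move: r r0 zr => r r0 zr.
have s0 : 0 < r / 3 by rewrite divr_gt0.
have rE : 3 * (r / 3) = r by rewrite mulrC divfK.
have [||y yb yE] := @double_increment f z (r / 3) i j s0; rewrite ?rE.
- by move=> y /zr[].
- by move=> y /zr[].
have [||y' yb' yE'] := @double_increment f z (r / 3) j i s0; rewrite ?rE.
- by move=> y0 /zr[].
- by move=> y0 /zr[].
rewrite rE in yb yb'.
have yy' : partial i (partial j f) y = partial j (partial i f) y'.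
  move: yE yE'; move: (partial i _ y) (partial j _ y') => p q yE yE'.
  apply: (mulIf (_ : (r / 3) ^+ 2 != 0)); first by rewrite expf_neq0// gt_eqF.
  rewrite -yE -yE' (addrAC z); congr (_ + _).
  by rewrite [LHS]addrAC.
have [_ _ h1 _] := zr _ yb; have [_ _ _ h2] := zr _ yb'.
move: h1 h2; rewrite yy'.
move: (partial i _ z) (partial j (partial i f) z) (partial j (partial i f) y') => a b c.
move=> h1 h2; rewrite (_ : a - b = (a - c) - (b - c)); last by ring.
rewrite [leRHS]splitr; exact: le_trans (ler_normB _ _) (lerD h1 h2).
Qed.

(** The derivatives along [v] and [- v] at time [s] add up to a combination of the increments of the
    first partial derivatives from [z - s *: v] to [z + s *: v], which [partial_increment_le]
    controls. *)
Lemma second_difference_le f z (r : R) (H : 'I_d -> 'I_d -> R) (eta : R) v : 0 < r ->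
  (forall y i, ball z r y -> derivable f y (e_ i)) ->
  (forall y i, ball z r y -> {for y, continuous (partial i f)}) ->
  (forall y i j, ball z r y -> derivable (partial j f) y (e_ i)) ->
  (forall y i j, ball z r y -> `|partial i (partial j f) y - H i j| <= eta) ->
  ball z r (z + v) ->
  `|f (z + v) + f (z - v) - 2 * f z - \sum_i \sum_j v ord0 i * v ord0 j * H i j| <=
  eta * (\sum_i `|v ord0 i|) ^+ 2.
Proof.
move=> r0 df cf ddf fH zv.
have inb (w : 'rV[R]_d) (t : R) : (forall i, `|w ord0 i| = `|v ord0 i|) ->
    0 <= t <= 1 -> ball z r (z + t *: w).
  move=> wv t1; apply/(ball_rVP _ _ _ _ _ r0) => k.
  have /(ball_rVP _ _ _ _ _ r0)/(_ k) := zv; rewrite !mxE.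
  rewrite !opprD !addrA !subrr !add0r !normrN normrM wv; apply: le_lt_trans.
  by rewrite ler_piMl// ger0_norm; lra.
have nb y : ball z r y -> \forall x \near y, ball z r x.
  move=> zy; have : open (ball z r) by exact: ball_open.
  by rewrite openE => /(_ _ zy).
set q : R := \sum_i _; set S : R := \sum_i `|_|.
pose D (w : 'rV[R]_d) (t : R) := \sum_i w ord0 i * partial i f (z + t *: w).
have dline (w : 'rV[R]_d) (t : R) : (forall i, `|w ord0 i| = `|v ord0 i|) -> 0 <= t <= 1 ->
    is_derive t (1:R) (fun s => f (z + s *: w)) (D w t).
  move=> wv t1; have [dw dwE] : is_derive (z + t *: w) w f (D w t).
    apply: derivable_C1; last by move=> i; apply: cf; exact: inb.
    near=> y => i; apply: df; near: y; apply: nb; exact: inb.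
  by rewrite -dwE; exact: is_derive_line.
have vv i : `|v ord0 i| = `|v ord0 i| by [].
have Nvv i : `|(- v) ord0 i| = `|v ord0 i| by rewrite mxE normrN.
have dD s : 0 <= s <= 1 -> `|D v s + D (- v) s - 2 * s * q| <= 2 * s * (eta * S ^+ 2).
  move=> s01; have -> : D v s + D (- v) s =
      \sum_j v ord0 j * (partial j f (z + s *: v) - partial j f (z + s *: - v)).
    by rewrite -big_split/=; apply: eq_bigr => i _; rewrite mxE; ring.
  have -> : 2 * s * q = \sum_j v ord0 j * (2 * s * \sum_i v ord0 i * H i j).
    rewrite /q exchange_big/= mulr_sumr; apply: eq_bigr => j _.
    rewrite [RHS]mulrCA; congr (_ * _); rewrite mulr_sumr; apply: eq_bigr => i _.
    by rewrite mulrCA mulrA.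
  have -> : 2 * s * (eta * S ^+ 2) = \sum_j `|v ord0 j| * (eta * (2 * s * S)).
    by rewrite -mulr_suml -/S; ring.
  rewrite -sumrB; apply: (le_trans (ler_norm_sum _ _ _)); apply: ler_sum => j _.
  have := @partial_increment_le R d (partial j f) z r (fun i => H i j) eta
    (z + s *: - v) ((2 * s) *: v) r0.
  rewrite (_ : z + s *: - v + (2 * s) *: v = z + s *: v); last first.
    by rewrite -addrA scalerN -scaleNr -scalerDl; congr (_ + _ *: _); ring.
  move=> /(_ _ _ _ _) H1.
  have {H1} : `|partial j f (z + s *: v) - partial j f (z + s *: - v) -
      \sum_i ((2 * s) *: v) ord0 i * H i j| <= eta * \sum_i `|((2 * s) *: v) ord0 i|.
    apply: H1.
    - by move=> y i; exact: ddf.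
    - by move=> y i; exact: fH.
    - exact: inb.
    - exact: inb.
  have -> : \sum_i ((2 * s) *: v) ord0 i * H i j = 2 * s * \sum_i v ord0 i * H i j.
    by rewrite mulr_sumr; apply: eq_bigr => i _; rewrite mxE mulrA.
  have -> : \sum_i `|((2 * s) *: v) ord0 i| = 2 * s * S.
    rewrite mulr_sumr; apply: eq_bigr => i _; rewrite mxE normrM ger0_norm//; lra.
  move: (partial j f _ - partial j f _) => A; move: (2 * s * _) => B; move: (eta * _) => C.
  by move=> AB; rewrite -mulrBr normrM ler_wpM2l.
(* The mean value theorem gives an unknown [s], so the comparison term [t ^+ 2 * k] is put inside
   the function: for [k = q - eta * S ^+ 2] and [k = q + eta * S ^+ 2] the derivative has a sign
   whatever [s] is. *)
have main k : exists2 s, 0 <= s <= 1 &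
    f (z + v) + f (z - v) - 2 * f z - k = D v s + D (- v) s - 2 * s * k.
  pose psi (t : R) := f (z + t *: v) + f (z + t *: - v) - t ^+ 2 * k.
  pose psi' (t : R) := D v t + D (- v) t - 2 * t * k.
  have [|s] := @MVT_between R psi psi' 0 1.
    move=> t; rewrite min_l ?max_r// => t01; apply: is_deriveB.
      by apply: is_deriveD; apply: dline.
    apply: is_derive_eq; rewrite /GRing.scale/=; ring.
  rewrite min_l ?max_r// => s01 psiE; exists s => //.
  move: psiE; rewrite /psi /psi' !scale1r !scale0r !addr0 subr0 mulr1.
  rewrite expr0n/= expr1n => <-; ring.
have SS : 0 <= S ^+ 2 by exact: sqr_ge0.
rewrite ler_norml; apply/andP; split.
  have [s s01 sE] := main (q - eta * S ^+ 2).
  have := dD s s01; rewrite ler_norml => /andP[h _].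
  suff : 0 <= D v s + D (- v) s - 2 * s * (q - eta * S ^+ 2) by rewrite -sE; lra.
  by move: h; lra.
have [s s01 sE] := main (q + eta * S ^+ 2).
have := dD s s01; rewrite ler_norml => /andP[_ h].
suff : D v s + D (- v) s - 2 * s * (q + eta * S ^+ 2) <= 0 by rewrite -sE; lra.
by move: h; lra.
Unshelve. all: by end_near. Qed.

End second_order.

(** * Quadratic forms and their duals *)

Section quadratic_forms.
Context (R : realType) (d : nat).
Implicit Types (u v g : 'rV[R]_d) (H : 'M[R]_d).

Definition qform H v : R := \sum_i \sum_j v ord0 i * v ord0 j * H i j.

(** For symmetric positive definite [H] this is the maximum over [v] of [2 * dotp v g - qform H v],
    reached where [v] is the inverse of [H] applied to [g]. *)
Definition dual_qform H g : R := dotp ((invmx H *m g^T)^T) g.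

Lemma dotpE u v : dotp u v = (u *m v^T) ord0 ord0.
Proof. by rewrite mxE; apply: eq_bigr => i _; rewrite mxE. Qed.

Lemma dotp_ge0 u : 0 <= dotp u u.
Proof. by apply: sumr_ge0 => i _; rewrite -expr2 sqr_ge0. Qed.

Lemma dotp_eq0 u : (dotp u u == 0) = (u == 0).
Proof.
apply/eqP/eqP => [/eqP u0|->]; last by apply: big1 => i _; rewrite mxE mul0r.
apply/rowP => i; rewrite mxE; move: u0.
rewrite psumr_eq0; last by move=> j _; rewrite -expr2 sqr_ge0.
by move=> /allP /(_ i); rewrite mem_index_enum mulf_eq0 orbb => /(_ isT)/eqP.
Qed.

Lemma qformE H v : qform H v = (v *m H *m v^T) ord0 ord0.
Proof.
rewrite /qform exchange_big/= mxE; apply: eq_bigr => j _.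
by rewrite !mxE mulr_suml; apply: eq_bigr => i _; ring.
Qed.

Lemma qformD_scalar (c : R) H v : qform (c%:M + H) v = c * dotp v v + qform H v.
Proof.
by rewrite !qformE mulmxDr mulmxDl mxE mul_mx_scalar -scalemxAl mxE dotpE.
Qed.

(** The form vanishes on the left kernel, whose vectors therefore have length zero. *)
Lemma unitmx_posdef (c : R) H : 0 < c -> (forall v, c * dotp v v <= qform H v) ->
  H \in unitmx.
Proof.
move=> c0 cH; rewrite -row_free_unit -kermx_eq0; apply/eqP/row_matrixP => i.
rewrite row0; apply/eqP; set u := row i _; rewrite -dotp_eq0.
have uH : u *m H = 0.
  by rewrite /u -row_mul mulmx_ker row0.
have := cH u; rewrite qformE uH mul0mx mxE pmulr_rle0// => uu.
by rewrite eq_le uu dotp_ge0.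
Qed.

(** Completing the square: the form is nonnegative at [v - s *: w], where [H] sends [w] to [g]. *)
Lemma qform_dual H g v (s : R) : H^T = H -> (forall u, 0 <= qform H u) ->
  H \in unitmx -> 2 * s * dotp v g - qform H v <= s ^+ 2 * dual_qform H g.
Proof.
move=> HT H0 uH; pose w := (invmx H *m g^T)^T.
have Hw : H *m w^T = g^T by rewrite /w trmxK mulKVmx.
have wH : w *m H = g by rewrite -[LHS]trmxK trmx_mul HT Hw trmxK.
have ET : (v - s *: w)^T = v^T - s *: w^T by apply/matrixP => i j; rewrite !mxE.
have := H0 (v - s *: w); rewrite qformE ET.
have -> : (v - s *: w) *m H *m (v^T - s *: w^T) = v *m H *m v^T - s *: (v *m g^T)
    - s *: (g *m v^T) + s ^+ 2 *: (g *m w^T).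
  rewrite mulmxBl -scalemxAl wH mulmxBr !mulmxBl -!scalemxAr -!scalemxAl.
  rewrite -(mulmxA v H w^T) Hw scalerA -expr2 opprB addrA addrAC.
  by congr (_ + _); rewrite addrAC.
have gC u : (g *m u^T) ord0 ord0 = dotp u g.
  by rewrite -dotpE; apply: eq_bigr => i _; rewrite mulrC.
have entry (X Y Z U : 'M[R]_1) (a b : R) : (X - a *: Y - a *: Z + b *: U) ord0 ord0 =
    X ord0 ord0 - a * Y ord0 ord0 - a * Z ord0 ord0 + b * U ord0 ord0.
  by rewrite !mxE.
rewrite entry -qformE !gC -dotpE (_ : dotp w g = dual_qform H g)//.
by move: (dotp v g) (qform H v) (dual_qform H g) => x y t; lra.
Qed.

Lemma dual_qform_ge0 H g : H^T = H -> (forall u, 0 <= qform H u) ->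
  H \in unitmx -> 0 <= dual_qform H g.
Proof.
move=> HT H0 uH; have d0 : dotp 0 g = 0.
  by apply: big1 => i _; rewrite mxE mul0r.
have q0 : qform H 0 = 0 by rewrite qformE mul0mx mul0mx mxE.
have := @qform_dual H g 0 1 HT H0 uH.
by rewrite d0 q0 mulr0 subrr expr1n mul1r.
Qed.

End quadratic_forms.

(** * Continuity of the inverse matrix *)

Section continuity_invmx.
Context (R : realType) (T : Type) (F : set_system T) {FF : Filter F}.

Lemma cvg_det d (A : T -> 'M[R]_d) (B : 'M[R]_d) :
  (forall i j, A x i j @[x --> F] --> B i j) -> \det (A x) @[x --> F] --> \det B.
Proof.
move=> AB; rewrite /determinant.
apply: cvg_big => [|s _]; first exact: add_continuous.
apply: cvgM; first exact: cvg_cst.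
by apply: cvg_big => [|i _]; [exact: mul_continuous|exact: AB].
Qed.

(** By Cramer's rule the entries are quotients of determinants. Invertibility is asked near the
    limit too, because [invmx] is given by this formula on invertible matrices only. *)
Lemma cvg_invmx d (A : T -> 'M[R]_d) (B : 'M[R]_d) i j :
  (forall i j, A x i j @[x --> F] --> B i j) -> B \in unitmx ->
  (\forall x \near F, A x \in unitmx) ->
  invmx (A x) i j @[x --> F] --> invmx B i j.
Proof.
move=> AB uB uA; rewrite [X in _ --> X](_ : _ = (\det B)^-1 * cofactor B j i); last first.
  by rewrite /invmx uB !mxE.
apply: cvg_trans.
  apply: (@near_eq_cvg _ _ F _ (fun x => (\det (A x))^-1 * cofactor (A x) j i)).
  by near=> x; rewrite /invmx (near uA x)// !mxE.
apply: cvgM.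
  by apply: cvgV; [rewrite -unitfE -unitmxE|exact: cvg_det].
apply: cvgM; first exact: cvg_cst.
apply: cvg_det => k l; rewrite !mxE.
by apply: cvg_trans (AB (lift j k) (lift i l)); under eq_fun do rewrite !mxE.
Unshelve. all: by end_near. Qed.

End continuity_invmx.

(** * Convex sets: interior and boundary *)

Section convex_sets.
Context (R : realType).
Local Notation mR := (measurableTypeR R).

Lemma convex_setP d (D : set 'rV[R]_d) (x y : 'rV[R]_d) (t : R) :
  convex_set D -> D x -> D y -> 0 <= t -> t <= 1 -> D (t *: x + (1 - t) *: y).
Proof.
move=> cD Dx Dy t0 t1.
by have := cD x y (Itv01 t0 t1); rewrite !inE; apply.
Qed.

Lemma convex_set_midpoint d (D : set 'rV[R]_d) (x y : 'rV[R]_d) :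
  convex_set D -> D x -> D y -> D (2^-1 *: (x + y)).
Proof.
move=> cD Dx Dy; have := @convex_setP d D x y 2^-1 cD Dx Dy.
rewrite (_ : 1 - 2^-1 = 2^-1 :> R); last by lra.
by rewrite -scalerDr; apply; lra.
Qed.

Lemma convex_functionP d (D : set 'rV[R]_d) (W : 'rV[R]_d -> R) (x y : 'rV[R]_d) (t : R) :
  convex_function D W -> D x -> D y -> 0 <= t -> t <= 1 ->
  W (t *: x + (1 - t) *: y) <= t * W x + (1 - t) * W y.
Proof.
move=> cW Dx Dy t0 t1.
by have := cW (Itv01 t0 t1) x y; rewrite !inE; apply.
Qed.

Lemma convex_function_midpoint d (D : set 'rV[R]_d) (W : 'rV[R]_d -> R) (x y : 'rV[R]_d) :
  convex_function D W -> D x -> D y -> 2 * W (2^-1 *: (x + y)) <= W x + W y.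
Proof.
move=> cW Dx Dy; have := @convex_functionP d D W x y 2^-1 cW Dx Dy.
rewrite (_ : 1 - 2^-1 = 2^-1 :> R); last by lra.
rewrite -scalerDr => /(_ _ _) H.
have : W (2^-1 *: (x + y)) <= 2^-1 * W x + 2^-1 * W y by apply: H; lra.
lra.
Qed.

Lemma rV_cons_conv n (a b : mR) (v w : 'rV[R]_n) (t : R) :
  t *: @rV_cons R n (a, v) + (1 - t) *: @rV_cons R n (b, w) =
  @rV_cons R n (t * a + (1 - t) * b : mR, t *: v + (1 - t) *: w).
Proof.
apply/rowP => i; rewrite !mxE/=; case: unliftP => [j _|_] //.
by rewrite !mxE.
Qed.

Lemma rV_unconsK n : cancel (@rV_uncons R n) (@rV_cons R n).
Proof.
move=> x; apply/rowP => i; rewrite !mxE/=; case: unliftP => [j ->|->] //.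
by rewrite mxE.
Qed.

(** A point [x] near the midpoint [c] is a convex combination, with weight [t x], of points of the
    two slices that are displaced from [u] and [v] by the same vector [w x]. This vector depends
    continuously on [x] and vanishes at [c], so both points stay in the given balls. *)
Lemma interior_rV_consS n (D : set 'rV[R]_n.+1) (a b : R) (u v : 'rV[R]_n) :
  convex_set D -> a < b ->
  [set w | D (@rV_cons R n (a : mR, w))]° u -> [set w | D (@rV_cons R n (b : mR, w))]° v ->
  D° !=set0.
Proof.
move=> cD ab /nbhs_ballP[e1 /= e10 ue1] /nbhs_ballP[e2 /= e20 ve2].
pose e := Num.min e1 e2; have e0 : 0 < e by rewrite lt_min e10.
have ue : ball u e `<=` [set w | D (@rV_cons R n (a, w))].
  by move=> w uw; apply: ue1; apply: le_ball uw; rewrite ge_min lexx.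
have ve : ball v e `<=` [set w | D (@rV_cons R n (b, w))].
  by move=> w vw; apply: ve2; apply: le_ball vw; rewrite ge_min lexx orbT.
pose t (x : 'rV[R]_n.+1) : R := (b - x ord0 ord0) / (b - a).
pose w (x : 'rV[R]_n.+1) (i : 'I_n) : R :=
  x ord0 (lift ord0 i) - (t x * u ord0 i + (1 - t x) * v ord0 i).
pose c : 'rV[R]_n.+1 := @rV_cons R n ((a + b) / 2 : mR, 2^-1 *: (u + v)).
have ba0 : b - a != 0 by rewrite subr_eq0 gt_eqF.
have tc : t c = 2^-1.
  by rewrite /t mxE unlift_none/=; apply: (mulIf ba0); rewrite divfK//; lra.
have wc i : w c i = 0.
  by rewrite /w tc mxE liftK/= !mxE; lra.
have ct : {for c, continuous t}.
  apply: continuousM; last exact: cst_continuous.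
  by apply: continuousB; [exact: cst_continuous|exact: coord_continuous].
have cw i : {for c, continuous (w^~ i)}.
  apply: continuousB; first exact: coord_continuous.
  apply: continuousD; apply: continuousM; [exact: ct|exact: cst_continuous| |
    exact: cst_continuous].
  by apply: continuousB; [exact: cst_continuous|exact: ct].
have nt : \forall x \near c, 0 <= t x <= 1.
  have half0 : 0 < 2^-1 :> R by [].
  move: ct => /cvgrPdist_lt /(_ _ half0); apply: filterS => x.
  by rewrite tc ltr_norml => /andP[? ?]; apply/andP; split; lra.
have nwi i : \forall x \near c, `|w x i| < e.
  move: (cw i) => /cvgrPdist_lt /(_ _ e0).
  by apply: filterS => x; rewrite wc sub0r normrN.
have nw : \forall x \near c, forall i, `|w x i| < e by exact: filter_forall nwi.
exists c; move: nt nw; apply: filterS2 => x t01 we.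
pose wx := \row_i w x i.
have -> : x = t x *: @rV_cons R n (a, u + wx) + (1 - t x) *: @rV_cons R n (b, v + wx).
  rewrite rV_cons_conv -[LHS]rV_unconsK; congr (@rV_cons R n (_, _)).
    have tE : t x * (b - a) = b - x ord0 ord0 by rewrite /t divfK.
    by transitivity (b - t x * (b - a)); [rewrite tE subKr|ring].
  by apply/rowP => i; rewrite !mxE /w; ring.
have /andP[t0 t1] := t01.
apply: convex_setP => //.
  apply: ue; apply/(ball_rVP _ _ _ _ _ e0) => i.
  by rewrite !mxE opprD addrA subrr sub0r normrN.
apply: ve; apply/(ball_rVP _ _ _ _ _ e0) => i.
by rewrite !mxE opprD addrA subrr sub0r normrN.
Qed.

(** By Tonelli some slice has positive measure, and so does a second one because a single first
    coordinate is negligible. By induction both have interior points, and [D] contains the segments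
    between them. *)
Lemma convex_interior_neq0 n (D : set 'rV[R]_n) : convex_set D -> measurable D ->
  lebesgue_rV R n D != 0%E -> D° !=set0.
Proof.
elim: n D => [|n IH] D cD mD D0.
  have [x Dx] : D !=set0.
    by apply/set0P; apply: contra_neq D0 => ->; rewrite measure0.
  have -> : D = setT by apply/seteqP; split => // y _; rewrite (_ : y = x)// !thinmx0.
  by rewrite interiorT; exists x.
pose S (a : mR) := [set w | D (@rV_cons R n (a, w))].
have mS a : measurable (S a).
  rewrite -[S a]setTI; apply: (measurableT_comp (@measurable_rV_cons R n)
    (@measurable_pair1 _ _ mR 'rV[R]_n a)) => //.
have cS a : convex_set (S a).
  move=> v w t; rewrite !inE => Sv Sw.
  have t0 : 0 <= t%:num by []. have t1 : t%:num <= 1 by [].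
  have := convex_setP _ _ _ _ _ cD Sv Sw t0 t1.
  by rewrite rV_cons_conv -mulrDl addrC subrK mul1r.
have DE : lebesgue_rV R n.+1 D = (\int[@lebesgue_measure R]_a lebesgue_rV R n (S a))%E.
  rewrite /= /lebesgue_rV_succ /pushforward /product_measure1/=.
  apply: eq_integral => a _; congr (lebesgue_rV R n _).
  by apply/seteqP; split => w; rewrite /xsection/= inE.
suff [a [b [ab Sa Sb]]] : exists a b, [/\ a < b, lebesgue_rV R n (S a) != 0%E
    & lebesgue_rV R n (S b) != 0%E].
  have [u Su] := IH _ (cS a) (mS a) Sa; have [v Sv] := IH _ (cS b) (mS b) Sb.
  exact: interior_rV_consS ab Su Sv.
have [a Sa] : exists a, lebesgue_rV R n (S a) != 0%E.
  apply: contrapT => /forallNP Sall; move: D0; rewrite DE integral0_eq ?eqxx// => a _.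
  by apply/eqP; apply: contra_notT (Sall a).
have mF : measurable_fun setT (fun a : mR => lebesgue_rV R n (S a)).
  have mD' : measurable (@rV_cons R n @^-1` D).
    by rewrite -[X in measurable X]setTI; exact: measurable_rV_cons.
  have := measurable_fun_xsection (lebesgue_rV R n) mD'.
  apply: eq_measurable_fun => b _ /=; congr (lebesgue_rV R n _).
  by apply/seteqP; split => w; rewrite /xsection/= inE.
have [b [ba Sb]] : exists b, b != a /\ lebesgue_rV R n (S b) != 0%E.
  apply: contrapT => /forallNP Sall; move: D0; rewrite DE.
  rewrite -(@integral_setD1 R _ a setT) ?integral0_eq ?eqxx//.
  - move=> b [_ /= /eqP ba]; apply/eqP; apply: contra_notT (Sall b) => Sb.
    by split.
  - exact: measurableD.
  - exact: measurable_funTS.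
by move: ba; rewrite neq_lt => /orP[ba|ab]; [exists b, a|exists a, b].
Qed.

(** The homothety with center [y] and ratio 1/2 sends a ball around [x] to a ball of half the
    radius. *)
Lemma interior_midpoint n (D : set 'rV[R]_n) (x y : 'rV[R]_n) :
  convex_set D -> D° x -> D y -> D° (2^-1 *: (x + y)).
Proof.
move=> cD /nbhs_ballP[e /= e0 xe] Dy.
have e20 : 0 < e / 2 by rewrite divr_gt0.
apply/nbhs_ballP; exists (e / 2) => //= z /(ball_rVP _ _ _ _ _ e20) zxy.
have -> : z = 2^-1 *: ((2 *: z - y) + y).
  by rewrite subrK scalerA mulVf ?scale1r.
apply: convex_set_midpoint => //; apply: xe; apply/(ball_rVP _ _ _ _ _ e0) => i.
have := zxy i; rewrite !mxE.
rewrite !ltr_norml => /andP[? ?]; apply/andP; split; lra.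
Qed.

Lemma bounded_lebesgue_rV_lty n (D : set 'rV[R]_n) (r : R) : measurable D ->
  (forall x i, D x -> `|x ord0 i| <= r) -> (lebesgue_rV R n D < +oo)%E.
Proof.
move=> mD Dr.
pose B := [set x : 'rV[R]_n | forall i, `[- r, r]%classic (x ord0 i)].
have mB : measurable B.
  rewrite (_ : B = \bigcap_(i in [set: 'I_n])
      ((fun x : 'rV[R]_n => x ord0 i : mR) @^-1` `[- r, r]%classic)).
    apply: fin_bigcap_measurable => // i _.
    by rewrite -[X in measurable X]setTI; apply: measurable_coor.
  by apply/seteqP; split => x Ax i; [move=> _|]; apply: Ax.
apply: (@le_lt_trans _ _ (lebesgue_rV R n B)).
  apply: le_measure; rewrite ?inE//.
  by move=> x Dx i; rewrite /= in_itv/= -ler_norml; exact: Dr.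
pose I : set mR := `[- r, r]%classic.
rewrite (@lebesgue_rV_box R n (fun=> I)); last by move=> i; exact: measurable_itv.
suff : (\prod_(i < n) @lebesgue_measure R I)%E \is a fin_num.
  by rewrite fin_numElt => /andP[].
apply: (big_ind (fun x => x \is a fin_num)) => // [x y|i _]; first exact: fin_numM.
by rewrite /I lebesgue_measure_itv/=; case: ifP.
Qed.

Lemma lebesgue_rV_ball_gt0 n (x : 'rV[R]_n) (e : R) : 0 < e ->
  (0 < lebesgue_rV R n (ball x e))%E.
Proof.
move=> e0.
have -> : ball x e = [set y | forall i, `](x ord0 i - e), (x ord0 i + e)[%classic (y ord0 i)].
  apply/seteqP; split => y.
    move=> /(ball_rVP _ _ _ _ _ e0) xy i; have := xy i.
    by rewrite /= in_itv/= ltr_norml => /andP[? ?]; apply/andP; split; lra.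
  move=> xy; apply/(ball_rVP _ _ _ _ _ e0) => i; have := xy i.
  by rewrite /= in_itv/= ltr_norml => /andP[? ?]; apply/andP; split; lra.
rewrite (@lebesgue_rV_box R n (fun i => `](x ord0 i - e), (x ord0 i + e)[%classic))//.
apply: (big_ind (fun x => 0 < x)%E) => // [a b|i _]; first exact: mule_gt0.
by rewrite lebesgue_measure_itv/= lte_fin ifT -?EFinB ?lte_fin; lra.
Qed.

Lemma measurable_open_rV n (D : set 'rV[R]_n) : open D -> measurable D.
Proof. by rewrite rV_borelE; exact: sub_sigma_algebra. Qed.

(* Prekopa-Leindler for the indicators of [D°], [D] and [D°]: the midpoint of a
   point of [D°] and a point of [D] is in [D°]. *)
Lemma lebesgue_rV_boundary n (D : set 'rV[R]_n) : convex_set D -> measurable D ->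
  (lebesgue_rV R n D < +oo)%E -> D° !=set0 -> lebesgue_rV R n (D `\` D°) = 0%E.
Proof.
move=> cD mD Doo [c Dc].
have mDo : measurable D° by apply: measurable_open_rV; exact: open_interior.
have DoD : D° `<=` D by exact: interior_subset.
have Dooo : (lebesgue_rV R n D° < +oo)%E.
  by apply: le_lt_trans Doo; apply: le_measure; rewrite ?inE.
have Do0 : (0 < lebesgue_rV R n D°)%E.
  have /nbhs_ballP[e /= e0 ce] : nbhs c D°.
    by apply: open_nbhs_nbhs; split => //; exact: open_interior.
  apply: (lt_le_trans (lebesgue_rV_ball_gt0 _ c _ e0)).
  apply: le_measure; rewrite ?inE//; apply: measurable_open_rV; exact: ball_open.
have : (lebesgue_rV R n D° * lebesgue_rV R n D <= lebesgue_rV R n D° * lebesgue_rV R n D°)%E.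
  have mI A : measurable A -> measurable_fun setT (fun x : 'rV[R]_n => (\1_A x : R)%:E).
    by move=> mA; apply/measurable_EFinP; exact: measurable_indic.
  have := @prekopa_leindler R n (fun x => (\1_(D°) x)%:E) (fun x => (\1_D x)%:E)
    (fun x => (\1_(D°) x)%:E) (mI _ mDo) (mI _ mD) (mI _ mDo).
  rewrite !integral_indic// !setIT; apply; try by move=> x; rewrite lee_fin.
  move=> x y; rewrite -!EFinM lee_fin !indicE.
  have [xD|xD] := boolP (x \in (D° : set _)); last by rewrite mul0r -expr2 sqr_ge0.
  have [yD|yD] := boolP (y \in D); last by rewrite mulr0 -expr2 sqr_ge0.
  rewrite (_ : _ \in (D° : set _)) ?inE//; apply: interior_midpoint => //.
    by move: xD; rewrite inE.
  by move: yD; rewrite inE.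
rewrite lee_pmul2l//; last by rewrite ge0_fin_numE.
move=> DDo; apply/eqP; rewrite eq_le measure_ge0 andbT measureD//.
by rewrite (setIidr DoD) lee_subel_addr ?add0e// ge0_fin_numE.
Qed.

End convex_sets.

(** * Elementary real inequalities *)

Section real_estimates.
Context (R : realType).

(** Lets a small parameter tend to zero without introducing limits. *)
Lemma ler_of_linear_error (x y C e0 : R) : 0 < e0 ->
  (forall e, 0 < e < e0 -> x <= y + e * C) -> x <= y.
Proof.
move=> e00 xy; apply: contrapT => /negP; rewrite -ltNge => yx.
pose C' := `|C| + 1; have C'0 : 0 < C' by rewrite ltr_wpDl.
have CC' : C <= C' by rewrite /C' (le_trans (ler_norm _))// lerDl.
pose e := Num.min (e0 / 2) ((x - y) / (2 * C')).
have e_gt0 : 0 < e by rewrite lt_min !divr_gt0// ?mulr_gt0// subr_gt0.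
have ee0 : e < e0.
  by apply: (@le_lt_trans _ _ (e0 / 2)); [rewrite ge_min lexx|lra].
have := xy e; rewrite e_gt0 ee0 => /(_ isT).
have : e * C <= e * C' by rewrite ler_wpM2l// ltW.
have : e * C' <= (x - y) / 2.
  rewrite -ler_pdivlMr//; apply: (@le_trans _ _ ((x - y) / (2 * C'))).
    by rewrite ge_min lexx orbT.
  by rewrite invfM mulrA.
lra.
Qed.

(** The odd degree makes this valid for both signs of [x]: the remainder is
    [(expR t - (1 + t)) * s * x] with [s] between 0 and [x], so [s * x] is nonnegative. *)
Lemma expR_ge_cubic (x : R) : 1 + x + x ^+ 2 / 2 + x ^+ 3 / 6 <= expR x.
Proof.
pose f2 (x : R) := expR x - (1 + x + x ^+ 2 / 2).
pose f3 (x : R) := expR x - (1 + x + x ^+ 2 / 2 + x ^+ 3 / 6).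
have d2 (s : R) : is_derive s 1 f2 (expR s - (1 + s)).
  by apply: is_derive_eq; rewrite /GRing.scale/=; field.
have d3 (s : R) : is_derive s 1 f3 (f2 s).
  by apply: is_derive_eq; rewrite /f2 /GRing.scale/=; field.
have [s sx] := MVT_between _ _ _ 0 x (fun s _ => d3 s).
have [t _] := MVT_between _ _ _ 0 s (fun s _ => d2 s).
rewrite /f2 /f3 !expr0n/= !mul0r !addr0 expR0 subrr !subr0 => f2E f3E.
rewrite -subr_ge0 f3E f2E -mulrA mulr_ge0 ?subr_ge0 ?expR_ge1Dx//.
have /orP[x0|x0] := le_total 0 x; move: sx.
  by rewrite (min_l x0) (max_r x0) => /andP[? _]; rewrite mulr_ge0.
by rewrite (min_r x0) (max_l x0) => /andP[_ ?]; rewrite mulr_le0.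
Qed.

(** Since [(1 - x) * expR x <= 1], it is enough that [(1 - x) * (1 + x + 2 * x ^+ 2)], which is
    [1 + x ^+ 2 - 2 * x ^+ 3], be at least 1. *)
Lemma expR_le_quadratic (x : R) : 0 <= x <= 2^-1 -> expR x <= 1 + x + 2 * x ^+ 2.
Proof.
move=> /andP[x0 x1]; have := expR_ge1Dx (- x); rewrite expRN => h.
have ex0 : 0 < expR x by exact: expR_gt0.
have {}h : (1 - x) * expR x <= 1 by rewrite -ler_pdivlMr// div1r.
nra.
Qed.

Lemma expR_quarter_le2 : expR (4^-1 : R) <= 2.
Proof.
have h : (0 <= 4^-1 :> R) && (4^-1 <= 2^-1 :> R) by apply/andP; split; lra.
have := expR_le_quadratic _ h; lra.
Qed.

End real_estimates.

(** * Continuity and integrals on compact sets *)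

Section continuity.
Context (R : realType) (d : nat).
Local Notation mR := (measurableTypeR R).
Local Notation lam := (lebesgue_rV R d).
Implicit Types (f g : 'rV[R]_d -> R) (U K : set 'rV[R]_d).

(** Continuity in the whole space at the points of [U]; for [U] not open this is stronger than
    continuity within [U]. *)
Definition cont_on U f := forall x, U x -> {for x, continuous f}.

Lemma cont_onS U K f : K `<=` U -> cont_on U f -> cont_on K f.
Proof. by move=> KU cf x /KU; exact: cf. Qed.

Lemma cont_on_cst U (k : R) : cont_on U (fun=> k).
Proof. by move=> x Ux; exact: cst_continuous. Qed.

Lemma cont_onD U f g : cont_on U f -> cont_on U g -> cont_on U (fun x => f x + g x).
Proof. by move=> cf cg x Ux; apply: continuousD; [exact: cf|exact: cg]. Qed.

Lemma cont_onN U f : cont_on U f -> cont_on U (fun x => - f x).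
Proof. by move=> cf x Ux; apply: continuousN; exact: cf. Qed.

Lemma cont_onM U f g : cont_on U f -> cont_on U g -> cont_on U (fun x => f x * g x).
Proof. by move=> cf cg x Ux; apply: continuousM; [exact: cf|exact: cg]. Qed.

Lemma cont_on_expR U f : cont_on U f -> cont_on U (fun x => expR (f x)).
Proof.
move=> cf x Ux; apply: (@continuous_comp _ _ _ f expR); first exact: cf.
exact: continuous_expR.
Qed.

Lemma cont_on_within U f : cont_on U f -> {within U, continuous f}.
Proof. by move=> cf; apply: continuous_in_subspaceT => x; rewrite inE; exact: cf. Qed.

Lemma measurable_fun_within U f : measurable U -> {within U, continuous f} ->
  measurable_fun U (f : 'rV[R]_d -> mR).
Proof.
move=> mU cf.
have mG : @measurable _ (measurableTypeR R) = <<s @measurable_realfun.RGenOpens.G R >>.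
  exact: measurable_realfun.RGenOpens.measurableE.
apply: (@measurability _ _ 'rV[R]_d mR U _ _ mG) => _ [V [a [b ->]] <-].
have oab : open (`]a, b[%classic : set R) by exact: interval_open.
have /continuousP /(_ _ oab) /open_subspaceP [Q oQ QE] := cf.
by rewrite setIC -QE; apply: measurableI => //; exact: measurable_open_rV.
Qed.

Lemma cont_on_bounded K f : compact K -> cont_on K f ->
  exists M, forall x, K x -> `|f x| <= M.
Proof.
move=> cK /cont_on_within cf.
have [M [_ HM]] := compact_bounded (continuous_compact cf cK).
exists (M + 1) => x Kx; apply: (HM (M + 1)); first by rewrite ltrDl.
by exists x.
Qed.

Lemma cont_on_integrable K f : measurable K -> compact K -> (lam K < +oo)%E ->
  cont_on K f -> lam.-integrable K (EFin \o f).
Proof.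
move=> mK cK Koo cf; apply: measurable_bounded_integrable => //.
  by apply: measurable_fun_within => //; exact: cont_on_within.
have [M HM] := cont_on_bounded _ _ cK cf.
exists M; split => [|x Mx y Ky]; first exact: num_real.
by apply: le_trans (HM _ Ky) _; exact: ltW.
Qed.

Lemma Rintegral_linear3 K (a b c : R) (F G H : 'rV[R]_d -> R) :
  measurable K -> compact K -> (lam K < +oo)%E ->
  cont_on K F -> cont_on K G -> cont_on K H ->
  (\int[lam]_(x in K) (a * F x + b * G x + c * H x) =
   a * \int[lam]_(x in K) F x + b * \int[lam]_(x in K) G x +
   c * \int[lam]_(x in K) H x)%R.
Proof.
move=> mK cK Koo cF cG cH.
have iK f : cont_on K f -> lam.-integrable K (EFin \o f) by exact: cont_on_integrable.
have cZ k f : cont_on K f -> cont_on K (fun x => k * f x).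
  by apply: cont_onM; exact: cont_on_cst.
rewrite RintegralD//; [|exact/iK/cont_onD/cZ/cG/cZ|exact/iK/cZ].
by rewrite RintegralD ?RintegralZl//; [exact/iK|exact/iK|exact/iK|
  exact/iK/cZ|exact/iK/cZ].
Qed.

(** Stronger than uniform continuity on [K]: [y] may leave [K], as it does in Taylor estimates
    around points of [K]. *)
Lemma cont_on_uniform K f (e : R) : compact K -> cont_on K f -> 0 < e ->
  exists2 r, 0 < r & forall z y, K z -> ball z r y -> `|f y - f z| <= e.
Proof.
move=> /compact_near_coveringP cK cf e0.
have := cK R (0^'+) (fun r z => forall y, ball z r y -> `|f y - f z| <= e) _.
case=> [x Kx|r r0 H]; last first.
- exists (r / 2); first by rewrite divr_gt0.
  move=> z y Kz zy; apply: (H (r / 2)) => //=.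
    by rewrite sub0r normrN gtr0_norm ?divr_gt0//; move: r0 => /=; lra.
  by rewrite divr_gt0.
- have e20 : 0 < e / 2 by rewrite divr_gt0.
  have /cvgrPdist_le /(_ _ e20) /nbhs_ballP[r /= r0 xr] := cf x Kx.
  have r20 : 0 < r / 2 by rewrite divr_gt0.
  exists (ball x (r / 2), [set s | 0 < s < r / 2]) => /=.
    split; first exact: nbhsx_ballx.
    exists (r / 2) => //= s /=; rewrite sub0r normrN => sr s0.
    by rewrite s0/= (le_lt_trans (ler_norm _) sr).
  move=> [z s] [/= xz /andP[s0 sr]] y zy.
  have xz' : ball x r z by apply: le_ball xz; lra.
  have xy : ball x r y.
    by apply: ball_split xz _; apply: le_ball zy; exact: ltW.
  have := xr _ xy; have := xr _ xz'.
  move: (f x) (f y) (f z) => a b c; rewrite !ler_norml => /andP[? ?] /andP[? ?].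
  by apply/andP; split; lra.
Qed.

End continuity.

(** * Gradients and Hessians on open sets *)

Section hessian.
Context (R : realType) (d : nat).
Implicit Types (f : 'rV[R]_d -> R) (U K : set 'rV[R]_d) (x y z v : 'rV[R]_d).
Local Notation e_ i := (delta_mx ord0 i : 'rV[R]_d).

Definition grad f x : 'rV[R]_d := \row_i partial i f x.

Definition hess f x : 'M[R]_d := \matrix_(i, j) partial i (partial j f) x.

Lemma hessE f x i j : hess f x i j = partial i (partial j f) x.
Proof. by rewrite mxE. Qed.

(** Only derivatives are concerned; continuity of [f] itself is recorded separately by [cont_on]. *)
Definition C1_on U f :=
  (forall i x, U x -> derivable f x (e_ i)) /\ forall i, cont_on R d U (partial i f).

Definition C2_on U f := C1_on U f /\ forall i, C1_on U (partial i f).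

Lemma nbhs_open U x : open U -> U x -> nbhs x U.
Proof. by move=> oU Ux; apply: open_nbhs_nbhs. Qed.

Lemma hess_sym U f x : open U -> C2_on U f -> U x -> (hess f x)^T = hess f x.
Proof.
move=> oU [[df cf] C2] Ux; apply/matrixP => i j; rewrite !mxE.
apply: partial_comm.
- by apply: filterS (nbhs_open _ _ oU Ux) => y Uy k; exact: df.
- by apply: filterS (nbhs_open _ _ oU Ux) => y Uy k l; apply: (C2 l).1.
- by move=> k l; apply: (C2 l).2.
Qed.

(** Cauchy-Schwarz. The coordinatewise Taylor errors are in terms of the sum of absolute values, the
    quadratic forms in terms of the Euclidean norm. *)
Lemma sum_norm_sqr_le v : (\sum_i `|v ord0 i|) ^+ 2 <= d%:R * dotp v v.
Proof.
rewrite expr2 mulr_suml.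
apply: (@le_trans _ _ (\sum_i \sum_j (v ord0 i ^+ 2 / 2 + v ord0 j ^+ 2 / 2))).
  apply: ler_sum => i _; rewrite mulr_sumr; apply: ler_sum => j _.
  rewrite -(real_normK (num_real (v ord0 i))) -(real_normK (num_real (v ord0 j))).
  by have := sqr_ge0 (`|v ord0 i| - `|v ord0 j|); lra.
have NE : \sum_i v ord0 i ^+ 2 = dotp v v by apply: eq_bigr => i _; rewrite expr2.
have inner i : \sum_(j < d) (v ord0 i ^+ 2 / 2 + v ord0 j ^+ 2 / 2) =
    v ord0 i ^+ 2 * (d%:R / 2) + dotp v v / 2.
  by rewrite big_split/= sumr_const card_ord -mulr_suml NE -mulr_natr; congr (_ + _); ring.
rewrite (eq_bigr _ (fun i _ => inner i)) big_split/= sumr_const card_ord -mulr_suml NE.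
by rewrite -mulr_natr; lra.
Qed.

Lemma hess_second_difference U f z (r eta : R) v : 0 < r -> C2_on U f -> ball z r `<=` U ->
  (forall y i j, ball z r y -> `|hess f y i j - hess f z i j| <= eta) ->
  ball z r (z + v) ->
  `|f (z + v) + f (z - v) - 2 * f z - qform R d (hess f z) v| <=
    eta * (\sum_i `|v ord0 i|) ^+ 2.
Proof.
move=> r0 [[df cf] C2] zU fH zv.
apply: (@second_difference_le R d f z r (fun i j => hess f z i j)) => //.
- by move=> y i /zU Uy; exact: df.
- by move=> y i /zU; exact: cf.
- by move=> y i j /zU Uy; apply: (C2 j).1.
- by move=> y i j zy; rewrite -hessE; exact: fH.
Qed.

Lemma hess_uniform U K f (e : R) : open U -> compact K -> K `<=` U -> C2_on U f ->
  0 < e -> exists2 r, 0 < r & forall z y i j, K z -> ball z r y ->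
  `|hess f y i j - hess f z i j| <= e.
Proof.
move=> oU cK KU [_ C2] e0.
have close i j : exists2 r : R, 0 < r & forall z y, K z -> ball z r y ->
    `|hess f y i j - hess f z i j| <= e.
  have cij : cont_on R d K (partial i (partial j f)) by apply: cont_onS KU _; exact: (C2 j).2.
  have [r r0 Hr] := cont_on_uniform _ _ _ _ _ cK cij e0.
  exists r; [exact: r0|move=> z y Kz zy].
  have := Hr z y Kz zy; congr (is_true (`|_ - _| <= _)); exact/esym/hessE.
have /choice[rr rrP] (p : 'I_d * 'I_d) : exists r : R, 0 < r /\ forall z y,
    K z -> ball z r y -> `|hess f y p.1 p.2 - hess f z p.1 p.2| <= e.
  have [r r0 Hr] := close p.1 p.2; exists r; exact: (conj r0 Hr).
exists (\big[Num.min/1]_p rr p).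
  by elim/big_ind: _ => [//|x y x0 y0|p _]; [rewrite lt_min x0|have [] := rrP p].
move=> z y i j Kz zy; have [_ Hr] := rrP (i, j); apply: Hr Kz _.
by apply: le_ball zy; exact: bigmin_le.
Qed.

(** Midpoint convexity makes the second difference in direction [t *: v] nonnegative, and it is
    [t ^+ 2] times the Hessian form up to [eta * (t * S) ^+ 2]. Dividing by [t ^+ 2] leaves an error
    as small as desired. *)
Lemma hess_psd U f z v : open U -> C2_on U f -> U z ->
  (forall x y, U x -> U y -> 2 * f (2^-1 *: (x + y)) <= f x + f y) ->
  0 <= qform R d (hess f z) v.
Proof.
move=> oU C2 Uz fU; pose S := \sum_i `|v ord0 i|.
apply: (@ler_of_linear_error R _ _ (S ^+ 2) 1) => // eta /andP[eta0 _].
have cz : compact [set z] by exact: compact_set1.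
have [|r r0 zr] := @hess_uniform U [set z] f eta oU cz _ C2 eta0.
  by move=> _ ->.
have /nbhs_ballP[r' /= r'0 zU] := nbhs_open _ _ oU Uz.
pose s := Num.min r r'; have s0 : 0 < s by rewrite lt_min r0.
have zsr : ball z s `<=` ball z r by apply: le_ball; rewrite ge_min lexx.
have zsU : ball z s `<=` U by apply: subset_trans zU; apply: le_ball; rewrite ge_min lexx orbT.
have S0 : 0 <= S by exact: sumr_ge0.
(* Only the absolute values of the coordinates matter, so one [t] serves [v] and [- v]. *)
have [t t0 zt] : exists2 t, 0 < t &
    forall w : 'rV[R]_d, (forall i, `|w ord0 i| = `|v ord0 i|) -> ball z s (z + t *: w).
  have t0 : 0 < s / (2 * (S + 1)) by rewrite divr_gt0// mulr_gt0// ltr_wpDl.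
  exists (s / (2 * (S + 1))) => // w wv; apply/(ball_rVP _ _ _ _ _ s0) => i; rewrite !mxE.
  rewrite opprD addrA subrr sub0r normrN normrM wv gtr0_norm//.
  have viS : `|v ord0 i| <= S by rewrite /S (bigD1 i)//= lerDl sumr_ge0.
  rewrite mulrAC ltr_pdivrMr ?mulr_gt0 ?ltr_wpDl// ltr_pM2l//; lra.
have Nvv i : `|(- v) ord0 i| = `|v ord0 i| by rewrite mxE normrN.
have := @hess_second_difference U f z s eta (t *: v) s0 C2 zsU.
move=> /(_ _ _) H.
have {H} : `|f (z + t *: v) + f (z - t *: v) - 2 * f z - qform R d (hess f z) (t *: v)| <=
    eta * (\sum_i `|(t *: v) ord0 i|) ^+ 2.
  by apply: H; [move=> y i j /zsr; exact: zr|exact: zt].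
have -> : \sum_i `|(t *: v) ord0 i| = t * S.
  by rewrite mulr_sumr; apply: eq_bigr => i _; rewrite mxE normrM gtr0_norm.
have -> : qform R d (hess f z) (t *: v) = t ^+ 2 * qform R d (hess f z) v.
  rewrite /qform mulr_sumr; apply: eq_bigr => i _; rewrite mulr_sumr.
  by apply: eq_bigr => j _; rewrite !mxE; ring.
have := fU (z + t *: v) (z - t *: v) (zsU _ (zt _ (fun=> erefl))).
have zz : 2^-1 *: (z + t *: v + (z - t *: v)) = z.
  rewrite addrACA subrr addr0 scalerDr -scalerDl (_ : _ + _ = 1) ?scale1r//; lra.
rewrite zz => /(_ _) fzab.
have {fzab} : 2 * f z <= f (z + t *: v) + f (z - t *: v).
  by apply: fzab; apply: zsU; rewrite -scalerN; exact: zt.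
move: (qform _ _ _ _) (f _) (f _) (f _) => q fa fb fz fzab.
rewrite ler_norml => /andP[_ h].
have t20 : 0 < t ^+ 2 by rewrite exprn_gt0.
have : 0 <= t ^+ 2 * (q + eta * S ^+ 2).
  have -> : t ^+ 2 * (q + eta * S ^+ 2) = t ^+ 2 * q + eta * (t * S) ^+ 2.
    by rewrite exprMn; ring.
  by move: (t ^+ 2 * q) (eta * _) h => A B h; lra.
by rewrite pmulr_rge0.
Qed.

End hessian.

Lemma continuous_at_sum (R : realType) (T : topologicalType) (I : Type) (r : seq I)
    (F : I -> T -> R) (x : T) : (forall i, {for x, continuous (F i)}) ->
  {for x, continuous (fun y => \sum_(i <- r) F i y)}.
Proof. by move=> cF; apply: cvg_big => [|i _]; [exact: add_continuous|exact: cF]. Qed.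

(** * Bound on the exponent in Prekopa-Leindler *)

Section brascamp_lieb.
Context (R : realType) (d : nat).
Local Notation mR := (measurableTypeR R).
Local Notation lam := (lebesgue_rV R d).
Local Notation e_ i := (delta_mx ord0 i : 'rV[R]_d).
Variables (U K : set 'rV[R]_d) (h W : 'rV[R]_d -> R) (c : R).
Hypothesis oU : open U.
Hypothesis KU : K `<=` U.
Hypothesis cK : compact K.
Hypothesis midK : forall x y, K x -> K y -> K (2^-1 *: (x + y)).
Variable r1 : R.
Hypothesis r10 : 0 < r1.
Hypothesis ballK : forall z, K z -> ball z r1 `<=` U.
Hypothesis ch : cont_on R d U h.
Hypothesis C1h : C1_on R d U h.
Hypothesis C2W : C2_on R d U W.
Hypothesis midW : forall x y, U x -> U y -> 2 * W (2^-1 *: (x + y)) <= W x + W y.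
Hypothesis c0 : 0 < c.

(** The Hessian of [gauss_potential]. *)
Definition bl_matrix (x : 'rV[R]_d) : 'M[R]_d := c%:M + hess R d W x.

Definition bl_qform (x : 'rV[R]_d) : R := dual_qform R d (bl_matrix x) (grad R d h x).

Lemma bl_matrix_sym x : U x -> (bl_matrix x)^T = bl_matrix x.
Proof. by move=> Ux; rewrite /bl_matrix raddfD/= tr_scalar_mx (hess_sym _ _ U). Qed.

Lemma bl_matrix_posdef x v : U x -> c * dotp v v <= qform R d (bl_matrix x) v.
Proof.
move=> Ux; rewrite /bl_matrix qformD_scalar lerDl.
exact: (hess_psd _ _ U).
Qed.

Lemma bl_matrix_psd x v : U x -> 0 <= qform R d (bl_matrix x) v.
Proof.
by move=> Ux; apply: le_trans (bl_matrix_posdef x v Ux); rewrite mulr_ge0 ?dotp_ge0// ltW.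
Qed.

Lemma bl_matrix_unit x : U x -> bl_matrix x \in unitmx.
Proof. by move=> Ux; apply: (unitmx_posdef _ _ c) => // v; exact: bl_matrix_posdef. Qed.

Lemma bl_qform_ge0 x : U x -> 0 <= bl_qform x.
Proof.
move=> Ux; apply: dual_qform_ge0; [exact: bl_matrix_sym| |exact: bl_matrix_unit].
by move=> v; exact: bl_matrix_psd.
Qed.

Lemma cont_on_bl_qform : cont_on R d U bl_qform.
Proof.
move=> x Ux.
have cA i j : {for x, continuous (fun y => bl_matrix y i j)}.
  rewrite (_ : (fun y => _) = (fun y => (c%:M : 'M[R]_d) i j + partial i (partial j W) y)).
    by apply: continuousD; [exact: cst_continuous|apply: (C2W.2 j).2].
  by apply/funext => y; rewrite mxE hessE.
have cV i j : {for x, continuous (fun y => invmx (bl_matrix y) i j)}.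
  have uA : \forall y \near x, bl_matrix y \in unitmx.
    by apply: filterS (nbhs_open _ _ _ _ oU Ux) => y; exact: bl_matrix_unit.
  exact: (@cvg_invmx R _ (nbhs x) (nbhs_filter x) d bl_matrix (bl_matrix x) i j cA
    (bl_matrix_unit x Ux) uA).
have -> : bl_qform = (fun y =>
    \sum_i (\sum_j invmx (bl_matrix y) i j * partial j h y) * partial i h y).
  apply/funext => y; rewrite /bl_qform /dual_qform; apply: eq_bigr => i _.
  by rewrite !mxE; congr (_ * _); apply: eq_bigr => j _; rewrite !mxE.
apply: continuous_at_sum => i.
apply: continuousM; last exact: C1h.2.
apply: continuous_at_sum => j.
by apply: continuousM; [exact: cV|exact: C1h.2].
Qed.

(** Taylor's formula leaves the errors [2 * eta * e * S] and [eta * S ^+ 2]. The first is at most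
    [eta * (e ^+ 2 + S ^+ 2)], and the terms in [S ^+ 2] are paid with a share [de] of
    [c * dotp v v]. The remaining share [1 - de] of the form is played against the linear term by
    duality. *)
Lemma exponent_le_local (de eta e r : R) z v : 0 < de < 1 -> 0 <= eta <= de ->
  2 * eta * d%:R <= de * c -> 0 < e -> 0 < r -> U z -> ball z r `<=` U ->
  (forall y i, ball z r y -> `|partial i h y - partial i h z| <= eta) ->
  (forall y i j, ball z r y -> `|hess R d W y i j - hess R d W z i j| <= eta) ->
  ball z r (z + v) ->
  e * (h (z + v) - h (z - v)) - (W (z + v) + W (z - v) - 2 * W z + c * dotp v v) <=
  2 * e ^+ 2 * (bl_qform z / (2 * (1 - de)) + de).
Proof.
move=> /andP[de0 de1] /andP[eta0 etade] etad e0 r0 Uz zU hz Wz zv.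
pose S := \sum_i `|v ord0 i|; pose g := grad R d h z.
have zNv : ball z r (z - v).
  apply/(ball_rVP _ _ _ _ _ r0) => i; move: zv => /(ball_rVP _ _ _ _ _ r0)/(_ i).
  by rewrite !mxE !opprD !addrA !subrr !sub0r !normrN.
have hD : h (z + v) - h (z - v) <= 2 * dotp v g + 2 * eta * S.
  have := @partial_increment_le R d h z r (fun i => partial i h z) eta (z - v) (2 *: v) r0.
  rewrite (_ : z - v + 2 *: v = z + v); last first.
    by rewrite -addrA -scaleN1r -scalerDl (_ : -1 + 2 = 1) ?scale1r//; ring.
  move=> /(_ _ _ _ _) H.
  have {H} : `|h (z + v) - h (z - v) - \sum_i (2 *: v) ord0 i * partial i h z| <=
      eta * \sum_i `|(2 *: v) ord0 i|.
    by apply: H => // y i /zU Uy; exact: C1h.1.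
  have -> : \sum_i (2 *: v) ord0 i * partial i h z = 2 * dotp v g.
    by rewrite mulr_sumr; apply: eq_bigr => i _; rewrite !mxE mulrA.
  have -> : \sum_i `|(2 *: v) ord0 i| = 2 * S.
    by rewrite mulr_sumr; apply: eq_bigr => i _; rewrite mxE normrM ger0_norm.
  by rewrite ler_norml => /andP[_]; lra.
have WD : qform R d (hess R d W z) v - eta * S ^+ 2 <= W (z + v) + W (z - v) - 2 * W z.
  have := @hess_second_difference R d U W z r eta v r0 C2W zU Wz zv.
  by rewrite ler_norml => /andP[+ _]; rewrite -/S; lra.
have qWz : 0 <= qform R d (hess R d W z) v by exact: (hess_psd _ _ U).
have Sd : S ^+ 2 <= d%:R * dotp v v by exact: sum_norm_sqr_le.
have qHE : qform R d (bl_matrix z) v = c * dotp v v + qform R d (hess R d W z) v.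
  exact: qformD_scalar.
(* With this parameter, multiplication by [1 - de] restores the linear term [2 * e * dotp v g]. *)
have dual := @qform_dual R d (bl_matrix z) g v (e / (1 - de)) (bl_matrix_sym z Uz)
  (fun u => bl_matrix_psd z u Uz) (bl_matrix_unit z Uz).
rewrite -/(bl_qform z) in dual.
have N0 : 0 <= dotp v v by exact: dotp_ge0.
move: hD WD dual; rewrite qHE; move: qWz Sd N0.
move: (qform _ _ (hess _ _ _ _) v) (dotp v v) (dotp v g) (bl_qform z) S => q N vg Q S.
move: (h _ - h _) (W _ + W _ - _) => hh WW qWz Sd N0 hD WD dual.
have etaS : 2 * (eta * S ^+ 2) <= de * (c * N).
  have : 2 * eta * S ^+ 2 <= 2 * eta * (d%:R * N) by rewrite ler_wpM2l// mulr_ge0.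
  have : 2 * eta * d%:R * N <= de * c * N by rewrite ler_wpM2r.
  lra.
have deq : 0 <= de * q by rewrite mulr_ge0// ltW.
have ehD : e * hh <= e * (2 * vg + 2 * eta * S) by rewrite ler_wpM2l// ltW.
have eS : 2 * eta * (e * S) <= eta * (e ^+ 2 + S ^+ 2).
  rewrite -subr_ge0 (_ : _ - _ = eta * (e - S) ^+ 2); last by ring.
  by rewrite mulr_ge0// sqr_ge0.
have etae : eta * e ^+ 2 <= de * e ^+ 2 by rewrite ler_wpM2r// sqr_ge0.
have de1' : 0 < 1 - de by rewrite subr_gt0.
have {}dual : 2 * e * vg - (1 - de) * (c * N + q) <= e ^+ 2 * (Q / (1 - de)).
  have := dual; rewrite -(ler_pM2l de1').
  rewrite (_ : (1 - de) * (2 * (e / (1 - de)) * vg - _) = 2 * e * vg - (1 - de) * (c * N + q)).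
    move=> /le_trans; apply; rewrite le_eqVlt; apply/orP; left; apply/eqP.
    by field; rewrite gt_eqF.
  by field; rewrite gt_eqF.
have -> : 2 * e ^+ 2 * (Q / (2 * (1 - de)) + de) = e ^+ 2 * (Q / (1 - de)) + 2 * (de * e ^+ 2).
  by field; rewrite gt_eqF.
have dee : 0 <= de * e ^+ 2 by rewrite mulr_ge0 ?sqr_ge0// ltW.
move: (e ^+ 2 * (Q / _)) dual => A dual.
nra.
Qed.

Lemma grad_uniform (e : R) : 0 < e -> exists2 r, 0 < r & forall z y i, K z -> ball z r y ->
  `|partial i h y - partial i h z| <= e.
Proof.
move=> e0.
have /choice[rr rrP] (i : 'I_d) : exists r : R, 0 < r /\ forall z y,
    K z -> ball z r y -> `|partial i h y - partial i h z| <= e.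
  have ci : cont_on R d K (partial i h) by apply: cont_onS KU _; exact: C1h.2.
  have [r r0 Hr] := cont_on_uniform _ _ _ _ _ cK ci e0.
  by exists r; exact: (conj r0 Hr).
exists (\big[Num.min/1]_i rr i).
  by elim/big_ind: _ => [//|x y x0 y0|i _]; [rewrite lt_min x0|have [] := rrP i].
move=> z y i Kz zy; have [_ Hr] := rrP i; apply: Hr Kz _.
by apply: le_ball zy; exact: bigmin_le.
Qed.

Definition gauss_potential (x : 'rV[R]_d) : R := W x + c / 2 * dotp x x.

(** The parallelogram identity: the second difference of the squared norm is exact. *)
Lemma gauss_potential_second_difference z v :
  gauss_potential (z + v) + gauss_potential (z - v) - 2 * gauss_potential z =
  W (z + v) + W (z - v) - 2 * W z + c * dotp v v.
Proof.
have E : dotp (z + v) (z + v) + dotp (z - v) (z - v) - 2 * dotp z z = 2 * dotp v v.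
  rewrite /dotp !mulr_sumr -big_split/= -sumrB; apply: eq_bigr => i _.
  by rewrite !mxE; ring.
have -> : dotp v v = (dotp (z + v) (z + v) + dotp (z - v) (z - v) - 2 * dotp z z) / 2.
  by rewrite E mulrC mulKf.
by rewrite /gauss_potential; field.
Qed.

(** Half of [bl_qform z], enlarged to absorb the Taylor errors; the enlargement disappears as [de]
    tends to 0. *)
Definition bl_exponent (de : R) (z : 'rV[R]_d) : R := bl_qform z / (2 * (1 - de)) + de.

(** The threshold [e0] has to serve all [x] and [y]. Compactness of [K] gives one radius [r] for
    Taylor's formula around every midpoint; pairs farther apart are handled by the quadratic term of
    the potential. *)
Lemma exponent_le (de : R) : 0 < de < 1 -> exists2 e0, 0 < e0 & forall e x y,
  0 < e < e0 -> K x -> K y ->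
  e * (h x - h y) - (gauss_potential x + gauss_potential y) +
    2 * gauss_potential (2^-1 *: (x + y)) <=
  2 * e ^+ 2 * bl_exponent de (2^-1 *: (x + y)).
Proof.
move=> /andP[de0 de1].
(* By Cauchy-Schwarz [eta * S ^+ 2] is then at most half of [de * c * dotp v v]. The summand 1 keeps
   the denominator positive for [d = 0]. *)
pose eta := Num.min de (de * c / (2 * (d%:R + 1))).
have d0 : 0 <= d%:R :> R by exact: ler0n.
have d1 : 0 < d%:R + 1 :> R by rewrite ltr_wpDl.
have eta0 : 0 < eta by rewrite lt_min de0 divr_gt0// mulr_gt0.
have etade : eta <= de by rewrite ge_min lexx.
have etad : 2 * eta * d%:R <= de * c.
  have : eta <= de * c / (2 * (d%:R + 1)) by rewrite ge_min lexx orbT.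
  rewrite ler_pdivlMr ?mulr_gt0// => h1.
  have : 0 <= eta by exact: ltW.
  by move: (d%:R) d0 h1 => D ? ?; lra.
have [rW rW0 HW] := hess_uniform _ _ _ _ _ _ oU cK KU C2W eta0.
have [rh rh0 Hh] := grad_uniform eta eta0.
pose r := Num.min r1 (Num.min rW rh).
have r0 : 0 < r by rewrite !lt_min r10 rW0.
have rr1 : r <= r1 by rewrite ge_min lexx.
have rrW : r <= rW by rewrite !ge_min lexx orbT.
have rrh : r <= rh by rewrite !ge_min lexx !orbT.
have [M0 HM] := cont_on_bounded _ _ _ _ cK (cont_onS _ _ _ _ _ KU ch).
pose M := `|M0|.
have {}HM x : K x -> `|h x| <= M by move=> Kx; apply: le_trans (HM x Kx) _; exact: ler_norm.
have M_ge0 : 0 <= M by exact: normr_ge0.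
have cr : 0 < c * r ^+ 2 by rewrite mulr_gt0// exprn_gt0.
have M1 : 0 < 2 * M + 1 by rewrite ltr_wpDl// mulr_ge0.
exists (c * r ^+ 2 / (2 * M + 1)); first exact: divr_gt0.
move=> e x y /andP[e0 ee0] Kx Ky; set z := 2^-1 *: (x + y).
have Kz : K z by exact: midK.
pose v : 'rV[R]_d := 2^-1 *: (x - y).
have half2 : 2^-1 + 2^-1 = 1 :> R by lra.
have xE : x = z + v.
  by rewrite /z /v -scalerDr addrACA subrr addr0 scalerDr -scalerDl half2 scale1r.
have yE : y = z - v.
  by rewrite /z /v -scalerBr opprD addrACA subrr add0r opprK scalerDr -scalerDl half2 scale1r.
move: v xE yE => v xE yE.
have -> : e * (h x - h y) - (gauss_potential x + gauss_potential y) + 2 * gauss_potential z =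
    e * (h (z + v) - h (z - v)) - (W (z + v) + W (z - v) - 2 * W z + c * dotp v v).
  by rewrite -gauss_potential_second_difference -xE -yE; ring.
have [zv|nzv] := pselect (ball z r (z + v)).
  apply: (exponent_le_local de eta e r) => //.
  - by rewrite de0.
  - by rewrite ltW.
  - exact: KU.
  - by apply: subset_trans (ballK z Kz); exact: le_ball.
  - by move=> y0 i zy0; apply: Hh Kz _; exact: le_ball zy0.
  - by move=> y0 i j zy0; apply: HW Kz _; exact: le_ball zy0.
(* Far pairs: the left-hand side is at most 0, since [e * (2 * M) <= c * r ^+ 2 <= c * dotp v v] by
   the choice of the threshold. *)
have Nr : r ^+ 2 <= dotp v v.
  apply: contrapT => /negP; rewrite -ltNge => Nr; apply: nzv.
  apply/(ball_rVP _ _ _ _ _ r0) => i; rewrite !mxE opprD addrA subrr sub0r normrN.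
  rewrite -(@ltr_pXn2r _ 2)// ?nnegrE// ?ltW// real_normK ?num_real//.
  apply: le_lt_trans Nr; rewrite /dotp (bigD1 i)//= -expr2 lerDl.
  by apply: sumr_ge0 => j _; rewrite -expr2 sqr_ge0.
have T0 : 0 <= bl_exponent de z.
  have de1' : 0 < 2 * (1 - de) by rewrite mulr_gt0// subr_gt0.
  rewrite /bl_exponent addr_ge0//; last exact: ltW.
  by rewrite divr_ge0//; [exact/bl_qform_ge0/KU|exact: ltW].
apply: (@le_trans _ _ 0); last by rewrite mulr_ge0// mulr_ge0// sqr_ge0.
have Wc : 0 <= W (z + v) + W (z - v) - 2 * W z.
  by rewrite -xE -yE subr_ge0; apply: midW; exact: KU.
have hh : h (z + v) - h (z - v) <= 2 * M.
  have := HM x Kx; have := HM y Ky; rewrite -xE -yE.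
  by rewrite !ler_norml => /andP[? ?] /andP[? ?]; lra.
have ehh : e * (h (z + v) - h (z - v)) <= e * (2 * M) by rewrite ler_wpM2l// ltW.
have eM : e * (2 * M) <= c * r ^+ 2.
  have : e * (2 * M + 1) <= c * r ^+ 2 by rewrite -ler_pdivlMr// ltW.
  lra.
have cN : c * r ^+ 2 <= c * dotp v v by rewrite ler_wpM2l// ltW.
have key (A B C D E : R) : A <= B -> B <= C -> C <= D -> 0 <= E -> A - (E + D) <= 0.
  by move=> *; lra.
exact: key ehh eM cN Wc.
Qed.

End brascamp_lieb.

(** * Second-order expansion of Prekopa-Leindler *)

Section variance_of_prekopa_leindler.
Context (R : realType).

(** Both sides of the hypothesis are [a ^+ 2] at [e = 0] and have no linear term; the conclusion
    compares the coefficients of [e ^+ 2]. *)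
Lemma variance_limit (a b s t D E e1 : R) : 0 <= a -> 0 <= t -> 0 <= D -> 0 <= E ->
  0 < e1 -> (forall e, 0 < e < e1 ->
    (a + e ^+ 2 * s / 2 - e ^+ 3 * D) ^+ 2 - e ^+ 2 * b ^+ 2 <=
    (a + e ^+ 2 * t + e ^+ 4 * E) ^+ 2) ->
  a * s - b ^+ 2 <= 2 * a * t.
Proof.
move=> a0 t0 D0 E0 e10 H.
have e1_gt0 : 0 < Num.min 1 e1 by rewrite lt_min ltr01.
apply: (@ler_of_linear_error R _ _ (2 * a * D + 2 * a * E + (t + E) ^+ 2) _ e1_gt0).
move=> e /andP[e0]; rewrite lt_min => /andP[e_lt1 ee1].
have e2 : 0 < e ^+ 2 by rewrite exprn_gt0.
rewrite -(ler_pM2l e2).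
have := H e; rewrite e0 ee1 => /(_ isT) {}H.
have sq : 0 <= (e ^+ 2 * s / 2 - e ^+ 3 * D) ^+ 2 by exact: sqr_ge0.
have [e0' e1'] := (ltW e0, ltW e_lt1).
have h1 : e ^+ 4 * (a * E) <= e ^+ 3 * (a * E).
  by rewrite ler_wpM2r ?mulr_ge0// ler_wiXn2l.
have h2 : (e ^+ 2 * t + e ^+ 4 * E) ^+ 2 <= e ^+ 3 * (t + E) ^+ 2.
  have le2 : e ^+ 2 * t + e ^+ 4 * E <= e ^+ 2 * (t + E).
    by rewrite mulrDr lerD2l ler_wpM2r// ler_wiXn2l.
  apply: (@le_trans _ _ ((e ^+ 2 * (t + E)) ^+ 2)).
    by rewrite lerXn2r// nnegrE ?addr_ge0// mulr_ge0 ?exprn_ge0// addr_ge0.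
  by rewrite exprMn ler_wpM2r ?sqr_ge0// -exprM ler_wiXn2l.
lra.
Qed.

Context (d : nat).
Local Notation lam := (lebesgue_rV R d).
Variables (K : set 'rV[R]_d) (h V Q : 'rV[R]_d -> R).
Hypothesis mK : measurable K.
Hypothesis cK : compact K.
Hypothesis Koo : (lam K < +oo)%E.
Hypothesis midK : forall x y, K x -> K y -> K (2^-1 *: (x + y)).
Hypothesis ch : cont_on R d K h.
Hypothesis cV : cont_on R d K V.
Hypothesis cQ : cont_on R d K Q.
Hypothesis Q0 : forall x, K x -> 0 <= Q x.

(** Convertible to [bl_exponent] when [Q] is [bl_qform], so that [exponent_le] fits the next
    hypothesis. *)
Let T (de : R) (x : 'rV[R]_d) := Q x / (2 * (1 - de)) + de.

Hypothesis exponent : forall de, 0 < de < 1 -> exists2 e0, 0 < e0 & forall e x y,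
  0 < e < e0 -> K x -> K y ->
  e * (h x - h y) - (V x + V y) + 2 * V (2^-1 *: (x + y)) <=
  2 * e ^+ 2 * T de (2^-1 *: (x + y)).

Let int (F : 'rV[R]_d -> R) : R := (\int[lam]_(x in K) F x)%R.
Let intble F := lam.-integrable K (EFin \o F).

Let p (x : 'rV[R]_d) := expR (- V x).

Let contC (k : R) : cont_on R d K (fun=> k).
Proof. exact: cont_on_cst. Qed.

Let contI F : cont_on R d K F -> intble F.
Proof. exact: cont_on_integrable. Qed.

Let cp : cont_on R d K p.
Proof. by apply: cont_on_expR; exact: cont_onN. Qed.

Let int3 (a b e : R) F G H : cont_on R d K F -> cont_on R d K G -> cont_on R d K H ->
  int (fun x => a * F x + b * G x + e * H x) = a * int F + b * int G + e * int H.
Proof. exact: Rintegral_linear3. Qed.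

Let int_le F G : intble F -> intble G -> (forall x, K x -> F x <= G x) -> int F <= int G.
Proof. by move=> iF iG FG; apply: le_Rintegral. Qed.

(** All three integrands are extended by zero. If [x] or [y] is outside [K] the product vanishes;
    otherwise the midpoint is in [K] and the exponents are compared. *)
Let int_PL (e de : R) : (forall x y, K x -> K y ->
    e * (h x - h y) - (V x + V y) + 2 * V (2^-1 *: (x + y)) <=
    2 * e ^+ 2 * T de (2^-1 *: (x + y))) ->
  int (fun x => expR (e * h x) * p x) * int (fun x => expR (- e * h x) * p x) <=
  int (fun x => expR (e ^+ 2 * T de x) * p x) ^+ 2.
Proof.
move=> ex.
have cT : cont_on R d K (T de) by apply: cont_onD => //; apply: cont_onM.
have c1 : cont_on R d K (fun x => expR (e * h x) * p x).
  by apply: cont_onM => //; apply: cont_on_expR; apply: cont_onM.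
have c2 : cont_on R d K (fun x => expR (- e * h x) * p x).
  by apply: cont_onM => //; apply: cont_on_expR; apply: cont_onM.
have c3 : cont_on R d K (fun x => expR (e ^+ 2 * T de x) * p x).
  by apply: cont_onM => //; apply: cont_on_expR; apply: cont_onM.
have fin F : cont_on R d K F -> (int F)%:E = (\int[lam]_(x in K) (F x)%:E)%E.
  by move=> /contI iF; rewrite /int /Rintegral fineK// (integrable_fin_num mK iF).
have mF F : cont_on R d K F -> measurable_fun setT ((fun x => (F x)%:E) \_ K)%E.
  move=> /contI /integrableP[mF _]; exact: (measurable_restrictT (EFin \o F) mK).1 mF.
have F0 F : (forall x, 0 <= F x) -> forall x, (0 <= ((fun x => (F x)%:E) \_ K) x)%E.
  by move=> F0 x; rewrite patchE; case: ifP => _ //; rewrite lee_fin.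
rewrite -lee_fin expr2 !EFinM (fin _ c1) (fin _ c2) (fin _ c3).
rewrite 3!(integral_mkcond K).
apply: prekopa_leindler.
- exact: mF.
- exact: mF.
- exact: mF.
- by apply: F0 => x; rewrite mulr_ge0 ?expR_ge0.
- by apply: F0 => x; rewrite mulr_ge0 ?expR_ge0.
- by apply: F0 => x; rewrite mulr_ge0 ?expR_ge0.
have mm x : (0 <= ((fun x => (expR (e ^+ 2 * T de x) * p x)%:E) \_ K) x)%E.
  by apply: F0 => y; rewrite mulr_ge0 ?expR_ge0.
move=> x y; have := mm (2^-1 *: (x + y)); rewrite !patchE => m0.
have [Kx|Kx] := boolP (x \in K); last by rewrite mul0e mule_ge0.
have [Ky|Ky] := boolP (y \in K); last by rewrite mule0 mule_ge0.
rewrite !inE in Kx Ky; rewrite mem_set; last exact: midK.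
rewrite -!EFinM lee_fin /p -!expRD ler_expR.
have := ex x y Kx Ky; lra.
Qed.

(** Used for [e] and [- e], hence the absolute value in the bound for the cubic term. *)
Let int_exp_ge (e M : R) : 0 <= M -> (forall x, K x -> `|h x| <= M) ->
  int p * (1 - `|e| ^+ 3 * M ^+ 3) + e * int (fun x => h x * p x) +
    e ^+ 2 / 2 * int (fun x => h x ^+ 2 * p x) <= int (fun x => expR (e * h x) * p x).
Proof.
move=> M0 hM; have chp : cont_on R d K (fun x => h x * p x) by exact: cont_onM.
have ch2p : cont_on R d K (fun x => h x ^+ 2 * p x) by apply: cont_onM => //; exact: cont_onM.
have cZ k f : cont_on R d K f -> cont_on R d K (fun x => k * f x) by exact: cont_onM.
rewrite [int p * _]mulrC -int3//; apply: int_le.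
- by apply/contI/cont_onD/cZ => //; apply: cont_onD; exact: cZ.
- by apply/contI/cont_onM => //; apply/cont_on_expR/cZ.
move=> x Kx; have px : 0 <= p x by exact: expR_ge0.
have := expR_ge_cubic R (e * h x).
have h3 : - (`|e| ^+ 3 * M ^+ 3) <= (e * h x) ^+ 3.
  rewrite lerNl; apply: (le_trans (ler_norm _)); rewrite normrN normrX normrM exprMn.
  by rewrite ler_wpM2l ?exprn_ge0// lerXn2r ?nnegrE//; exact: hM.
have e3M : 0 <= `|e| ^+ 3 * M ^+ 3 by rewrite mulr_ge0 ?exprn_ge0.
move=> h4.
have {h3 h4} h5 : 1 - `|e| ^+ 3 * M ^+ 3 + e * h x + e ^+ 2 / 2 * h x ^+ 2 <= expR (e * h x).
  by apply: le_trans h4; move: h3; rewrite exprMn; lra.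
by have := ler_wpM2r px h5; rewrite !mulrDl !mulrA.
Qed.

(** The bound [B] keeps the argument of [expR] in the range of [expR_le_quadratic]. *)
Let int_exp_le (e de B : R) : 0 <= B -> (forall x, K x -> 0 <= T de x <= B) ->
  e ^+ 2 * B <= 2^-1 ->
  int (fun x => expR (e ^+ 2 * T de x) * p x) <=
  int p * (1 + 2 * e ^+ 4 * B ^+ 2) +
    e ^+ 2 * (int (fun x => Q x * p x) / (2 * (1 - de)) + de * int p).
Proof.
move=> B0 TB eB.
have cT : cont_on R d K (T de) by apply: cont_onD => //; apply: cont_onM.
have cQp : cont_on R d K (fun x => Q x * p x) by exact: cont_onM.
have cZ k f : cont_on R d K f -> cont_on R d K (fun x => k * f x) by exact: cont_onM.
have -> : int p * (1 + 2 * e ^+ 4 * B ^+ 2) +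
    e ^+ 2 * (int (fun x => Q x * p x) / (2 * (1 - de)) + de * int p) =
    (1 + 2 * e ^+ 4 * B ^+ 2) * int p + (e ^+ 2 / (2 * (1 - de))) * int (fun x => Q x * p x) +
    (e ^+ 2 * de) * int p by ring.
rewrite -int3//; apply: int_le.
- by apply/contI/cont_onM => //; apply/cont_on_expR/cZ.
- by apply/contI/cont_onD/cZ => //; apply: cont_onD; exact: cZ.
move=> x Kx; have px : 0 <= p x by exact: expR_ge0.
have /andP[T0 TB'] := TB x Kx.
have e2 : 0 <= e ^+ 2 by exact: sqr_ge0.
have eT : e ^+ 2 * T de x <= e ^+ 2 * B by rewrite ler_wpM2l.
have y01 : 0 <= e ^+ 2 * T de x <= 2^-1.
  by rewrite mulr_ge0//=; apply: le_trans eB.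
have h1 := expR_le_quadratic R _ y01.
have h2 : (e ^+ 2 * T de x) ^+ 2 <= e ^+ 4 * B ^+ 2.
  rewrite (exprM e 2 2) -exprMn lerXn2r// nnegrE mulr_ge0//.
have h3 : expR (e ^+ 2 * T de x) <=
    1 + 2 * e ^+ 4 * B ^+ 2 + e ^+ 2 / (2 * (1 - de)) * Q x + e ^+ 2 * de.
  apply: (le_trans h1).
  have -> : e ^+ 2 * T de x = e ^+ 2 / (2 * (1 - de)) * Q x + e ^+ 2 * de by rewrite /T; ring.
  by move: h2; rewrite /T; lra.
by have := ler_wpM2r px h3; rewrite !mulrDl !mulrA.
Qed.

(** Multiplying through by the square of the mass avoids normalizing [p]. The lower bounds for [e]
    and [- e] have a difference of squares as their product, so the terms linear in [e] cancel. *)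
Theorem variance_le_of_exponent :
  int p * int (fun x => h x ^+ 2 * p x) - int (fun x => h x * p x) ^+ 2 <=
  int p * int (fun x => Q x * p x).
Proof.
have [M0 HM] := cont_on_bounded _ _ _ _ cK ch.
pose M := `|M0|.
have {}HM x : K x -> `|h x| <= M by move=> Kx; apply: le_trans (HM x Kx) _; exact: ler_norm.
have M_ge0 : 0 <= M by exact: normr_ge0.
move: M M_ge0 HM => M M_ge0 HM.
have [B0 HB] := cont_on_bounded _ _ _ _ cK cQ.
have p0 x : 0 <= p x by exact: expR_ge0.
have a0 : 0 <= int p by apply: Rintegral_ge0 => x _.
have q0 : 0 <= int (fun x => Q x * p x).
  by apply: Rintegral_ge0 => x Kx; rewrite mulr_ge0//; exact: Q0.
have bM : `|int (fun x => h x * p x)| <= M * int p.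
  have -> : M * int p = M * int p + 0 * int p + 0 * int p by ring.
  rewrite -int3//; apply: (le_trans (le_normr_Rintegral _ _)) => //.
    by apply/contI/cont_onM.
  apply: le_Rintegral => //.
  - by apply: integrable_norm; exact/contI/cont_onM.
  - by apply: contI; apply: cont_onD; [apply: cont_onD|]; exact: cont_onM.
  - by move=> x Kx; rewrite /= normrM (ger0_norm (p0 x)) !mul0r !addr0 ler_wpM2r//; exact: HM.
have [a_eq0|a_neq0] := eqVneq (int p) 0.
  by rewrite a_eq0 !mul0r sub0r oppr_le0 sqr_ge0.
have a_gt0 : 0 < int p by rewrite lt_neqAle eq_sym a_neq0.
set s := int (fun x => h x ^+ 2 * p x); set b := int (fun x => h x * p x).
set q := int (fun x => Q x * p x); set a := int p.
have s0 : 0 <= s by apply: Rintegral_ge0 => x _; rewrite mulr_ge0// sqr_ge0.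
have key de : 0 < de < 1 -> a * s - b ^+ 2 <= 2 * a * (q / (2 * (1 - de)) + de * a).
  move=> de01; have [e0 e00 He] := exponent de de01.
  have /andP[de0 de1] := de01.
  have de1' : 0 < 2 * (1 - de) by rewrite mulr_gt0// subr_gt0.
  pose B := `|B0| / (2 * (1 - de)) + 1.
  have B_ge0 : 0 <= B by rewrite addr_ge0// divr_ge0// ltW.
  have TB x : K x -> 0 <= T de x <= B.
    move=> Kx; rewrite /T; apply/andP; split.
      by rewrite addr_ge0//; [rewrite divr_ge0 ?Q0// ltW|exact: ltW].
    rewrite /B; apply: lerD; last exact: ltW.
    apply: ler_wpM2r; first by rewrite invr_ge0 ltW.
    apply: (le_trans (ler_norm _)).
    exact: le_trans (HB x Kx) (ler_norm _).
  pose D := M ^+ 3 * a; pose E := 2 * B ^+ 2 * a.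
  have D0 : 0 <= D by rewrite mulr_ge0 ?exprn_ge0.
  have E0 : 0 <= E by rewrite !mulr_ge0 ?exprn_ge0.
  have t0 : 0 <= q / (2 * (1 - de)) + de * a.
    by rewrite addr_ge0 ?mulr_ge0 ?invr_ge0// ltW.
  (* The bounds serve, in this order, the exponent hypothesis, the comparison of powers of [e],
     [e ^+ 2 * B <= 2^-1], and the nonnegativity of the lower bounds [X1] and [X2], without which
     they could not be multiplied. *)
  pose e1 := Num.min e0 (Num.min 1 (Num.min (2^-1 / (B + 1)) (a / (`|b| + D + 1)))).
  have bD1 : 0 < `|b| + D + 1 by rewrite ltr_wpDl// addr_ge0.
  have B1 : 0 < B + 1 by rewrite ltr_wpDl.
  have e10 : 0 < e1 by rewrite !lt_min e00 ltr01 !divr_gt0.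
  apply: (variance_limit a b s _ D E e1) => // e /andP[e_gt0].
  rewrite !lt_min => /and4P[ee0 e_lt1 eB ea].
  have eB' : e ^+ 2 * B <= 2^-1.
    move: eB; rewrite ltr_pdivlMr// => eB.
    apply: (@le_trans _ _ (e * B)); last by lra.
    by rewrite ler_wpM2r// expr2 ler_piMl// ltW.
  have ea' : e * (`|b| + D) <= a.
    by move: ea; rewrite ltr_pdivlMr// => ea; lra.
  have PL := int_PL e de (fun x y => He e x y (introT andP (conj e_gt0 ee0))).
  have L1 := int_exp_ge e M M_ge0 HM.
  have L2 := int_exp_ge (- e) M M_ge0 HM.
  have U1 := int_exp_le e de B B_ge0 TB eB'.
  rewrite normrN sqrrN in L2; rewrite (ger0_norm (ltW e_gt0)) in L1 L2.
  rewrite -/a -/b -/s -/q in L1 L2 U1.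
  have e3 : e ^+ 3 * D <= e * D by rewrite ler_wpM2r// exprS ler_piMr ?ltW// exprn_ilt1// ltW.
  have be : `|e * b| <= e * `|b| by rewrite normrM gtr0_norm.
  have es : 0 <= e ^+ 2 * s by rewrite mulr_ge0// sqr_ge0.
  pose X1 := a * (1 - e ^+ 3 * M ^+ 3) + e * b + e ^+ 2 / 2 * s.
  pose X2 := a * (1 - e ^+ 3 * M ^+ 3) + - e * b + e ^+ 2 / 2 * s.
  have X10 : 0 <= X1.
    move: be ea' e3; rewrite /X1 /D ler_norml => /andP[? ?]; lra.
  have X20 : 0 <= X2.
    move: be ea' e3; rewrite /X2 /D ler_norml => /andP[? ?]; lra.
  have := ler_pM X10 X20 L1 L2 => /le_trans /(_ PL) => h1.
  have h2 := le_trans h1 (lerXn2r 2 _ _ U1).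
  have -> : (a + e ^+ 2 * s / 2 - e ^+ 3 * D) ^+ 2 - e ^+ 2 * b ^+ 2 = X1 * X2.
    by rewrite /X1 /X2 /D; ring.
  have -> : a + e ^+ 2 * (q / (2 * (1 - de)) + de * a) + e ^+ 4 * E =
      a * (1 + 2 * e ^+ 4 * B ^+ 2) + e ^+ 2 * (q / (2 * (1 - de)) + de * a).
    by rewrite /E; ring.
  apply: h2; rewrite nnegrE; first by apply: Rintegral_ge0 => x _; rewrite mulr_ge0// expR_ge0.
  rewrite addr_ge0// mulr_ge0//; last by rewrite sqr_ge0.
  by rewrite addr_ge0// !mulr_ge0 ?exprn_ge0// ltW.
have half0 : 0 < 2^-1 :> R by [].
(* Now [de] tends to 0: below 1/2, [1 / (1 - de)] is at most [1 + 2 * de], so the error is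
   linear. *)
apply: (@ler_of_linear_error R _ _ (2 * a * q + 2 * a ^+ 2) _ half0) => de /andP[de0 de1].
have de1' : 0 < 1 - de by lra.
have := key de; rewrite de0 (lt_trans de1) /=; last by lra.
move=> /(_ isT) /le_trans; apply.
have qde : q / (1 - de) <= q * (1 + 2 * de).
  rewrite ler_wpM2l// -div1r ler_pdivrMr//.
  have : 0 <= de * (1 - 2 * de) by rewrite mulr_ge0 ?ltW//; lra.
  by lra.
have -> : 2 * a * (q / (2 * (1 - de)) + de * a) = a * (q / (1 - de)) + 2 * de * a ^+ 2.
  by field; rewrite gt_eqF.
have : a * (q / (1 - de)) <= a * (q * (1 + 2 * de)) by rewrite ler_wpM2l.
lra.
Qed.

End variance_of_prekopa_leindler.

Lemma continuous_at_near_eq (R : realType) (T : topologicalType) (f g : T -> R) (x : T) :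
  (\forall y \near x, f y = g y) -> {for x, continuous f} -> {for x, continuous g}.
Proof.
move=> fg; rewrite /prop_for /continuous_at -(nbhs_singleton fg) => cf.
by apply: cvg_trans cf; exact: near_eq_cvg.
Qed.

(** * Regularity in the interior of the support *)

Section regularity.
Context (R : realType) (d : nat).
Implicit Types (f g p : 'rV[R]_d -> R) (D U : set 'rV[R]_d) (x v : 'rV[R]_d).
Local Notation e_ i := (delta_mx ord0 i : 'rV[R]_d).

Lemma cont_on_interior D g : {within D, continuous g} -> cont_on R d D° g.
Proof.
by move=> gc x Dx; move: (gc x); rewrite /continuous_at -(nbhs_subspace_interior Dx).
Qed.

Lemma cont_on_congr U f g : open U -> (forall x, U x -> f x = g x) ->
  cont_on R d U f -> cont_on R d U g.
Proof.
move=> oU fg cf x Ux; have fgx : \forall y \near x, f y = g y.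
  by apply: filterS (nbhs_open _ _ _ _ oU Ux) => y; exact: fg.
exact: continuous_at_near_eq fgx (cf x Ux).
Qed.

Lemma C1_on_congr U f g : open U -> (forall x, U x -> f x = g x) ->
  C1_on R d U f -> C1_on R d U g.
Proof.
move=> oU fg [df cf]; have fgx x : U x -> \forall y \near x, f y = g y.
  by move=> Ux; apply: filterS (nbhs_open _ _ _ _ oU Ux) => y; exact: fg.
split=> [i x Ux|i].
  by apply: near_eq_derivable (df i x Ux); exact: fgx.
apply: cont_on_congr (cf i) => // x Ux.
by apply: near_eq_derive; exact: fgx.
Qed.

Lemma C1_onM U f g : open U -> cont_on R d U f -> cont_on R d U g ->
  C1_on R d U f -> C1_on R d U g -> C1_on R d U (fun x => f x * g x).
Proof.
move=> oU cf cg [df cdf] [dg cdg]; split=> [i x Ux|i].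
  by apply: derivableM; [exact: df|exact: dg].
apply: (@cont_on_congr U (fun x => f x * partial i g x + g x * partial i f x)) => //.
  move=> x Ux; rewrite /partial deriveM//; [exact: df|exact: dg].
move=> x Ux; apply: continuousD; apply: continuousM;
  [exact: cf|exact: cdg|exact: cg|exact: cdf].
Qed.

Lemma C1_onN U f : open U -> C1_on R d U f -> C1_on R d U (fun x => - f x).
Proof.
move=> oU [df cf]; split=> [i x Ux|i]; first by apply: derivableN; exact: df.
apply: (@cont_on_congr U (fun x => - partial i f x)) => //.
  by move=> x Ux; rewrite /partial deriveN//; exact: df.
by move=> x Ux; apply: continuousN; exact: cf.
Qed.

Lemma C1_onV U f : open U -> (forall x, U x -> f x != 0) -> cont_on R d U f ->
  C1_on R d U f -> C1_on R d U (fun x => (f x)^-1).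
Proof.
move=> oU f0 cf [df cdf]; split=> [i x Ux|i].
  by apply: derivableV; [exact: f0|exact: df].
apply: (@cont_on_congr U (fun x => - (f x ^- 2 * partial i f x))) => //.
  by move=> x Ux; rewrite /partial deriveV//; [rewrite scaleNr|exact: f0|exact: df].
move=> x Ux; apply: continuousN; apply: continuousM; last exact: cdf.
apply: continuousV; first by rewrite expf_neq0// f0.
by apply: continuousM; exact: cf.
Qed.

(** The one-variable chain rule is applied on the line through [x] in direction [v]. *)
Lemma is_derive_neg_ln p x v : 0 < p x -> derivable p x v ->
  is_derive x v (fun y => - ln (p y)) (- ((p x)^-1 * 'D_v p x)).
Proof.
move=> p0 dp; pose W y := - ln (p y).
have dp0 : derivable p (x + 0 *: v) v by rewrite scale0r addr0.
have lp := is_derive_line R _ p x v 0 dp0.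
have p00 : 0 < p (x + 0 *: v) by rewrite scale0r addr0.
have lW : is_derive (0 : R) 1 (fun s : R => W (x + s *: v)) (- ((p x)^-1 * 'D_v p x)).
  apply: is_deriveN.
  have dln := is_derive1_ln p00.
  have := @is_derive1_comp R (@ln R) (fun s : R => p (x + s *: v)) 0 _ _ dln lp.
  by rewrite scale0r addr0.
have dW : derivable W x v.
  apply/derivable1P; rewrite (_ : (fun h : R => _) = (fun s : R => W (x + s *: v))).
    by have [] := lW.
  by apply/funext => s; rewrite addrC.
have dW0 : derivable W (x + 0 *: v) v by rewrite scale0r addr0.
have [_ E1] := is_derive_line R _ W x v 0 dW0.
have [_ E2] := lW.
rewrite -E2 E1 scale0r addr0; exact: derivableP.
Qed.

(** Smoothness is assumed of the density; this transfers it to the potential [W]. *)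
Lemma C2_on_neg_ln U p : open U -> (forall x, 0 < p x) -> cont_on R d U p ->
  C2_on R d U p -> C2_on R d U (fun x => - ln (p x)).
Proof.
move=> oU p0 cp [C1p C2p]; set W := fun x => _.
have dW i x : U x -> is_derive x (e_ i) W (- ((p x)^-1 * partial i p x)).
  by move=> Ux; apply: is_derive_neg_ln => //; exact: C1p.1.
have dWE i x : U x -> - ((p x)^-1 * partial i p x) = partial i W x.
  by move=> Ux; have [_ <-] := dW i x Ux.
have p_neq0 x : U x -> p x != 0 by rewrite gt_eqF.
have cVp : cont_on R d U (fun x => (p x)^-1).
  by move=> x Ux; apply: continuousV; [exact: p_neq0|exact: cp].
have cdp i : cont_on R d U (partial i p) by exact: C1p.2.
split=> [|j].
  split=> [i x Ux|i]; first by have [] := dW i x Ux.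
  apply: (cont_on_congr U _ _ oU (dWE i)) => x Ux.
  by apply: continuousN; apply: continuousM; [exact: cVp|exact: cdp].
apply: (C1_on_congr U _ _ oU (dWE j)); apply: C1_onN => //.
by apply: C1_onM => //; exact: C1_onV.
Qed.

Lemma Ck_on1_interior D f : Ck_on 1 D f -> cont_on R d D° f /\ C1_on R d D° f.
Proof.
move=> [cf fk]; split; first exact: cont_on_interior.
split=> [i x Dx|i]; first exact: (fk [::] i isT).1.
have [g gc gE] := (fk [::] i isT).2.
by apply: (@cont_on_congr D° g) => //; [exact: open_interior|exact: cont_on_interior].
Qed.

Lemma smooth_on_interior D f : smooth_on D f -> cont_on R d D° f /\ C2_on R d D° f.
Proof.
move=> sf; have [cf C1f] := Ck_on1_interior D f (sf 1%N).
split=> //; split=> // i; have [_ fk] := sf 2%N.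
split=> [j x Dx|j]; first exact: (fk [:: i] j isT).1.
have [g gc gE] := (fk [:: i] j isT).2.
by apply: (@cont_on_congr D° g) => //; [exact: open_interior|exact: cont_on_interior].
Qed.

(** A variant of [ipartial_onE] for [W], whose regularity is established in the interior only. *)
Lemma ipartial_on_interior D f (s : seq 'I_d) x : cont_on R d D° (ipartial s f) ->
  D° x -> ipartial_on D s f x = ipartial s f x.
Proof.
move=> cf Dx; have Dnx : nbhs x D° by apply: nbhs_open => //; exact: open_interior.
by rewrite /ipartial_on within_interior//; apply: cvg_lim => //; exact: cf.
Qed.

Lemma grad_on_interior D f x : C1_on R d D° f -> D° x -> grad_on D f x = grad R d f x.
Proof.
move=> [_ cf] Dx; apply/rowP => i; rewrite !mxE.
by apply: ipartial_on_interior => //; exact: cf.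
Qed.

Lemma hess_on_interior D f x : C2_on R d D° f -> D° x -> hess_on D f x = hess R d f x.
Proof.
move=> [_ C2] Dx; apply/matrixP => i j; rewrite !mxE.
by apply: ipartial_on_interior => //; exact: (C2 j).2.
Qed.

End regularity.

(** * Integration against a density *)

Section integration.
Local Open Scope ereal_scope.
Context d (T : measurableType d) (R : realType).
Import HBNNSimple.

(* Nothing is asked of [f] on [N], where it will be made of boundary values of
   derivatives, defined by [lim]. *)
Lemma le_integral_off_null (mu : {measure set T -> \bar R}) (D N K : set T)
    (f : T -> \bar R) : measurable N -> mu N = 0 -> K `<=` D `\` N ->
  (forall x, (D `\` N) x -> 0 <= f x) ->
  \int[mu]_(x in K) f x <= \int[mu]_(x in D) f x.
Proof.
move=> mN N0 KDN f0.
rewrite [leRHS]integralE.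
have -> : \int[mu]_(x in D) f^\- x = 0.
  apply/eqP; rewrite eq_le integral_ge0// andbT.
  rewrite integral_mkcond ge0_integralTE; last first.
    by move=> x; apply: erestrict_ge0.
  apply: ge_ereal_sup => _ [g /= gf <-].
  rewrite -integralT_nnsfun (_ : (fun x => (g x)%:E) = (EFin \o g) \_ N).
    by rewrite -integral_mkcond null_set_integral//; exact/measurable_EFinP/measurable_funTS.
  apply/funext => x; rewrite patchE; case: ifPn => //; rewrite notin_setE => Nx.
  apply/eqP; rewrite eq_le; apply/andP; split; last by rewrite lee_fin.
  apply: (le_trans (gf x)).
  rewrite patchE; case: ifPn => //; rewrite inE => Dx.
  by rewrite funenegE ge_max lexx andbT leeNl oppe0 f0.
rewrite sube0 integral_mkcond [leRHS]integral_mkcond.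
have fK x : 0 <= (f \_ K) x.
  by apply: erestrict_ge0 => y /KDN; exact: f0.
have fD x : 0 <= (f^\+ \_ D) x by apply: erestrict_ge0.
rewrite ge0_integralTE// ge0_integralTE//.
apply: le_ereal_sup => _ [g /= gf <-]; exists g => //= x.
apply: (le_trans (gf x)); rewrite !patchE; case: ifPn => [|_].
  rewrite inE => /KDN[Dx Nx]; rewrite mem_set//.
  by rewrite funeposE le_max lexx.
by have := fD x; rewrite patchE.
Qed.

(** For indicators this is the hypothesis on [nu]; simple functions and monotone convergence do the
    rest. *)
Lemma integral_density (mu nu : {measure set T -> \bar R}) (D K : set T)
    (rho F : T -> R) : measurable D -> measurable_fun D rho ->
  (forall x, 0 <= rho x)%R ->
  (forall A, measurable A -> nu A = \int[mu]_(x in A `&` D) (rho x)%:E) ->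
  measurable K -> K `<=` D -> measurable_fun K F -> (forall x, K x -> 0 <= F x)%R ->
  \int[nu]_(x in K) (F x)%:E = \int[mu]_(x in K) (F x * rho x)%:E.
Proof.
move=> mD mrho rho0 nuE mK KD mF F0.
have mrhoK : measurable_fun K rho by exact: measurable_funS mrho.
have mFE : measurable_fun K (EFin \o F) by exact/measurable_EFinP.
pose f_ := nnsfun_approx mK mFE.
have cf x : K x -> (f_ n x)%:E @[n --> \oo] --> (F x)%:E.
  by move=> Kx; apply: cvg_nnsfun_approx => // y Ky; rewrite /= lee_fin F0.
have mfr n : measurable_fun K (fun x => (f_ n x * rho x)%:E).
  by apply/measurable_EFinP; apply: measurable_funM => //; exact: measurable_funTS.
transitivity (limn (fun n => \int[nu]_(x in K) (f_ n x)%:E)).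
  rewrite -monotone_convergence//.
  - by apply: eq_integral => x /[!inE] Kx; apply/esym/cvg_lim => //; exact: cf.
  - by move=> n; exact/measurable_EFinP/measurable_funTS.
  - by move=> n x _; rewrite lee_fin.
  - by move=> x _ m n mn; rewrite lee_fin; exact/lefP/nd_nnsfun_approx.
transitivity (limn (fun n => \int[mu]_(x in K) (f_ n x * rho x)%:E)); last first.
  rewrite -monotone_convergence//.
  - apply: eq_integral => x /[!inE] Kx; apply/cvg_lim => //.
    rewrite [X in _ --> X]EFinM; under eq_fun do rewrite EFinM.
    by apply: cvgeZr => //; exact: cf.
  - by move=> n x _; rewrite lee_fin mulr_ge0.
  - move=> x _ m n mn; rewrite lee_fin ler_wpM2r//.
    by move: x; exact/lefP/nd_nnsfun_approx.
congr (limn _); apply/funext => n; move: (f_ n) => g {cf mfr f_}.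
transitivity (\sum_(k \in range g) \int[nu]_(x in K) (k * \1_(g @^-1` [set k]) x)%:E).
  under eq_integral do rewrite fimfunE -fsumEFin//.
  rewrite ge0_integral_fsum//.
  - by move=> y; exact/measurable_EFinP/measurable_funM.
  - by move=> y x _; rewrite nnfun_muleindic_ge0.
transitivity (\sum_(k \in range g)
    \int[mu]_(x in K) ((k * \1_(g @^-1` [set k]) x)%:E * (rho x)%:E)); last first.
  rewrite -ge0_integral_fsum//.
  - apply: eq_integral => x /[!inE] Kx.
    rewrite -ge0_mule_fsuml; last by move=> y; rewrite nnfun_muleindic_ge0.
    by rewrite EFinM fsumEFin// -fimfunE.
  - move=> y; apply: emeasurable_funM; last exact/measurable_EFinP.
    exact/measurable_EFinP/measurable_funM.
  - by move=> y x _; rewrite mule_ge0 ?lee_fin// -lee_fin nnfun_muleindic_ge0.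
apply: eq_fsbigr => k _; rewrite integralZl_indic_nnsfun//.
have mgk : measurable (g @^-1` [set k]) by exact: measurable_sfunP.
rewrite integral_indic// nuE; last exact: measurableI.
under [RHS]eq_integral do rewrite EFinM -muleA.
(* A negative [k] is not a value of the nonnegative [g], so its fiber is empty. *)
have [k0|k0] := ltP k 0%R.
  rewrite preimage_nnfun0// set0I set0I integral_set0 mule0 integral0_eq// => x _.
  by rewrite indic0 mul0e mule0.
rewrite ge0_integralZl//; last 2 first.
- apply: emeasurable_funM; last exact/measurable_EFinP.
  exact/measurable_EFinP.
- by move=> x _; rewrite mule_ge0// lee_fin.
congr (_ * _); rewrite -setIA (setIidl KD) setIC integral_mkcondr.
apply: eq_integral => x _; rewrite patchE indicE.
by case: ifPn => [|_]; rewrite ?mul1e ?mul0e.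
Qed.

End integration.

(** * Change of density, and the cores of a convex set *)

Section perturbation.
Context (R : realType) (d : nat).
Local Notation lam := (lebesgue_rV R d).
Implicit Types (U K D : set 'rV[R]_d).

(* The density [expR (- W)] is within a factor [expR (1/4) <= 2] of the strictly
   log-concave density [expR (- gauss_potential R d W c)]. *)
Lemma variance_le_perturbed U K (h W : 'rV[R]_d -> R) (c r1 : R) :
  open U -> K `<=` U -> measurable K -> compact K -> (0 < lam K < +oo)%E ->
  (forall x y, K x -> K y -> K (2^-1 *: (x + y))) ->
  0 < r1 -> (forall z, K z -> ball z r1 `<=` U) ->
  cont_on R d U h -> C1_on R d U h -> cont_on R d U W -> C2_on R d U W ->
  (forall x y, U x -> U y -> 2 * W (2^-1 *: (x + y)) <= W x + W y) ->
  0 < c -> (forall x, K x -> c / 2 * dotp x x <= 4^-1) ->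
  exists k : R, \int[lam]_(x in K) ((h x - k) ^+ 2 * expR (- W x)) <=
    2 * \int[lam]_(x in K) (bl_qform R d h W c x * expR (- W x)).
Proof.
move=> oU KU mK cK /andP[K0 Koo] midK r10 ballK ch C1h cW C2W midW c0 cr.
pose V := gauss_potential R d W c; pose Q := bl_qform R d h W c.
have [chK cWK] := (cont_onS _ _ _ _ _ KU ch, cont_onS _ _ _ _ _ KU cW).
have cQ : cont_on R d K Q by apply: cont_onS KU _; exact: cont_on_bl_qform.
have Q0 x : K x -> 0 <= Q x by move=> /KU Ux; apply: (bl_qform_ge0 _ _ U).
have cdot : cont_on R d K (fun x => c / 2 * dotp x x).
  apply: cont_onM; first exact: cont_on_cst.
  move=> x Kx; apply: continuous_at_sum => i.
  by apply: continuousM; exact: coord_continuous.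
have cV : cont_on R d K V by exact: cont_onD.
have cp : cont_on R d K (fun x => expR (- V x)) by apply: cont_on_expR; exact: cont_onN.
have cpW : cont_on R d K (fun x => expR (- W x)) by apply: cont_on_expR; exact: cont_onN.
have ch2 : cont_on R d K (fun x => h x ^+ 2) by exact: cont_onM.
have main := variance_le_of_exponent R d K h V Q mK cK Koo midK chK cV cQ Q0
  (exponent_le R d U K h W c oU KU cK midK r1 r10 ballK ch C1h C2W midW c0).
move: main; set a := \int[lam]_(x in K) expR (- V x).
set s := \int[lam]_(x in K) (h x ^+ 2 * _); set b := \int[lam]_(x in K) (h x * _).
set q := \int[lam]_(x in K) (Q x * _) => main.
have iK F : cont_on R d K F -> lam.-integrable K (EFin \o F) by exact: cont_on_integrable.
have a0 : 0 < a.
  have [M HM] := cont_on_bounded _ _ _ _ cK cp.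
  have [B HB] := cont_on_bounded _ _ _ _ cK cV.
  apply: (@lt_le_trans _ _ (expR (- B) * fine (lam K))).
    by rewrite mulr_gt0 ?expR_gt0// fine_gt0// K0.
  rewrite -Rintegral_cst//; apply: le_Rintegral => //.
  - exact/iK/cont_on_cst.
  - exact: iK.
  - move=> x Kx; rewrite ler_expR lerN2; exact: le_trans (ler_norm _) (HB x Kx).
pose k := b / a; exists k.
have e14 : 0 < expR (4^-1 : R) by exact: expR_gt0.
have chk : cont_on R d K (fun x => (h x - k) ^+ 2).
  by apply: cont_onM; apply: cont_onD => //; exact: cont_on_cst.
have pW x : K x -> expR (- W x) <= expR 4^-1 * expR (- V x).
  move=> Kx; rewrite -expRD ler_expR /V /gauss_potential.
  by have := cr x Kx; lra.
have pV x : expR (- V x) <= expR (- W x).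
  rewrite ler_expR lerN2 /V /gauss_potential lerDl.
  by rewrite mulr_ge0 ?dotp_ge0// divr_ge0// ltW.
have step1 : \int[lam]_(x in K) ((h x - k) ^+ 2 * expR (- W x)) <=
    expR 4^-1 * \int[lam]_(x in K) ((h x - k) ^+ 2 * expR (- V x)).
  rewrite -RintegralZl//; last exact/iK/cont_onM.
  apply: le_Rintegral => //.
  - exact/iK/cont_onM.
  - by apply/iK/cont_onM; [exact: cont_on_cst|exact: cont_onM].
  - by move=> x Kx; rewrite mulrCA ler_wpM2l ?sqr_ge0//; exact: pW.
have step2 : \int[lam]_(x in K) ((h x - k) ^+ 2 * expR (- V x)) <= q.
  have -> : \int[lam]_(x in K) ((h x - k) ^+ 2 * expR (- V x)) =
      1 * s + (- 2 * k) * b + k ^+ 2 * a.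
    rewrite -Rintegral_linear3//; try exact: cont_onM.
    by apply: eq_Rintegral => x _; ring.
  rewrite -(ler_pM2l a0); apply: le_trans main.
  have kE : k * a = b by rewrite /k divfK// gt_eqF.
  by rewrite -kE; lra.
have step3 : q <= \int[lam]_(x in K) (Q x * expR (- W x)).
  apply: le_Rintegral => //; try exact/iK/cont_onM.
  by move=> x Kx; rewrite ler_wpM2l// Q0.
have q0 : 0 <= q by apply: Rintegral_ge0 => x Kx; rewrite mulr_ge0 ?expR_ge0// Q0.
apply: (le_trans step1); apply: (@le_trans _ _ (expR 4^-1 * q)).
  by rewrite ler_wpM2l// ltW.
by apply: ler_pM => //; exact: expR_quarter_le2.
Qed.

(** The margin leaves room for Taylor's formula around each point of the core, and the open ball
    makes the core closed. *)
Definition core D (n : nat) : set 'rV[R]_d := [set x | ball x n.+1%:R^-1 `<=` D].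

Lemma core_ball_interior D n z : core D n z -> ball z n.+1%:R^-1 `<=` D°.
Proof.
move=> Dz y zy; have : nbhs y (ball z n.+1%:R^-1).
  by apply: nbhs_open zy; exact: ball_open.
by apply: filterS; exact: Dz.
Qed.

Lemma core_interior D n : core D n `<=` D°.
Proof. by move=> x Dx; apply: core_ball_interior Dx _ _; exact: ballxx. Qed.

Lemma core_nondecreasing D : nondecreasing_seq (core D).
Proof.
move=> m n mn; apply/subsetPset => x; apply: subset_trans.
by apply: le_ball; rewrite lef_pV2 ?posrE// ler_nat ltnS.
Qed.

Lemma bigcup_core D : \bigcup_n core D n = D°.
Proof.
apply/seteqP; split => [x [n _]|x /nbhs_ballP[e /= e0 xe]]; first exact: core_interior.
exists (Num.truncn e^-1) => //; apply: subset_trans xe; apply: le_ball.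
by rewrite invf_ple ?posrE// ltW// truncnS_gt.
Qed.

(** A point displaced from the midpoint by [w] is the midpoint of [x + w] and [y + w]. *)
Lemma core_midpoint D n x y : convex_set D -> core D n x -> core D n y ->
  core D n (2^-1 *: (x + y)).
Proof.
move=> cD Dx Dy z; have n0 : 0 < n.+1%:R^-1 :> R by [].
move=> /(ball_rVP _ _ _ _ _ n0) zxy; set w := z - 2^-1 *: (x + y).
have -> : z = 2^-1 *: ((x + w) + (y + w)).
  by apply/rowP => i; rewrite /w !mxE; lra.
apply: convex_set_midpoint => //; [apply: Dx|apply: Dy];
  apply/(ball_rVP _ _ _ _ _ n0) => i; rewrite !mxE opprD addrA subrr sub0r normrN;
  by have := zxy i; rewrite !mxE distrC.
Qed.

Lemma closed_core D n : closed (core D n).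
Proof.
move=> x clx y xy; have yx : ball y n.+1%:R^-1 x by exact: ball_sym.
have := clx _ (nbhs_open _ _ _ _ (ball_open _ _) yx).
by move=> [x' [Dx' yx']]; apply: Dx'; exact: ball_sym.
Qed.

Lemma core_compact D n (r : R) : (forall x i, D x -> `|x ord0 i| <= r) -> compact (core D n).
Proof.
move=> Dr.
have cbox : compact [set v : 'rV[R]_d | forall i, `[- r, r]%classic (v ord0 i)].
  by apply: (@rV_compact R^o d (fun=> `[- r, r]%classic)) => _; exact: segment_compact.
apply: subclosed_compact (closed_core D n) cbox _ => x Dx i.
rewrite /= in_itv/= -ler_norml; apply: Dr.
exact: interior_subset (core_interior _ _ _ Dx).
Qed.

Lemma measurable_core D n : measurable (core D n).
Proof.
rewrite -[core D n]setCK; apply: measurableC; apply: measurable_open_rV.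
by apply: closed_openC; exact: closed_core.
Qed.

End perturbation.

(** * Variance bound in the limit of an exhaustion *)

Section exhaustion.
Local Open Scope ereal_scope.
Context d (T : measurableType d) (R : realType).

(** The constant [k] depends on [n] and [h] may be unbounded. A fixed [K n0] of positive measure, on
    which [h] is bounded, confines these constants; this gives square integrability, and with it an
    integrable function dominating every [(h - k) ^+ 2]. *)
Lemma variance_le_of_exhaustion (nu : probability T R) (D : set T)
    (K : (set T)^nat) (h : T -> R) (S : R) :
  measurable D -> nu D = 1 -> (forall n, measurable (K n)) -> nondecreasing_seq K ->
  (forall n, K n `<=` D) -> nu (D `\` \bigcup_n K n) = 0 -> measurable_fun D h ->
  (forall n, exists M, forall x, K n x -> (`|h x| <= M)%R) -> (0 <= S)%R ->
  (forall n, 0 < nu (K n) -> exists k, \int[nu]_(x in K n) ((h x - k) ^+ 2)%:E <= S%:E) ->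
  \int[nu]_(x in D) (h x ^+ 2)%:E - ((\int[nu]_(x in D) h x)%R ^+ 2)%:E <= S%:E.
Proof.
move=> mD nuD mK ndK KD N0 mh bdh S0 HS.
have mhK n : measurable_fun (K n) h by exact: measurable_funS (mh).
have mKoo : measurable (\bigcup_n K n) by exact: bigcup_measurable.
have KooD : \bigcup_n K n `<=` D by move=> x [n _ /KD].
have full (f : T -> R) : measurable_fun D f -> (forall x, 0 <= f x)%R ->
    \int[nu]_(x in K n) (f x)%:E @[n --> \oo] --> \int[nu]_(x in D) (f x)%:E.
  move=> mf f0.
  rewrite (@ge0_negligible_integral _ _ _ nu D (D `\` \bigcup_n K n))//; last 3 first.
  - exact: measurableD.
  - exact/measurable_EFinP.
  - by move=> x _; rewrite lee_fin.
  rewrite setDD (setIidr KooD); apply: ge0_nondecreasing_set_cvg_integral => //.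
  - by move=> n; apply/measurable_EFinP; exact: measurable_funS mf.
  - by move=> n x _; rewrite lee_fin.
have fK (f : T -> R) n : measurable_fun D f -> measurable_fun (K n) f.
  by move=> mf; exact: measurable_funS mf.
(* Otherwise the measures of the [K n], all zero, would converge to [nu D = 1]. *)
have [n0 n0P] : exists n, 0 < nu (K n).
  apply: contrapT => /forallNP nK.
  have int1 A : measurable A -> \int[nu]_(x in A) ((cst 1%R : T -> R) x)%:E = nu A.
    by move=> mA; rewrite -[RHS]mul1e -(integral_cst nu mA).
  have := full (cst 1%R) (measurable_cst _) (fun=> ler01).
  rewrite int1// nuD (_ : (fun n => _) = cst 0) => [/cvg_lim|]; last first.
    apply/funext => n; rewrite int1//.
    by apply/eqP; rewrite eq_le measure_ge0 leNgt andbT; exact/negP/nK.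
  rewrite lim_cst// => /(_ (@ereal_hausdorff R)) /eqP.
  by rewrite eqe eq_sym oner_eq0.
have m0E : nu (K n0) = (fine (nu (K n0)))%:E by rewrite fineK// fin_num_measure.
set m0 := fine (nu (K n0)) in m0E.
have m00 : (0 < m0)%R by rewrite -lte_fin -m0E.
have [M0 HM0] := bdh n0; pose M := `|M0|%R.
(* Integrating [k ^+ 2 <= 2 * (h - k) ^+ 2 + 2 * h ^+ 2] over [K n0], of measure [m0], bounds
   [k ^+ 2] by this number. *)
pose B : R := ((2 * S + 2 * M ^+ 2) / m0)%R.
have B0 : (0 <= B)%R.
  by apply: divr_ge0; [rewrite addr_ge0// mulr_ge0// sqr_ge0|exact: ltW].
have nu_le1 A : measurable A -> nu A <= 1 by exact: probability_le1.
have HS' n : (n0 <= n)%N -> exists2 k, (k ^+ 2 <= B)%R &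
    \int[nu]_(x in K n) ((h x - k) ^+ 2)%:E <= S%:E.
  move=> n0n; have Kn0n : K n0 `<=` K n by apply/subsetPset; exact: ndK.
  have [k kS] : exists k, \int[nu]_(x in K n) ((h x - k) ^+ 2)%:E <= S%:E.
    apply: HS; apply: (lt_le_trans n0P); apply: le_measure; rewrite ?inE//.
  exists k => //.
  have mhk A : measurable A -> A `<=` D -> measurable_fun A (fun x => ((h x - k) ^+ 2)%:E).
    move=> mA AD; apply/measurable_EFinP; apply: measurable_funX.
    by apply: measurable_funB => //; exact: measurable_funS mh.
  have : \int[nu]_(x in K n0) (k ^+ 2)%:E <=
      \int[nu]_(x in K n0) (2%:E * ((h x - k) ^+ 2)%:E + (2 * M ^+ 2)%:E).
    apply: ge0_le_integral => //.
    - by move=> x _; rewrite lee_fin sqr_ge0.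
    - by apply: emeasurable_funD => //; apply: measurable_funeM; apply: mhk.
    - move=> x Kx; rewrite -EFinM -EFinD lee_fin.
      have hM : (`|h x| <= M)%R by apply: le_trans (HM0 x Kx) _; exact: ler_norm.
      have hM2 : (h x ^+ 2 <= M ^+ 2)%R.
        by rewrite -(real_normK (num_real (h x))) lerXn2r// nnegrE normr_ge0.
      by have := sqr_ge0 (2 * h x - k)%R; lra.
  rewrite integral_cst// ge0_integralD//; last 3 first.
  - by move=> x _; rewrite -EFinM lee_fin mulr_ge0// sqr_ge0.
  - by apply: measurable_funeM; exact: mhk.
  - by move=> x _; rewrite lee_fin mulr_ge0// sqr_ge0.
  rewrite integral_cst// ge0_integralZl//; last 2 first.
  - exact: mhk.
  - by move=> x _; rewrite lee_fin sqr_ge0.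
  move=> /le_trans le1.
  have : (k ^+ 2)%:E * nu (K n0) <= 2%:E * S%:E + (2 * M ^+ 2)%:E * 1.
    apply: le1; apply: leeD.
      rewrite lee_pmul2l//; apply: le_trans kS; apply: ge0_subset_integral => //.
      - exact: mhk.
      - by move=> x _; rewrite lee_fin sqr_ge0.
    by rewrite lee_wpmul2l ?nu_le1// lee_fin mulr_ge0// sqr_ge0.
  by rewrite m0E mule1 -!EFinM -EFinD lee_fin -ler_pdivlMr.
have mh2 : measurable_fun D (fun x => (h x ^+ 2)%R) by exact: measurable_funX.
have h20 x : (0 <= h x ^+ 2)%R by exact: sqr_ge0.
(* The same inequality with [h] and [k] exchanged, integrated over [K n], gives a bound independent
   of [n]. *)
have h2B : \int[nu]_(x in D) (h x ^+ 2)%:E <= (2 * S + 2 * B)%:E.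
  rewrite -(cvg_lim _ (full _ mh2 h20))//; apply: lime_le; first exact: (cvgP _ (full _ mh2 h20)).
  near=> n; have n0n : (n0 <= n)%N by near: n; exact: nbhs_infty_ge.
  have [k kB kS] := HS' n n0n.
  have mhk : measurable_fun (K n) (fun x => ((h x - k) ^+ 2)%:E).
    by apply/measurable_EFinP; apply: measurable_funX; exact: measurable_funB.
  apply: (@le_trans _ _ (\int[nu]_(x in K n) (2%:E * ((h x - k) ^+ 2)%:E + (2 * B)%:E))).
    apply: ge0_le_integral => //.
    - by move=> x _; rewrite lee_fin.
    - exact/measurable_EFinP/fK.
    - by apply: emeasurable_funD => //; exact: measurable_funeM.
    - move=> x _; rewrite -EFinM -EFinD lee_fin.
      by have := sqr_ge0 (h x - 2 * k)%R; lra.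
  rewrite ge0_integralD//; last 3 first.
  - by move=> x _; rewrite -EFinM lee_fin mulr_ge0// sqr_ge0.
  - exact: measurable_funeM.
  - by move=> x _; rewrite lee_fin mulr_ge0.
  rewrite integral_cst// ge0_integralZl//; last by move=> x _; rewrite lee_fin sqr_ge0.
  rewrite [leRHS]EFinD; apply: leeD; first by rewrite EFinM lee_pmul2l.
  by rewrite -[leRHS]mule1 lee_wpmul2l ?nu_le1// lee_fin mulr_ge0.
have ih2 : nu.-integrable D (EFin \o (fun x => (h x ^+ 2)%R)).
  apply/integrableP; split; first exact/measurable_EFinP.
  under eq_integral do rewrite /= ger0_norm ?sqr_ge0//.
  by apply: le_lt_trans h2B _; rewrite ltry.
have Doo : nu D < +oo by rewrite nuD ltry.
have icst (r : R) : nu.-integrable D (EFin \o (fun=> r)) by exact: finite_measure_integrable_cst.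
have ih : nu.-integrable D (EFin \o h).
  have i1 : nu.-integrable D (EFin \o (fun x => (1 + h x ^+ 2)%R)).
    exact: (integrableD mD (icst 1%R) ih2).
  apply: le_integrable i1 => //; first exact/measurable_EFinP.
  move=> x Dx; rewrite /= lee_fin.
  have hx2 : (`|h x| ^+ 2 = h x ^+ 2)%R by rewrite real_normK ?num_real.
  rewrite (ger0_norm (_ : 0 <= 1 + h x ^+ 2)%R); last by rewrite addr_ge0.
  by rewrite -hx2; have := sqr_ge0 (`|h x| - 1)%R; have := normr_ge0 (h x); nra.
set e := \int[nu]_(x in D) (h x ^+ 2)%:E; set b := (\int[nu]_(x in D) h x)%R.
have eE : e = (fine e)%:E by rewrite fineK// (integrable_fin_num mD ih2).
(* Dominates [(h - k) ^+ 2] for every [k] with [k ^+ 2 <= B], and so controls the part outside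
   [K n]. *)
pose phi x := (2 * h x ^+ 2 + 2 * B)%R.
have phi0 x : (0 <= phi x)%R by rewrite addr_ge0// mulr_ge0.
have mphi : measurable_fun D phi.
  apply: measurable_funD; last exact: measurable_cst.
  by apply: measurable_funM.
have iphi : nu.-integrable D (EFin \o phi).
  have := integrableD mD (integrableZl mD 2 ih2) (icst (2 * B)%R).
  by apply: eq_integrable.
have PhiE : \int[nu]_(x in D) (phi x)%:E = (fine (\int[nu]_(x in D) (phi x)%:E))%:E.
  by rewrite fineK// (integrable_fin_num mD iphi).
(* The integral of [phi] over [K n] is added to both sides, so that the limit only involves
   integrals over increasing sets. *)
have key n : (n0 <= n)%N -> (fine e - b ^+ 2)%:E + \int[nu]_(x in K n) (phi x)%:E <=
    S%:E + \int[nu]_(x in D) (phi x)%:E.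
  move=> n0n; have [k kB kS] := HS' n n0n.
  have mhk A : measurable A -> A `<=` D -> measurable_fun A (fun x => ((h x - k) ^+ 2)%:E).
    move=> mA AD; apply/measurable_EFinP; apply: measurable_funX.
    by apply: measurable_funB => //; exact: measurable_funS mh.
  have mDK : measurable (D `\` K n) by exact: measurableD.
  have DKD : D `\` K n `<=` D by exact: subDsetl.
  have split (f : T -> R) : measurable_fun D f -> (forall x, 0 <= f x)%R ->
      \int[nu]_(x in D) (f x)%:E =
      \int[nu]_(x in K n) (f x)%:E + \int[nu]_(x in D `\` K n) (f x)%:E.
    move=> mf f0; rewrite -{1}(setDUK (KD n)) ge0_integral_setU//.
    - by rewrite (setDUK (KD n)); exact/measurable_EFinP.
    - by move=> x _; rewrite lee_fin.
    - by apply/disj_setPS => x [? []].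
  have hkD : \int[nu]_(x in D) ((h x - k) ^+ 2)%:E <= S%:E + \int[nu]_(x in D `\` K n) (phi x)%:E.
    rewrite split; [|by apply/measurable_EFinP; exact: mhk|by move=> x; exact: sqr_ge0].
    apply: leeD => //; apply: ge0_le_integral => //.
    - by move=> x _; rewrite lee_fin sqr_ge0.
    - exact: mhk.
    - by apply/measurable_EFinP; exact: measurable_funS mphi.
    - move=> x _; rewrite lee_fin /phi; have := sqr_ge0 (h x + k)%R; lra.
  (* As [nu D = 1], the two sides differ by [(b - k) ^+ 2]. *)
  have var : (fine e - b ^+ 2)%:E <= \int[nu]_(x in D) ((h x - k) ^+ 2)%:E.
    have i1 : nu.-integrable D (EFin \o (fun x => (- 2 * k * h x)%R)).
      by have := integrableZl mD (- 2 * k)%R ih; apply: eq_integrable.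
    have i2 : nu.-integrable D (EFin \o (fun x => (h x ^+ 2 + - 2 * k * h x)%R)).
      by have := integrableD mD ih2 i1; apply: eq_integrable.
    have i3 : nu.-integrable D (EFin \o (fun x => (h x ^+ 2 + - 2 * k * h x + k ^+ 2)%R)).
      by have := integrableD mD i2 (icst (k ^+ 2)%R); apply: eq_integrable.
    have -> : \int[nu]_(x in D) ((h x - k) ^+ 2)%:E =
        (\int[nu]_(x in D) (h x ^+ 2 + - 2 * k * h x + k ^+ 2)%R)%:E.
      rewrite /Rintegral fineK; last exact: integrable_fin_num i3.
      by apply: eq_integral => x _; congr EFin; ring.
    rewrite (RintegralD mD i2 (icst (k ^+ 2)%R)) (RintegralD mD ih2 i1).
    rewrite (RintegralZl _ mD ih) (Rintegral_cst _ mD) -/b.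
    rewrite (_ : fine (nu D) = 1%R); last by rewrite nuD.
    rewrite lee_fin /Rintegral -/e.
    have := sqr_ge0 (b - k)%R; lra.
  have gen (x u s v : \bar R) : x <= s + v -> x + u <= s + (u + v).
    by move=> xsv; rewrite (addeC u) addeA; exact: leeD.
  by rewrite (split phi)//; apply: gen; exact: le_trans var hkD.
have : \int[nu]_(x in D) (phi x)%:E <= (S - (fine e - b ^+ 2))%:E + \int[nu]_(x in D) (phi x)%:E.
  rewrite -{1}(cvg_lim _ (full _ mphi phi0))//; apply: lime_le;
    first exact: (cvgP _ (full _ mphi phi0)).
  near=> n; have n0n : (n0 <= n)%N by near: n; exact: nbhs_infty_ge.
  have := key n n0n; rewrite PhiE -EFinD.
  move=> h1; rewrite -EFinD -(@leeD2lE _ (fine e - b ^+ 2)%:E)//.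
  by apply: (le_trans h1); rewrite -EFinD lee_fin; lra.
rewrite PhiE -EFinD lee_fin => h1.
by rewrite eE -EFinB lee_fin; lra.
Unshelve. all: by end_near. Qed.

End exhaustion.

(** * Coordinates of points in a Euclidean ball *)

Section euclidean_ball.
Context (R : realType) (d : nat).
Implicit Types (x : 'rV[R]_d) (r : R).

Lemma dotp_le_of_enorm x r : enorm x <= r -> dotp x x <= r ^+ 2.
Proof.
move=> xr; have r0 : 0 <= r by apply: le_trans xr; exact: sqrtr_ge0.
by rewrite -(sqr_sqrtr (dotp_ge0 R d x)) lerXn2r// nnegrE sqrtr_ge0.
Qed.

Lemma coord_le_of_enorm x r i : enorm x <= r -> `|x ord0 i| <= r.
Proof.
move=> xr; have r0 : 0 <= r by apply: le_trans xr; exact: sqrtr_ge0.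
rewrite -(@ler_pXn2r _ 2)// ?nnegrE// real_normK ?num_real//.
apply: le_trans (dotp_le_of_enorm x r xr).
rewrite /dotp (bigD1 i)//= -expr2 lerDl; apply: sumr_ge0 => j _.
by rewrite -expr2 sqr_ge0.
Qed.

End euclidean_ball.

(** * The inequality for a log-concave probability measure *)

Section log_concave.
Context (R : realType) (d : nat) (r : R) (nu : probability 'rV[R]_d R).
Context (Omega : set 'rV[R]_d) (W h : 'rV[R]_d -> R).
Local Notation lam := (lebesgue_rV R d).
Hypothesis mO : measurable Omega.
Hypothesis bO : forall x, Omega x -> enorm x <= r.
Hypothesis lcO : log_concave nu Omega W.
Hypothesis smO : smooth_on Omega (fun x => expR (- W x)).
Hypothesis ckh : Ck_on 1 Omega h.

Lemma probability_support : nu Omega = 1%E.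
Proof.
have [_ _ dens] := lcO.
by rewrite -(@probability_setT _ _ _ nu) (dens _ mO) (dens _ measurableT) setTI setIid.
Qed.

Lemma measurable_density : measurable_fun Omega (fun x => expR (- W x)).
Proof. by apply: measurable_fun_within => //; have [] := smO 0%N. Qed.

Lemma probability_null A : measurable A -> A `<=` Omega -> lam A = 0%E -> nu A = 0%E.
Proof.
have [_ _ dens] := lcO; move=> mA AO A0; rewrite dens// (setIidl AO).
apply: null_set_integral => //; apply/measurable_EFinP.
exact: measurable_funS measurable_density.
Qed.

Lemma lebesgue_support_lty : (lam Omega < +oo)%E.
Proof.
by apply: (bounded_lebesgue_rV_lty _ _ _ r) => // x i Ox; apply: coord_le_of_enorm; exact: bO.
Qed.

Lemma interior_support_neq0 : Omega° !=set0.
Proof.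
have [cO _ _] := lcO; apply: convex_interior_neq0 => //; apply/eqP => O0.
have := probability_support; rewrite (probability_null _ mO (fun _ => id) O0).
by move=> /eqP; rewrite eqe eq_sym oner_eq0.
Qed.

Lemma probability_boundary : nu (Omega `\` Omega°) = 0%E.
Proof.
have [cO _ _] := lcO; apply: probability_null.
- by apply: measurableD => //; apply: measurable_open_rV; exact: open_interior.
- exact: subDsetl.
- apply: lebesgue_rV_boundary => //; [exact: lebesgue_support_lty|exact: interior_support_neq0].
Qed.

(** A set with interior points has a coordinate that is not constantly zero. This makes
    [(2 * r ^+ 2)^-1] positive; for [r = 0] it would be 0 by convention. *)
Lemma radius_gt0 : (0 < d)%N -> 0 < r.
Proof.
move=> d0; have [z /nbhs_ballP[e /= e0 ze]] := interior_support_neq0.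
rewrite ltNge; apply/negP => r0; pose i := Ordinal d0.
have zero x : Omega x -> x ord0 i = 0.
  move=> Ox; apply/eqP; rewrite -normr_le0; apply: le_trans r0.
  by apply: coord_le_of_enorm; exact: bO.
have : Omega (z + (e / 2) *: delta_mx ord0 i).
  apply: ze; apply/(ball_rVP _ _ _ _ _ e0) => j.
  rewrite !mxE opprD addrA subrr sub0r normrN normrM gtr0_norm ?divr_gt0//.
  case: (j == i); rewrite ?andbT ?andbF /= ?normr1 ?normr0 ?mulr1 ?mulr0//; move: e0; lra.
have z0 : z ord0 i = 0 by apply: zero; apply: ze; exact: ballxx.
by move=> /zero; rewrite !mxE !eqxx mulr1 z0 add0r => e2; move: e0; lra.
Qed.

Let Q x := dual_qform R d (((2 * r ^+ 2)^-1)%:M + hess_on Omega W x) (grad_on Omega h x).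

Lemma log_concave_variance_le : (0 < d)%N ->
  (variance_on nu Omega h <= 2%:E * \int[nu]_(x in Omega) (Q x)%:E)%E.
Proof.
move=> d0; have [cO cW dens] := lcO; have r0 := radius_gt0 d0.
pose U := Omega°; pose c := (2 * r ^+ 2)^-1.
have c0 : 0 < c by rewrite invr_gt0 mulr_gt0// exprn_gt0.
have oU : open U by exact: open_interior.
have mU : measurable U by exact: measurable_open_rV.
have UO : U `<=` Omega by exact: interior_subset.
have [ch C1h] := Ck_on1_interior R d Omega h ckh.
have [cp C2p] := smooth_on_interior R d Omega _ smO.
have WE : W = fun x => - ln (expR (- W x)) by apply/funext => x; rewrite expRK opprK.
have C2W : C2_on R d U W by rewrite WE; apply: C2_on_neg_ln => // x; exact: expR_gt0.
have cWU : cont_on R d U W.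
  rewrite WE => x Ux; apply: continuousN; apply: continuous_comp; first exact: cp.
  by apply: continuous_ln; exact: expR_gt0.
have midW x y : U x -> U y -> 2 * W (2^-1 *: (x + y)) <= W x + W y.
  by move=> /UO Ox /UO Oy; exact: convex_function_midpoint cW Ox Oy.
have QE x : U x -> Q x = bl_qform R d h W c x.
  by move=> Ux; rewrite /Q hess_on_interior// grad_on_interior.
have Q0 x : U x -> 0 <= Q x.
  by move=> Ux; rewrite QE//; exact: (bl_qform_ge0 _ _ U).
have coreU n : core R d Omega n `<=` U by exact: core_interior.
have coreO n : core R d Omega n `<=` Omega by exact: subset_trans (coreU n) UO.
have mN : measurable (Omega `\` U) by exact: measurableD.
have ONE : Omega `\` (Omega `\` U) = U by rewrite setDD (setIidr UO).
have coreQ n : (\int[nu]_(x in core R d Omega n) (Q x)%:E <= \int[nu]_(x in Omega) (Q x)%:E)%E.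
  apply: (@le_integral_off_null _ _ _ nu Omega (Omega `\` U)) => //.
  - exact: probability_boundary.
  - by rewrite ONE.
  - by rewrite ONE => x Ux; rewrite lee_fin Q0.
have S0 : (0 <= \int[nu]_(x in Omega) (Q x)%:E)%E.
  apply: le_trans (coreQ 0%N); apply: integral_ge0 => x /coreU Ux.
  by rewrite lee_fin Q0.
(* An infinite right-hand side is trivial; a finite one is a single real bound for all cores. *)
have [->|Soo] := eqVneq (\int[nu]_(x in Omega) (Q x)%:E)%E +oo%E.
  by rewrite gt0_muley ?leey// lte_fin.
have SE : (\int[nu]_(x in Omega) (Q x)%:E)%E = (fine (\int[nu]_(x in Omega) (Q x)%:E))%:E.
  by rewrite fineK// ge0_fin_numE// lt_neqAle Soo leey.
set S := fine _ in SE; rewrite SE -EFinM.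
have S_ge0 : 0 <= S by rewrite -lee_fin -SE.
apply: (variance_le_of_exhaustion _ _ _ _ _ (core R d Omega)) => //.
- exact: probability_support.
- by move=> n; exact: measurable_core.
- exact: core_nondecreasing.
- by rewrite bigcup_core; exact: probability_boundary.
- by apply: measurable_fun_within => //; have [] := ckh.
- move=> n; apply: cont_on_bounded; last exact: cont_onS (coreU n) ch.
  by apply: (core_compact _ _ _ _ r) => x i Ox; apply: coord_le_of_enorm; exact: bO.
- by rewrite mulr_ge0.
move=> n nuK; set K := core R d Omega n.
have mK : measurable K by exact: measurable_core.
have cK : compact K.
  by apply: (core_compact _ _ _ _ r) => x i Ox; apply: coord_le_of_enorm; exact: bO.
have Koo : (lam K < +oo)%E.
  apply: le_lt_trans lebesgue_support_lty; apply: le_measure; rewrite ?inE//.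
  exact: coreO.
(* The exhaustion supplies cores of positive [nu]-measure, and [nu] is absolutely continuous. *)
have K0 : (0 < lam K)%E.
  rewrite lt0e measure_ge0 andbT; apply/eqP => K0.
  by move: nuK; rewrite (probability_null K mK (coreO n) K0) ltxx.
have lamK : (0 < lam K < +oo)%E by rewrite K0.
have midK x y : K x -> K y -> K (2^-1 *: (x + y)) by exact: core_midpoint.
have n0 : 0 < n.+1%:R^-1 :> R by [].
have ballK z : K z -> ball z n.+1%:R^-1 `<=` U by exact: core_ball_interior.
have cr x : K x -> c / 2 * dotp x x <= 4^-1.
  move=> /coreO/bO/dotp_le_of_enorm xr.
  apply: (@le_trans _ _ (c / 2 * r ^+ 2)).
    by rewrite ler_wpM2l// divr_ge0// ltW.
  rewrite le_eqVlt; apply/orP; left; apply/eqP; rewrite /c; field.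
  by rewrite gt_eqF.
have [k Hk] := variance_le_perturbed R d U K h W c _ oU (coreU n) mK cK lamK midK n0
  ballK ch C1h cWU C2W midW c0 cr.
exists k.
have cQ : cont_on R d U (bl_qform R d h W c) by exact: cont_on_bl_qform.
have cexp : cont_on R d K (fun x => expR (- W x)).
  by apply: cont_on_expR; apply: cont_onN; exact: cont_onS (coreU n) cWU.
have dE (F : 'rV[R]_d -> R) : cont_on R d K F -> (forall x, K x -> 0 <= F x) ->
    (\int[nu]_(x in K) (F x)%:E = (\int[lam]_(x in K) (F x * expR (- W x))%R)%:E)%E.
  move=> cF F0.
  rewrite (integral_density _ _ _ lam nu Omega K (fun x => expR (- W x)) F)//.
  - rewrite /Rintegral fineK//; apply: (integrable_fin_num mK).
    by apply: cont_on_integrable => //; exact: cont_onM.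
  - exact: measurable_density.
  - exact: coreO.
  - by apply: measurable_fun_within => //; exact: cont_on_within.
rewrite dE; last 2 first.
- apply: cont_onM; apply: cont_onD; try exact: cont_on_cst; exact: cont_onS (coreU n) ch.
- by move=> x _; exact: sqr_ge0.
rewrite lee_fin; apply: (le_trans Hk); rewrite ler_pM2l// -lee_fin -SE.
apply: le_trans (coreQ n); rewrite -dE.
- rewrite le_eqVlt; apply/orP; left; apply/eqP; apply: eq_integral => x; rewrite inE => Kx.
  by rewrite QE//; exact: (coreU n).
- exact: cont_onS (coreU n) cQ.
- by move=> x Kx; apply: (bl_qform_ge0 _ _ U) => //; exact: (coreU n).
Qed.

(** The space is a single point, so [h] is constant. *)
Lemma variance_on_rV0 : d = 0%N -> variance_on nu Omega h = 0%E.
Proof.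
move=> d0; have hE : h = cst (h 0).
  by apply/funext => x; congr h; apply/rowP => i; have := ltn_ord i; rewrite [X in (_ < X)%N]d0.
rewrite /variance_on hE /=.
have nu1 := probability_support.
rewrite (integral_cst nu mO) (Rintegral_cst _ mO).
by rewrite [X in fine X]nu1 [X in (_ * X)%E]nu1/= mule1 mulr1 subee.
Qed.

End log_concave.

Theorem theorem3p3 (R : realType) (d : nat) (r : R)
    (nu : probability 'rV[R]_d R) (Omega : set 'rV[R]_d)
    (W h : 'rV[R]_d -> R) :
  measurable Omega ->
  (forall x, Omega x -> enorm x <= r) ->
  log_concave nu Omega W ->
  smooth_on Omega (fun x => expR (- W x)) ->
  barycenter nu = 0 ->
  Ck_on 1 Omega h ->
  (variance_on nu Omega h <=
   2%:E * \int[nu]_(x in Omega)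
     (dotp ((invmx (((2 * r ^+ 2)^-1)%:M + hess_on Omega W x)
               *m (grad_on Omega h x)^T)^T)
           (grad_on Omega h x))%:E)%E.
Proof.
(* In dimension 0 the radius may be 0, but both sides vanish. *)
move=> mO bO lcO smO _ ckh; have [d0|d0] := posnP d.
  rewrite (variance_on_rV0 R d nu Omega W h)// integral0_eq ?mule0// => x _.
  by rewrite /dotp big1// => i; have := ltn_ord i; rewrite [X in (_ < X)%N]d0.
exact: log_concave_variance_le.
Qed.
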